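(* (Nonuniqueness of the inverse problem in the presence of a black hole.) Let $L_1$ and $L_2$ be two operators on $\Omega\times\mathbb R$ of the type described in the context, with ergosphere $S_\Delta$, that differ only in $\Omega_{int}$, i.e. $L_1=L_2$ in $\Omega\cap\Omega_{ext}$. Assume that there are no obstacles between $\partial\Omega_0$ and $S_\Delta$, that $S_\Delta$ is a characteristic surface, i.e. $\sum_{j,k=1}^n g^{jk}\nu_j\nu_k=0$ on $S_\Delta$, and that $\sum_{j=1}^n g^{j0}\nu_j<0$ on $S_\Delta$, where $\nu$ is the normal to $S_\Delta$ pointing out of $\Omega_{int}$. Let $f$ have compact support in $\partial\Omega\times\mathbb R$ and, for $i=1,2$, let $u_i$ be the solution of the initial-boundary value problem $$L_iu_i=0\ \text{ in }\Omega\times\mathbb R,\qquad u_i=0\ \text{ for }x\in\Omega,\ x_0\ll0,\qquad u_i|_{\partial\Omega\times\mathbb R}=f,$$ with the same $f$ for $i=1$ and $i=2$. Then $u_1=u_2$ in $(\Omega\cap\Omega_{ext})\times\mathbb R$. Therefore the Dirichlet-to-Neumann operators coincide, $\Lambda_1=\Lambda_2$ on $\partial\Omega_0\times\mathbb R$. Since $L_1\ne L_2$ in $\Omega_{int}$ is allowed, the inverse problem of recovering the operator from $\Lambda$ on $\partial\Omega_0\times\mathbb R$ does not have a unique solution.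
   Context: Domain: $\Omega=\Omega_0\setminus\bigcup_{j=1}^m\overline{\Omega_j}\subset\mathbb R^n$ (possibly without obstacles), where $\Omega_0$ is a bounded simply connected domain with smooth boundary and the $\Omega_j$ (''obstacles'') are smooth domains with pairwise disjoint closures contained in $\Omega_0$. Operators: with $x_0\in\mathbb R$ the time variable and $x=(x_1,\dots,x_n)$, $$Lu=\sum_{j,k=0}^n\frac{1}{\sqrt{(-1)^n g(x)}}\frac{\partial}{\partial x_j}\Big(\sqrt{(-1)^n g(x)}\,g^{jk}(x)\frac{\partial u}{\partial x_k}\Big),$$ where $[g^{jk}(x)]_{j,k=0}^n$ is a real symmetric matrix, smooth on $\overline\Omega$ and independent of $x_0$, $g(x)=(\det[g^{jk}(x)]_{j,k=0}^n)^{-1}$, the quadratic form $\sum_{j,k=0}^n g^{jk}(x)\xi_j\xi_k$ has signature $(1,-1,\dots,-1)$ for all $x\in\overline\Omega$, and $g^{00}(x)>0$ on $\overline\Omega$. Ergosphere: $\Delta(x)=\det[g^{jk}(x)]_{j,k=1}^n$ and $S_\Delta=\{x:\Delta(x)=0\}$, assumed to be a smooth closed surface lying in $\Omega$. $\Omega_{int}$ and $\Omega_{ext}$ are the interior and the exterior of $S_\Delta$. It is assumed that $(-1)^n\Delta(x)>0$ in $\overline\Omega\cap\Omega_{ext}$ and $(-1)^n\Delta(x)<0$ in $\overline\Omega\cap\Omega_{int}$. Dirichlet-to-Neumann operator on $\partial\Omega_0\times\mathbb R$: with $N_0=0$ and $(N_1,\dots,N_n)$ the unit outward normal to $\partial\Omega_0$,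 $$\Lambda f=\sum_{j,k=0}^n g^{jk}(x)\frac{\partial u}{\partial x_j}N_k(x)\Big(-\sum_{p,r=1}^n g^{pr}(x)N_pN_r\Big)^{-1/2}\Big|_{\partial\Omega_0\times\mathbb R},$$ where $u$ is the solution of the initial-boundary value problem with boundary data $f$; $\Lambda_i$ is this operator for $L_i$. *)

(* Defs.v *)
From mathcomp Require Export all_boot all_order all_algebra.
From mathcomp Require Export all_classical all_reals all_analysis.

Set Implicit Arguments.
Unset Strict Implicit.
Unset Printing Implicit Defensive.

Export Order.TTheory GRing.Theory Num.Theory.
Export numFieldNormedType.Exports.

Local Open Scope classical_set_scope.
Local Open Scope ring_scope.

(* Functions on R^d are total; all derivatives below are only used on open
   sets, where they do not depend on the values taken elsewhere. *)
Section Calculus.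
Context {R : realType} {d : nat}.
Implicit Types (U D S : set 'rV[R]_d) (f : 'rV[R]_d -> R).

Definition partial (i : 'I_d) f : 'rV[R]_d -> R :=
  fun x => 'D_(delta_mx ord0 i) f x.

Definition grad f (x : 'rV[R]_d) : 'rV[R]_d := \row_i partial i f x.

Fixpoint Ck (k : nat) U f : Prop :=
  (forall x, U x -> {for x, continuous f}) /\
  match k with
  | 0 => True
  | k'.+1 => forall i : 'I_d,
      (forall x, U x -> derivable f x (delta_mx ord0 i)) /\
      Ck k' U (partial i f)
  end.

Definition smooth U f : Prop := forall k, Ck k U f.

Definition boundary D : set 'rV[R]_d := closure D `\` interior D.

Definition defining_function D U f : Prop :=
  [/\ open U, smooth U f, (forall x, U x -> grad f x <> 0)
    & forall x, U x -> (D x <-> f x < 0)].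

Definition smooth_boundary D : Prop :=
  forall p, boundary D p -> exists U f, U p /\ defining_function D U f.

(* The norm of 'rV[R]_d is the sup norm, hence the explicit sum of squares. *)
Definition outward_normal D (p v : 'rV[R]_d) : Prop :=
  \sum_(i < d) v ord0 i ^+ 2 = 1 /\
  exists U f, [/\ U p, defining_function D U f
    & exists2 c : R, 0 < c & grad f p = c *: v].

Definition simply_connected D : Prop :=
  connected D /\
  forall gamma : R -> 'rV[R]_d,
    {within `[0, 1], continuous gamma} ->
    (forall t, 0 <= t <= 1 -> D (gamma t)) -> gamma 0 = gamma 1 ->
    exists H : R * R -> 'rV[R]_d,
      [/\ {within [set st | 0 <= st.1 <= 1 /\ 0 <= st.2 <= 1], continuous H},
          (forall s t, 0 <= s <= 1 -> 0 <= t <= 1 -> D (H (s, t))),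
          (forall t, 0 <= t <= 1 -> H (0, t) = gamma t),
          (forall t, 0 <= t <= 1 -> H (1, t) = gamma 0)
        & forall s, 0 <= s <= 1 -> H (s, 0) = gamma 0 /\ H (s, 1) = gamma 0].

Definition closed_surface S : Prop :=
  [/\ S !=set0, compact S, connected S
    & forall p, S p -> exists U f,
        [/\ U p, open U, smooth U f, (forall x, U x -> grad f x <> 0)
          & forall x, U x -> (S x <-> f x = 0)]].

(* Interior and exterior of a closed surface: the union of the bounded,
   resp. unbounded, connected components of its complement. *)
Definition surf_int S : set 'rV[R]_d :=
  [set x | ~ S x /\ bounded_set (connected_component (~` S) x)].

Definition surf_ext S : set 'rV[R]_d :=
  [set x | ~ S x /\ ~ bounded_set (connected_component (~` S) x)].

End Calculus.

Section Domain.
Context {R : realType} {n m : nat}.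

Definition obstacle_domain (Omega0 : set 'rV[R]_n)
    (O : 'I_m -> set 'rV[R]_n) : Prop :=
  [/\ [/\ Omega0 !=set0, open Omega0, bounded_set Omega0,
          simply_connected Omega0 & smooth_boundary Omega0],
      (forall j, [/\ O j !=set0, open (O j), connected (O j)
                   & smooth_boundary (O j)]),
      (forall j, closure (O j) `<=` Omega0)
    & forall i j, i != j -> closure (O i) `&` closure (O j) = set0].

Definition remove_obstacles (Omega0 : set 'rV[R]_n)
    (O : 'I_m -> set 'rV[R]_n) : set 'rV[R]_n :=
  Omega0 `\` \bigcup_j closure (O j).

End Domain.

(* A point z of space-time is a row (x_0, x_1, ..., x_n); the index [ord0] is
   the time direction and [lift ord0 j] is the j-th space direction. An
   operator L is given by its coefficient matrix x |-> [g^{jk}(x)]_{j,k=0}^n,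
   a function of the space variable only. *)
Section WaveOperator.
Context {R : realType} {n : nat}.
Implicit Types (Omega D S : set 'rV[R]_n) (G : 'rV[R]_n -> 'M[R]_n.+1).
Implicit Types (z : 'rV[R]_n.+1) (f u : 'rV[R]_n.+1 -> R).

Definition time z : R := z ord0 ord0.

Definition space z : 'rV[R]_n := col' ord0 z.

Definition cylinder D : set 'rV[R]_n.+1 := [set z | D (space z)].

(* sqrt((-1)^n g) with g = (det [g^{jk}])^{-1} *)
Definition density G (x : 'rV[R]_n) : R :=
  Num.sqrt ((-1) ^+ n * (\det (G x))^-1).

Definition waveop G u z : R :=
  \sum_(j < n.+1) \sum_(k < n.+1)
    (density G (space z))^-1 *
    partial j (fun w => density G (space w) * G (space w) j k * partial k u w) z.

Definition Delta G (x : 'rV[R]_n) : R := \det (row' ord0 (col' ord0 (G x))).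

Definition spatial_form G (x v : 'rV[R]_n) : R :=
  \sum_(j < n) \sum_(k < n)
    G x (lift ord0 j) (lift ord0 k) * v ord0 j * v ord0 k.

Definition lorentz_signature (A : 'M[R]_n.+1) : Prop :=
  exists2 P : 'M[R]_n.+1, P \in unitmx &
    P *m A *m P^T = diag_mx (\row_j (if j == ord0 then 1 else -1)).

Definition wave_coefficients Omega G : Prop :=
  [/\ (exists2 U, open U /\ closure Omega `<=` U &
         forall j k, smooth U (fun x => G x j k)),
      (forall x, closure Omega x -> (G x)^T = G x),
      (forall x, closure Omega x -> lorentz_signature (G x))
    & forall x, closure Omega x -> 0 < G x ord0 ord0].

Definition has_ergosphere Omega S G : Prop :=
  [/\ S = [set x | closure Omega x /\ Delta G x = 0],
      (forall x, closure Omega x -> surf_ext S x -> 0 < (-1) ^+ n * Delta G x)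
    & forall x, closure Omega x -> surf_int S x -> (-1) ^+ n * Delta G x < 0].

Definition black_hole S (nu : 'rV[R]_n -> 'rV[R]_n) G : Prop :=
  forall x, S x ->
    spatial_form G x (nu x) = 0 /\
    \sum_(j < n) G x (lift ord0 j) ord0 * nu x ord0 j < 0.

Definition boundary_data Omega f : Prop :=
  compact (closure [set z | cylinder (boundary Omega) z /\ f z <> 0]).

(* Classical solutions, C^2 up to the boundary: as usual for smooth domains,
   this means that u is C^2 in some neighbourhood of the closed cylinder. The
   values of u outside the closed cylinder are irrelevant. *)
Definition ibvp_solution Omega G f u : Prop :=
  [/\ (exists2 W, open W /\ cylinder (closure Omega) `<=` W & Ck 2 W u),
      (forall z, cylinder Omega z -> waveop G u z = 0),
      (exists T : R, forall z, cylinder Omega z -> time z < T -> u z = 0)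
    & forall z, cylinder (boundary Omega) z -> u z = f z].

(* (0, v_1, ..., v_n) *)
Definition no_time (v : 'rV[R]_n) : 'rV[R]_n.+1 :=
  \row_k (if unlift ord0 k is Some i then v ord0 i else 0).

Definition conormal (N : 'rV[R]_n -> 'rV[R]_n) G u z : R :=
  \sum_(j < n.+1) \sum_(k < n.+1)
    G (space z) j k * partial j u z * no_time (N (space z)) ord0 k *
    (Num.sqrt (- spatial_form G (space z) (N (space z))))^-1.

Definition solvable_data Omega G : set ('rV[R]_n.+1 -> R) :=
  [set f | boundary_data Omega f /\ exists u, ibvp_solution Omega G f u].

(* The Dirichlet-to-Neumann operator; it is meaningful for data f in
   [solvable_data Omega G] and at points z over the outer boundary. *)
Definition DtN (N : 'rV[R]_n -> 'rV[R]_n) Omega G f : 'rV[R]_n.+1 -> R :=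
  conormal N G (xget (fun=> 0) [set u | ibvp_solution Omega G f u]).

End WaveOperator.

(* Main.v *)
From HB Require Import structures.
From mathcomp Require Import ring lra.
Require Import Defs.

Set Implicit Arguments.
Unset Strict Implicit.
Unset Printing Implicit Defensive.

Local Open Scope classical_set_scope.
Local Open Scope ring_scope.

(** Uniqueness in the exterior is a local energy argument. The difference u of
    the two solutions satisfies there one divergence form equation, and its
    energy current is divergence free. The spatial form of the metric is
    negative semidefinite up to the ergosphere, so the energy density is
    nonnegative and energy crosses a boundary point at a finite speed; at the
    ergosphere the normal is a null vector, hence in the kernel of the spatial
    form, and the sign of [sum_j g^{j0} nu_j] lets energy only leave the
    exterior, while u = 0 on the outer boundary. Testing the current against a
    weight supported in a small backward cone shows that u stays zero for a
    uniformly positive time after any time up to which it vanishes. Since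
    [surf_int] and [surf_ext] are defined by connected components, a part of
    the Jordan-Brouwer theorem is needed to see that the interior reaches
    each point of the surface.

    The second operator is the image of the first one under the change of the
    time variable t - a(x), where a is a small bump supported in the interior:
    solutions correspond to each other by [u \o delay a], and the new mixed
    coefficients differ from the old ones wherever grad a <> 0, because the
    spatial block is invertible off the ergosphere. *)

(** No integral is used: the divergence theorem appears only as a statement on Riemann sums over a
    box, for fields that vanish on its faces. The exterior is not a box, so the current is cut off
    near its boundary, where only a local function f, positive inside, is at hand. Such a cutoff
    costs its derivative times the flux through the level sets of f. On the boundary the flux has
    the favourable sign; inside it may exceed zero by a multiple of f, and this excess is beaten by
    a cutoff of logarithmic type in f. At the ergosphere the spatial form degenerates, so the energy
    bounds only the time derivative of u. This suffices, since u vanishes in the past. The length of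
    a propagation step must not depend on the starting time; it is uniform in space by compactness.
    No existence result for the hyperbolic problem is assumed or proved. This is why the second
    operator is a change of variables of the first: the same boundary data admit solutions for both,
    so the two Dirichlet-to-Neumann operators have the same domain. *)

#[global] Instance rV_nbhs_filter {R : realType} {d : nat} (x : 'rV[R]_d) :
  ProperFilter (nbhs x) := nbhs_pfilter x.

Lemma cvg_sum_R {R : realType} {T I : Type} (F : set_system T) {FF : Filter F}
    (r : seq I) (P : pred I) (f : I -> T -> R) (l : I -> R) :
  (forall i, P i -> f i x @[x --> F] --> l i) ->
  \sum_(i <- r | P i) f i x @[x --> F] --> \sum_(i <- r | P i) l i.
Proof. by move=> fl; apply: cvg_big => //; exact: add_continuous. Qed.

(** * Differential calculus in R^d *)

Section Lines.
Context {R : realType} {d : nat}.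
Implicit Types (f : 'rV[R]_d -> R) (x v h : 'rV[R]_d).

Lemma is_derive_line f x v (t : R) : derivable f (x + t *: v) v ->
  is_derive t 1 (fun s => f (x + s *: v)) ('D_v f (x + t *: v)).
Proof.
have E : (fun h : R => h^-1 *: (f (x + (h *: (1 : R) + t) *: v) - f (x + t *: v))) =
  (fun h : R => h^-1 *: (f (h *: v + (x + t *: v)) - f (x + t *: v))).
  by apply/funext => h; rewrite [h *: 1]mulr1 scalerDl addrCA.
move=> df; split; rewrite /derivable /derive /shift /=.
  by rewrite E.
by rewrite E.
Qed.

(** The increment [t] may have either sign, so the intermediate point is given by a fraction [th] in
    the unit interval; steps in both directions of an axis are then treated alike. *)
Lemma MVT_line f x v (t : R) :
  (forall th : R, 0 <= th <= 1 -> derivable f (x + (th * t) *: v) v) ->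
  exists2 th : R, 0 <= th <= 1 &
    f (x + t *: v) - f x = t * 'D_v f (x + (th * t) *: v).
Proof.
move=> df.
have key (s : R) : s \in `[Num.min 0 t, Num.max 0 t]%R ->
    exists2 th : R, 0 <= th <= 1 & s = th * t.
  rewrite in_itv/=; have [t0|t0|<-] := ltgtP 0 t.
  - move=> /andP[s0 st]; exists (s / t); last by rewrite divfK// gt_eqF.
    by rewrite divr_ge0 ?(ltW t0)//= ler_pdivrMr// mul1r.
  - move=> /andP[s0 st]; exists (s / t); last by rewrite divfK// lt_eqF.
    by rewrite -[s / t]mulrNN -invrN divr_ge0 ?oppr_ge0 ?(ltW t0)//= ler_pdivrMr
      ?oppr_gt0// mul1r lerN2.
  - by exists 0; rewrite ?lexx ?ler01// mul0r; apply/eqP; rewrite eq_le andbC.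
have D (s : R) : s \in `[Num.min 0 t, Num.max 0 t]%R ->
    is_derive s 1 (fun s => f (x + s *: v)) ('D_v f (x + s *: v)).
  by move=> /key[th th01 ->]; apply: is_derive_line; exact: df.
have leab : Num.min 0 t <= Num.max 0 t by rewrite ge_min !le_max !lexx.
have C : {within `[Num.min 0 t, Num.max 0 t], continuous (fun s => f (x + s *: v))}.
  by apply: derivable_within_continuous => s /D[].
have D' (s : R) : s \in `]Num.min 0 t, Num.max 0 t[%R ->
    is_derive s 1 (fun s => f (x + s *: v)) ('D_v f (x + s *: v)).
  by move=> sab; apply: D; exact: subset_itv_oo_cc sab.
have [c /key[th th01 ->]] := MVT_segment leab D' C.
have [t0|t0] := leP 0 t.
  rewrite scale0r addr0 subr0 => E; exists th => //.
  by rewrite E mulrC.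
by rewrite scale0r addr0 sub0r => E; exists th => //; lra.
Qed.

End Lines.

Section C1.
Context {R : realType} {d : nat}.
Implicit Types (U : set 'rV[R]_d) (f g : 'rV[R]_d -> R) (x v h : 'rV[R]_d).

Definition dotr (c h : 'rV[R]_d) : R := \sum_i c ord0 i * h ord0 i.

Fact dotr_is_linear c : linear (dotr c).
Proof.
move=> a u w; rewrite /dotr scaler_sumr -big_split/=; apply: eq_bigr => i _.
by rewrite !mxE [_ *: _]mulrCA -mulrDr.
Qed.
HB.instance Definition _ c :=
  GRing.isLinear.Build R 'rV[R]_d R _ (dotr c) (dotr_is_linear c).

Lemma coord_le (h : 'rV[R]_d) i : `|h ord0 i| <= `|h|.
Proof.
rewrite [leRHS]/Num.norm /= mx_normrE; apply/bigmax_geP; right => /=.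
by exists (ord0, i).
Qed.

Lemma normr_row_le (h : 'rV[R]_d) (e : R) : 0 <= e ->
  (forall i, `|h ord0 i| <= e) -> `|h| <= e.
Proof.
move=> e0 he; rewrite [leLHS]/Num.norm /= mx_normrE; apply/bigmax_leP.
by split=> // -[j i] _ /=; rewrite [j]ord1.
Qed.

Lemma normr_row_lt (h : 'rV[R]_d) (e : R) : 0 < e ->
  (forall i, `|h ord0 i| < e) -> `|h| < e.
Proof.
move=> e0 he; rewrite [ltLHS]/Num.norm /= mx_normrE; apply/bigmax_ltP.
by split=> // -[j i] _ /=; rewrite [j]ord1.
Qed.

Lemma dotr_continuous c : continuous (dotr c).
Proof.
move=> x; apply: (@cvg_sum_R R _ _ (nbhs x) (nbhs_filter x)) => i _; apply: cvgM; first exact: cvg_cst.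
exact: coord_continuous.
Qed.

(** The increment is split along the points [y k], which change one coordinate at a time; each piece
    is a mean value along an axis, with all intermediate points within [|h|] of x. *)
Lemma partial_differentiable f x :
  (\forall y \near x, forall i, derivable f y (delta_mx ord0 i)) ->
  (forall i, {for x, continuous (partial i f)}) ->
  is_diff x f (dotr (grad f x)).
Proof.
move=> df cf.
have E : f \o shift x = cst (f x) + dotr (grad f x) +o_ (0 : 'rV[R]_d) id.
  apply/eqaddoP => _/posnumP[e].
  (* The error is shared among d pieces; the extra 1 keeps the divisor positive when d = 0. *)
  have e'0 : 0 < e%:num / (d%:R + 1) by rewrite divr_gt0// ltr_wpDl.
  have : \forall y \near x, (forall i, derivable f y (delta_mx ord0 i)) /\
      forall i, `|partial i f y - partial i f x| <= e%:num / (d%:R + 1).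
    apply: filterI => //.
    apply: (@filter_forall _ _ (fun i y => `|partial i f y - partial i f x|
      <= e%:num / (d%:R + 1)) (nbhs x)) => i.
    exact: (cvgr_distC_le _ _ (cf i)).
  move=> /nbhs_ballP[r r0 /= rP].
  apply/nbhs_ballP; exists r => //= h; rewrite -ball_normE /ball_/=.
  rewrite sub0r normrN => hr.
  pose y (k : nat) : 'rV[R]_d := \row_i (x ord0 i + if (i < k)%N then h ord0 i else 0).
  have yS (k : 'I_d) : y k.+1 = y k + h ord0 k *: delta_mx ord0 k.
    apply/rowP => i; rewrite !mxE ltnS leq_eqVlt eqxx/=.
    have [ik|ik] := eqVneq i k.
      by rewrite ik eqxx ltnn/= mulr1 addr0.
    by rewrite mulr0 addr0 (_ : (i == k :> nat) = false)//; exact/negbTE.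
  have y0 : y 0%N = x by apply/rowP => i; rewrite !mxE addr0.
  have yd : y d = h + x by apply/rowP => i; rewrite !mxE ltn_ord addrC.
  have yb (k : 'I_d) th : 0 <= th <= 1 ->
      ball x r (y k + (th * h ord0 k) *: delta_mx ord0 k).
    move=> /andP[th0 th1]; rewrite -ball_normE /ball_/= distrC.
    apply: le_lt_trans hr; apply: normr_row_le => // i; rewrite !mxE eqxx/=.
    have [->|ik] := eqVneq i k.
      rewrite ltnn addr0 mulr1 addrAC subrr add0r normrM (ger0_norm th0).
      by apply: le_trans (coord_le h k); rewrite ler_piMl.
    rewrite mulr0 addr0 addrAC subrr add0r; case: ifP => _; first exact: coord_le.
    by rewrite normr0.
  have tel : f (h + x) - f x = \sum_(k < d) (f (y k.+1) - f (y k)).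
    rewrite -yd -y0 -(big_mkord xpredT (fun k => f (y k.+1) - f (y k))).
    by rewrite telescope_sumr.
  rewrite [X in `|X|](_ : _ = (f (h + x) - f x) - dotr (grad f x) h); last first.
    by rewrite /= !fctE opprD addrA.
  rewrite tel /dotr -sumrB.
  apply: (@le_trans _ _ (\sum_(k < d) (e%:num / (d%:R + 1) * `|h|))); last first.
    rewrite sumr_const card_ord -[leLHS]mulr_natl mulrA ler_wpM2r//.
    by rewrite mulrCA ger_pMr// ler_pdivrMr ?ltr_wpDl// mul1r lerDl.
  apply: le_trans (ler_norm_sum _ _ _) _; apply: ler_sum => k _.
  have [th th01] := @MVT_line R d f (y k) (delta_mx ord0 k) (h ord0 k)
    (fun th th01 => (rP _ (yb k th th01)).1 k).
  rewrite -yS => ->; rewrite mxE [X in _ - X]mulrC -mulrBr normrM mulrC.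
  by apply: ler_pM => //; [exact: ((rP _ (yb k th th01)).2 k)|exact: coord_le].
have D := diff_unique (@dotr_continuous (grad f x)) E.
split=> //; apply/diff_locallyP; split; first by rewrite D; exact: dotr_continuous.
by rewrite D.
Qed.

End C1.

(** * Calculus of functions of class C^k *)

Section CkTheory.
Context {R : realType} {d : nat}.
Implicit Types (U V : set 'rV[R]_d) (f g : 'rV[R]_d -> R) (x v h : 'rV[R]_d).
Local Notation e_ i := (delta_mx ord0 i).

Lemma Ck_continuous k U f x : Ck k U f -> U x -> {for x, continuous f}.
Proof. by case: k => [|k] [+ _]; exact. Qed.

Lemma Ck_derivable k U f x i : Ck k.+1 U f -> U x -> derivable f x (e_ i).
Proof. by move=> [_ /(_ i)[+ _]]; exact. Qed.
Arguments Ck_derivable {k U f x i}.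

Lemma Ck_partial k U f i : Ck k.+1 U f -> Ck k U (partial i f).
Proof. by move=> [_ /(_ i)[]]. Qed.

Lemma CkW k U f : Ck k.+1 U f -> Ck k U f.
Proof.
elim: k f => [|k IH] f [cf df]; first by split.
split=> // i; split; first exact: (df i).1.
exact/IH/(df i).2.
Qed.

Lemma Ck_le k l U f : (l <= k)%N -> Ck k U f -> Ck l U f.
Proof.
by move=> /subnK <-; elim: (k - l)%N => // m IH /CkW.
Qed.

Lemma Ck_sub k U V f : V `<=` U -> Ck k U f -> Ck k V f.
Proof.
move=> VU; elim: k f => [|k IH] f [cf df]; split=> //; try by move=> x /VU/cf.
move=> i; have [di dk] := df i; split; last exact: IH.
by move=> x /VU/di.
Qed.

Lemma near_open_eq U f g x : open U -> (forall y, U y -> f y = g y) -> U x ->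
  \forall y \near x, f y = g y.
Proof.
move=> oU fg Ux; near=> y; apply: fg.
by near: y; exact: (open_nbhs_nbhs (conj oU Ux)).
Unshelve. all: by end_near.
Qed.

Lemma partial_eq U f g i x : open U -> (forall y, U y -> f y = g y) -> U x ->
  partial i f x = partial i g x.
Proof. by move=> oU fg Ux; apply: near_eq_derive; exact: near_open_eq Ux. Qed.

Lemma continuous_at_eq (T : topologicalType) U (f g : 'rV[R]_d -> T) x :
  open U -> (forall y, U y -> f y = g y) -> U x ->
  {for x, continuous f} -> {for x, continuous g}.
Proof.
move=> oU fg Ux cf; rewrite /prop_for /continuous_at -(fg x Ux).
apply: cvg_trans cf; apply: near_eq_cvg; near=> y; apply: fg.
by near: y; exact: (open_nbhs_nbhs (conj oU Ux)).
Unshelve. all: by end_near.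
Qed.

Lemma Ck_eq k U f g : open U -> (forall x, U x -> f x = g x) ->
  Ck k U f -> Ck k U g.
Proof.
move=> oU; elim: k f g => [|k IH] f g fg [cf df]; split=> //.
- by move=> x Ux; exact: (continuous_at_eq oU fg Ux (cf x Ux)).
- by move=> x Ux; exact: (continuous_at_eq oU fg Ux (cf x Ux)).
move=> i; have [di dk] := df i; split=> [x Ux|].
  by apply: near_eq_derivable (di x Ux); exact: near_open_eq Ux.
by apply: IH dk => x Ux; exact: partial_eq Ux.
Qed.

Lemma Ck_local k U f : (forall x, U x -> exists2 V, open V /\ V x & Ck k V f) ->
  Ck k U f.
Proof.
elim: k f => [|k IH] f loc; split=> //.
- by move=> x /loc[V [_ Vx] /Ck_continuous]; exact.
- by move=> x /loc[V [_ Vx] /Ck_continuous]; exact.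
move=> i; split=> [x /loc[V [_ Vx] /Ck_derivable]|]; first exact.
by apply: IH => x /loc[V oV /Ck_partial Vf]; exists V.
Qed.

Lemma is_diff_C1 U f x : open U -> Ck 1 U f -> U x ->
  is_diff x f (dotr (grad f x)).
Proof.
move=> oU Cf Ux; apply: partial_differentiable.
  apply: filterS (open_nbhs_nbhs (conj oU Ux)) => y Uy i.
  exact: Ck_derivable Cf Uy.
by move=> i; apply: Ck_continuous (Ck_partial i Cf) Ux.
Qed.

Lemma C1_derivable U f x v : open U -> Ck 1 U f -> U x -> derivable f x v.
Proof.
by move=> oU Cf Ux; have [df _] := is_diff_C1 oU Cf Ux; exact: diff_derivable.
Qed.

Lemma C1_derive U f x v : open U -> Ck 1 U f -> U x ->
  'D_v f x = dotr (grad f x) v.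
Proof.
move=> oU Cf Ux; have [df dE] := is_diff_C1 oU Cf Ux.
by rewrite deriveE// dE.
Qed.

Lemma partial_cst (c : R) i : partial i (fun _ : 'rV[R]_d => c) = fun=> 0.
Proof. by apply/funext => x; rewrite /partial derive_cst. Qed.

Lemma Ck_cst k U c : Ck k U (fun=> c).
Proof.
elim: k c => [|k IH] c; split=> //; try by move=> x _; exact: cst_continuous.
move=> i; split; first by move=> x _; exact: derivable_cst.
by rewrite partial_cst.
Qed.

Lemma partialD f g i x : derivable f x (e_ i) -> derivable g x (e_ i) ->
  partial i (fun y => f y + g y) x = partial i f x + partial i g x.
Proof. exact: deriveD. Qed.

Lemma partialM f g i x : derivable f x (e_ i) -> derivable g x (e_ i) ->
  partial i (fun y => f y * g y) x = partial i f x * g x + f x * partial i g x.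
Proof.
move=> df dg; rewrite /partial [LHS](deriveM df dg) addrC.
by congr (_ + _); rewrite [LHS]mulrC.
Qed.

Lemma CkD k U f g : open U -> Ck k U f -> Ck k U g -> Ck k U (fun x => f x + g x).
Proof.
move=> oU; elim: k f g => [|k IH] f g Cf Cg; split=> //.
- by move=> x Ux; apply: continuousD; [exact: (Ck_continuous Cf Ux)|exact: (Ck_continuous Cg Ux)].
- by move=> x Ux; apply: continuousD; [exact: (Ck_continuous Cf Ux)|exact: (Ck_continuous Cg Ux)].
move=> i; split=> [x Ux|].
  by apply: derivableD; [exact: (Ck_derivable Cf Ux)|exact: (Ck_derivable Cg Ux)].
apply: (@Ck_eq _ _ (fun x => partial i f x + partial i g x)) => //.
  move=> x Ux; rewrite partialD//.
    exact: (Ck_derivable Cf Ux).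
  exact: (Ck_derivable Cg Ux).
by apply: IH; exact: Ck_partial.
Qed.

Lemma CkM k U f g : open U -> Ck k U f -> Ck k U g -> Ck k U (fun x => f x * g x).
Proof.
move=> oU; elim: k f g => [|k IH] f g Cf Cg; split=> //.
- by move=> x Ux; apply: continuousM; [exact: (Ck_continuous Cf Ux)|exact: (Ck_continuous Cg Ux)].
- by move=> x Ux; apply: continuousM; [exact: (Ck_continuous Cf Ux)|exact: (Ck_continuous Cg Ux)].
move=> i; split=> [x Ux|].
  by apply: derivableM; [exact: (Ck_derivable Cf Ux)|exact: (Ck_derivable Cg Ux)].
apply: (@Ck_eq _ _ (fun x => partial i f x * g x + f x * partial i g x)) => //.
  move=> x Ux; rewrite partialM//.
    exact: (Ck_derivable Cf Ux).
  exact: (Ck_derivable Cg Ux).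
by apply: CkD => //; apply: IH; try (exact: Ck_partial); exact: CkW.
Qed.

Lemma CkZ k U c f : open U -> Ck k U f -> Ck k U (fun x => c * f x).
Proof. by move=> oU; apply: CkM => //; exact: Ck_cst. Qed.

Lemma CkN k U f : open U -> Ck k U f -> Ck k U (fun x => - f x).
Proof.
move=> oU /(CkZ (-1) oU); apply: Ck_eq => // x _.
by rewrite mulN1r.
Qed.

Lemma CkB k U f g : open U -> Ck k U f -> Ck k U g -> Ck k U (fun x => f x - g x).
Proof. by move=> oU Cf Cg; apply: CkD => //; exact: CkN. Qed.

Lemma Ck_sum k U (I : Type) (r : seq I) (P : pred I) (F : I -> 'rV[R]_d -> R) :
  open U -> (forall i, P i -> Ck k U (F i)) ->
  Ck k U (fun x => \sum_(i <- r | P i) F i x).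
Proof.
move=> oU CF; elim: r => [|a r IH].
  by apply: (Ck_eq oU _ (Ck_cst k U 0)) => x _; rewrite big_nil.
have [Pa|nPa] := boolP (P a).
  apply: Ck_eq oU _ (CkD oU (CF a Pa) IH) => x _.
  by rewrite big_cons Pa.
by apply: Ck_eq oU _ IH => x _; rewrite big_cons (negbTE nPa).
Qed.

Lemma Ck_prod k U (I : Type) (r : seq I) (P : pred I) (F : I -> 'rV[R]_d -> R) :
  open U -> (forall i, P i -> Ck k U (F i)) ->
  Ck k U (fun x => \prod_(i <- r | P i) F i x).
Proof.
move=> oU CF; elim: r => [|a r IH].
  by apply: (Ck_eq oU _ (Ck_cst k U 1)) => x _; rewrite big_nil.
have [Pa|nPa] := boolP (P a).
  apply: Ck_eq oU _ (CkM oU (CF a Pa) IH) => x _.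
  by rewrite big_cons Pa.
by apply: Ck_eq oU _ IH => x _; rewrite big_cons (negbTE nPa).
Qed.

Lemma partialZ c f i x : derivable f x (e_ i) ->
  partial i (fun y => c * f y) x = c * partial i f x.
Proof.
move=> df; rewrite partialM; [|exact: derivable_cst|exact: df].
by rewrite partial_cst mul0r add0r.
Qed.

Lemma partial_sum U (I : Type) (r : seq I) (F : I -> 'rV[R]_d -> R) i x :
  open U -> (forall k, Ck 1 U (F k)) -> U x ->
  partial i (fun y => \sum_(k <- r) F k y) x = \sum_(k <- r) partial i (F k) x.
Proof.
move=> oU CF Ux; elim: r => [|k r IH].
  rewrite big_nil (@partial_eq U _ (fun=> 0) _ _ oU _ Ux); first by rewrite partial_cst.
  by move=> y _; rewrite big_nil.
rewrite big_cons -IH -partialD.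
- by apply: (partial_eq _ oU _ Ux) => y _; rewrite big_cons.
- exact: (Ck_derivable (CF k) Ux).
have C : Ck 1 U (fun y => \sum_(k <- r) F k y) by apply: (Ck_sum _ oU) => l _; exact: CF.
exact: (Ck_derivable C Ux).
Qed.

Lemma is_derive_dotr c x v : is_derive x v (dotr c) (dotr c v).
Proof.
have dl : differentiable (dotr c) x.
  by apply: linear_differentiable; exact: dotr_continuous.
split; first exact: diff_derivable.
by rewrite deriveE// diff_lin//; exact: dotr_continuous.
Qed.

Lemma dotr_delta v i : dotr (e_ i) v = v ord0 i.
Proof.
rewrite /dotr (bigD1 i)//= mxE !eqxx mul1r big1 ?addr0// => j ji.
by rewrite mxE eqxx (negbTE ji) mul0r.
Qed.

Lemma is_derive_coord i x v :
  is_derive x v (fun y : 'rV[R]_d => y ord0 i) (v ord0 i).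
Proof.
have <- : dotr (e_ i) = (fun y : 'rV[R]_d => y ord0 i).
  by apply/funext => y; exact: dotr_delta.
rewrite -(dotr_delta v i); exact: is_derive_dotr.
Qed.

Lemma partial_coord i j x : partial i (fun y : 'rV[R]_d => y ord0 j) x = (i == j)%:R.
Proof.
have [_ E] := is_derive_coord j x (e_ i).
by rewrite /partial E mxE eqxx/= eq_sym.
Qed.

Lemma Ck_coord k U i : open U -> Ck k U (fun x : 'rV[R]_d => x ord0 i).
Proof.
move=> oU; case: k => [|k]; split=> //; try by move=> x _; exact: coord_continuous.
move=> j; split=> [x _|]; first by have [] := is_derive_coord i x (e_ j).
apply: (Ck_eq oU _ (Ck_cst k U (j == i)%:R)) => x _.
by rewrite partial_coord.
Qed.

Lemma derivable_comp1 (phi : R -> R) f x v :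
  derivable f x v -> derivable phi (f x) 1 ->
  is_derive x v (fun y => phi (f y)) (phi^`()%classic (f x) * 'D_v f x).
Proof.
move=> df dphi.
pose l := fun h : R => f (h *: v + x).
have l0 : l 0 = f x by rewrite /l scale0r add0r.
have dl : derivable l 0 1 := (derivable1P f x v).1 df.
have dphi' : derivable phi (l 0) 1 by rewrite l0.
have dc : derivable (fun y => phi (f y)) x v.
  apply: (derivable1P (fun y => phi (f y)) x v).2.
  apply: (derivable1_diffP _ _).2.
  exact: (differentiable_comp ((derivable1_diffP l 0).1 dl)
    ((derivable1_diffP phi (l 0)).1 dphi')).
have E (g : 'rV[R]_d -> R) : derivable g x v ->
    'D_v g x = (fun h : R => g (h *: v + x))^`()%classic 0.
  move=> dg; rewrite derive1E.
  have := @is_derive_line R d g x v 0; rewrite scale0r addr0 => /(_ dg) [_ <-].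
  suff -> : (fun h : R => g (h *: v + x)) = (fun s : R => g (x + s *: v)) by [].
  by apply/funext => h; rewrite addrC.
split=> //.
by rewrite (E _ dc) (E _ df) -l0; exact: derive1_comp dl dphi'.
Qed.

Lemma partial_comp1 (phi : R -> R) f x i :
  derivable f x (e_ i) -> derivable phi (f x) 1 ->
  partial i (fun y => phi (f y)) x = phi^`()%classic (f x) * partial i f x.
Proof. by move=> df dphi; have [_ E] := derivable_comp1 df dphi; exact: E. Qed.

Lemma C1_comp1 (phi : R -> R) U f : open U -> Ck 1 U f ->
  (forall x, U x -> derivable phi (f x) 1) ->
  (forall x, U x -> {for f x, continuous phi^`()%classic}) ->
  Ck 1 U (fun x => phi (f x)).
Proof.
move=> oU Cf dphi cphi.
split=> [x Ux|i].
  apply: continuous_comp; first exact: Ck_continuous Cf Ux.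
  exact/differentiable_continuous/derivable1_diffP/dphi.
have D x : U x -> is_derive x (e_ i) (fun y => phi (f y))
    (phi^`()%classic (f x) * partial i f x).
  by move=> Ux; apply: derivable_comp1; [exact: Ck_derivable Cf Ux|exact: dphi].
split=> [x /D[]//|].
apply: (@Ck_eq _ _ (fun x => phi^`()%classic (f x) * partial i f x)) => //.
  by move=> x /D[].
split=> // x Ux; apply: continuousM; last exact: Ck_continuous (Ck_partial i Cf) Ux.
by apply: continuous_comp; [exact: Ck_continuous Cf Ux|exact: cphi].
Qed.

Lemma is_derive_shift_line f x a v : derivable f (x + a) v ->
  is_derive x v (fun y => f (y + a)) ('D_v f (x + a)).
Proof.
have E : (fun h : R => h^-1 *: (f (h *: v + x + a) - f (x + a))) =
  (fun h : R => h^-1 *: (f (h *: v + (x + a)) - f (x + a))).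
  by apply/funext => h; rewrite addrA.
by split; rewrite /derivable /derive /shift /= E.
Qed.

Lemma ball_two_steps x (r h s t : R) k l : 0 < h -> h < r / 2 ->
  0 <= s <= 1 -> 0 <= t <= 1 -> ball x r (x + (s * h) *: e_ k + (t * h) *: e_ l).
Proof.
move=> h0 hr /andP[s0 s1] /andP[t0 t1].
rewrite -ball_normE /ball_ /= -addrA opprD addNKr normrN.
have nd m : `|e_ m : 'rV[R]_d| <= 1.
  apply: normr_row_le => // n; rewrite mxE eqxx/=.
  by case: eqP; rewrite ?normr1 ?normr0 ?ler01.
apply: le_lt_trans (ler_normD _ _) _; rewrite !normrZ.
rewrite (ger0_norm s0) (ger0_norm t0) (gtr0_norm h0) [ltRHS]splitr.
apply: ltrD; apply: le_lt_trans hr; rewrite -[leRHS]mulr1; apply: ler_pM => //.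
- by rewrite mulr_ge0// ltW.
- by rewrite ler_piMl// ltW.
- by rewrite mulr_ge0// ltW.
- by rewrite ler_piMl// ltW.
Qed.

(** The second difference over a square of side h is, by two mean values, [h ^+ 2] times either
    mixed derivative at some point of the square. The two points differ, but both are close to x,
    where both derivatives are continuous. *)
Lemma Schwarz U f x i j : open U -> Ck 2 U f -> U x ->
  partial i (partial j f) x = partial j (partial i f) x.
Proof.
move=> oU Cf Ux.
have [r r0 rU] : exists2 r : R, 0 < r & ball x r `<=` U.
  by have /nbhs_ballP[r r0 rU] := open_nbhs_nbhs (conj oU Ux); exists r.
have bU (h s t : R) k l : 0 < h -> h < r / 2 -> 0 <= s <= 1 -> 0 <= t <= 1 ->
    ball x r (x + (s * h) *: e_ k + (t * h) *: e_ l) := @ball_two_steps x r h s t k l.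
have key k l (h : R) : 0 < h -> h < r / 2 -> exists s t : R,
    [/\ 0 <= s <= 1, 0 <= t <= 1 &
    f (x + h *: e_ k + h *: e_ l) - f (x + h *: e_ k) - (f (x + h *: e_ l) - f x)
     = h * (h * partial l (partial k f) (x + (s * h) *: e_ k + (t * h) *: e_ l))].
  move=> h0 hr; pose F y := f (y + h *: e_ l) - f y.
  have dF (th : R) : 0 <= th <= 1 -> is_derive (x + (th * h) *: e_ k) (e_ k) F
      (partial k f (x + (th * h) *: e_ k + h *: e_ l) -
       partial k f (x + (th * h) *: e_ k)).
    move=> th01; apply: is_deriveB.
      apply: is_derive_shift_line; apply: (@Ck_derivable 1 U f _ _ Cf); apply: rU.
      by rewrite -[h in h *: e_ l]mul1r; apply: bU; rewrite ?lexx ?ler01.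
    apply: derivableP; apply: (@Ck_derivable 1 U f _ _ Cf); apply: rU.
    rewrite -[X in ball _ _ X]addr0 -(scale0r (e_ l)) -(mul0r h).
    by apply: bU; rewrite ?lexx ?ler01.
  have [|s s01 Es] := @MVT_line R d F x (e_ k) h.
    by move=> th /dF[].
  have [|t t01 Et] := @MVT_line R d (partial k f) (x + (s * h) *: e_ k) (e_ l) h.
    move=> th th01; apply: (@Ck_derivable 0 U _ _ _ (Ck_partial k Cf)); apply: rU.
    exact: bU.
  exists s, t; split=> //; rewrite -Et.
  have -> : partial k f (x + (s * h) *: e_ k + h *: e_ l) -
       partial k f (x + (s * h) *: e_ k) = 'D_(e_ k) F (x + (s * h) *: e_ k).
    by have [_ ->] := dF _ s01.
  by rewrite -Es.
apply/eqP; rewrite -subr_eq0 -normr_le0; apply/ler_addgt0Pl => e e0; rewrite addr0.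
have e20 : 0 < e / 2 by rewrite divr_gt0.
have cj : {for x, continuous (partial i (partial j f))}.
  exact: Ck_continuous (Ck_partial i (Ck_partial j Cf)) Ux.
have ci : {for x, continuous (partial j (partial i f))}.
  exact: Ck_continuous (Ck_partial j (Ck_partial i Cf)) Ux.
have /nbhs_ballP[r1 /= r10 P1] : \forall y \near x,
    `|partial i (partial j f) x - partial i (partial j f) y| <= e / 2.
  exact: cvgr_dist_le cj _ e20.
have /nbhs_ballP[r2 /= r20 P2] : \forall y \near x,
    `|partial j (partial i f) y - partial j (partial i f) x| <= e / 2.
  exact: cvgr_distC_le ci _ e20.
pose q := Num.min r (Num.min r1 r2).
have q0 : 0 < q by rewrite !lt_min r0 r10 r20.
have [h [h0 hr' hr]] : exists h : R, [/\ 0 < h, h < q / 2 & h < r / 2].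
  exists (q / 4); split; first by rewrite divr_gt0.
    by rewrite ltr_pM2l// ltf_pV2 ?posrE//; lra.
  apply: (@lt_le_trans _ _ (q / 2)); first by rewrite ltr_pM2l// ltf_pV2 ?posrE//; lra.
  by rewrite ler_pM2r// /q ge_min lexx.
have bq (s t : R) k l : 0 <= s <= 1 -> 0 <= t <= 1 ->
    ball x q (x + (s * h) *: e_ k + (t * h) *: e_ l) := @ball_two_steps x q h s t k l h0 hr'.
have [s [t [s01 t01 E1]]] := key j i h h0 hr.
have [s' [t' [s'01 t'01 E2]]] := key i j h h0 hr.
have E : partial i (partial j f) (x + (s * h) *: e_ j + (t * h) *: e_ i) =
    partial j (partial i f) (x + (s' * h) *: e_ i + (t' * h) *: e_ j).
  have hn0 : h != 0 by rewrite gt_eqF.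
  apply: (mulfI hn0); apply: (mulfI hn0).
  apply: (etrans (esym E1)); apply: (etrans _ E2).
  by rewrite [x + h *: e_ j + _]addrAC !opprB addrACA [RHS]addrACA [- _ - _]addrC.
have qr1 : q <= r1 by rewrite /q !ge_min lexx orbT.
have qr2 : q <= r2 by rewrite /q !ge_min lexx !orbT.
have B1 := P1 _ (le_ball qr1 (bq s t j i s01 t01)).
have B2 := P2 _ (le_ball qr2 (bq s' t' i j s'01 t'01)).
rewrite (splitr e).
apply: le_trans (lerD B1 B2); apply: le_trans (ler_normD _ _).
by rewrite E addrA subrK.
Qed.

End CkTheory.

(** * Chain rule for maps between row spaces *)

Section Chain.
Context {R : realType} {d e : nat}.
Implicit Types (U : set 'rV[R]_d) (V : set 'rV[R]_e) (f : 'rV[R]_e -> R)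
  (g : 'rV[R]_d -> 'rV[R]_e) (x v : 'rV[R]_d).
Local Notation e_ i := (delta_mx ord0 i).

Lemma row_continuous g x :
  (forall j, {for x, continuous (fun y => g y ord0 j)}) -> {for x, continuous g}.
Proof.
move=> cg; apply/cvgrPdist_lt => eps eps0.
have : \forall y \near x, forall j, `|g x ord0 j - g y ord0 j| < eps.
  apply: (@filter_forall _ _ (fun j y => `|g x ord0 j - g y ord0 j| < eps) (nbhs x)) => j.
  exact: (cvgr_dist_lt _ _ (cg j) _ eps0).
move=> H; near=> y; apply: normr_row_lt => // j; rewrite !mxE.
by move: j; near: y.
Unshelve. all: by end_near. Qed.

Lemma C1_row_differentiable U g x : open U ->
  (forall j, Ck 1 U (fun y => g y ord0 j)) -> U x -> differentiable g x.
Proof.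
move=> oU Cg Ux.
have -> : g = \sum_(j < e) (fun y => g y ord0 j *: (e_ j : 'rV[R]_e)).
  by apply/funext => y; rewrite fct_sumE; apply: row_sum_delta.
apply: differentiable_sum => j; apply: differentiableZl.
by have [] := is_diff_C1 oU (Cg j) Ux.
Qed.

Lemma C1_row_diffE U g x v j : open U ->
  (forall j, Ck 1 U (fun y => g y ord0 j)) -> U x ->
  ('d g x v) ord0 j = 'D_v (fun y => g y ord0 j) x.
Proof.
move=> oU Cg Ux; have dg := C1_row_differentiable oU Cg Ux.
have dl : differentiable (dotr (e_ j : 'rV[R]_e)) (g x).
  by apply: linear_differentiable; exact: dotr_continuous.
have -> : (fun y => g y ord0 j) = dotr (e_ j) \o g.
  by apply/funext => y /=; rewrite dotr_delta.
rewrite deriveE; last exact: differentiable_comp.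
rewrite (diff_comp dg dl)/=.
have E : 'd (dotr (e_ j : 'rV[R]_e)) (g x) = dotr (e_ j) :> (_ -> _) :=
  diff_lin (g x) (@dotr_continuous R e (e_ j)).
rewrite E.
by symmetry; exact: dotr_delta.
Qed.

Lemma chain_derive U V f g x v : open U -> open V -> Ck 1 V f ->
  (forall j, Ck 1 U (fun y => g y ord0 j)) -> U x -> V (g x) ->
  is_derive x v (fun y => f (g y))
    (\sum_j partial j f (g x) * 'D_v (fun y => g y ord0 j) x).
Proof.
move=> oU oV Cf Cg Ux Vgx.
have dg := C1_row_differentiable oU Cg Ux.
have [df fE] := is_diff_C1 oV Cf Vgx.
have dfg : differentiable (f \o g) x by exact: differentiable_comp.
split; first exact: diff_derivable.
rewrite [LHS](deriveE _ dfg) (diff_comp dg df)/= fE /dotr; apply: eq_bigr => j _.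
by rewrite mxE (C1_row_diffE _ _ oU).
Qed.

Lemma Ck_comp k U V f g : open U -> open V -> (forall x, U x -> V (g x)) ->
  Ck k V f -> (forall j, Ck k U (fun y => g y ord0 j)) ->
  Ck k U (fun x => f (g x)).
Proof.
move=> oU oV UV; elim: k f => [|k IH] f Cf Cg.
  split=> // x Ux; apply: continuous_comp; last exact: (Ck_continuous Cf (UV x Ux)).
  by apply: row_continuous => j; exact: (Ck_continuous (Cg j) Ux).
have C1g j : Ck 1 U (fun y => g y ord0 j) by apply: Ck_le (Cg j).
have C1f : Ck 1 V f by apply: Ck_le Cf.
have D x i (Ux : U x) := chain_derive (e_ i) oU oV C1f C1g Ux (UV x Ux).
split=> [x Ux|i].
  apply: continuous_comp; last exact: (Ck_continuous Cf (UV x Ux)).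
  by apply: row_continuous => j; exact: (Ck_continuous (Cg j) Ux).
split=> [x Ux|]; first by have [] := D x i Ux.
apply: (@Ck_eq _ _ _ _ (fun x => \sum_j partial j f (g x) *
   partial i (fun y => g y ord0 j) x)) => //.
  by move=> x Ux; have [_ E] := D x i Ux; rewrite -E.
apply: Ck_sum => // j _; apply: CkM => //.
  by apply: IH => [|l]; [exact: Ck_partial|exact/CkW].
exact: Ck_partial.
Qed.

End Chain.

(** * Compactness and the divergence theorem on a box *)

Section Compactness.
Context {R : realType} {d : nat}.
Implicit Types (K : set 'rV[R]_d) (f : 'rV[R]_d -> R) (x y : 'rV[R]_d).

Lemma nbhs_rowP x (A : set 'rV[R]_d) :
  nbhs x A <-> exists2 r : R, 0 < r & forall y, `|x - y| < r -> A y.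
Proof.
split=> [/nbhs_ballP[r r0 rA]|[r r0 rA]].
  by exists r => // y xy; apply: rA; rewrite -ball_normE.
by apply/nbhs_ballP; exists r => // y; rewrite -ball_normE => /rA.
Qed.

(** One covering argument for several uses: [P] couples a scale [del] with a point, and the local
    hypothesis asks for it on a whole neighbourhood and for all small scales at once. Instances are
    moduli of continuity, bounds (the scale being the inverse of the bound), charts of a surface and
    time steps. *)
Lemma compact_uniform K (P : R -> 'rV[R]_d -> Prop) : compact K ->
  (forall x, K x -> exists2 r : R, 0 < r &
     forall y (del : R), `|x - y| < r -> 0 < del < r -> P del y) ->
  exists2 r : R, 0 < r & forall (del : R) x, 0 < del < r -> K x -> P del x.
Proof.
move=> cK loc.
have /compact_near_coveringP := cK.
move=> /(_ R (0 : R)^'+ P _)[].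
  move=> x /loc[r r0 Pr].
  exists ([set y : 'rV[R]_d | `|x - y| < r], [set del : R | 0 < del < r]).
    split=> /=; first by apply/nbhs_rowP; exists r.
    exists r => //= del; rewrite /ball_/= sub0r normrN => h del0.
    by rewrite del0 (le_lt_trans (ler_norm _)).
  by move=> [y del] /= [h1 h2]; exact: Pr.
move=> r /= r0 rP; exists r => // del x /andP[del0 delr] Kx.
by apply: (rP del); rewrite //= sub0r normrN gtr0_norm.
Qed.

Lemma unif_cont_compact K f : compact K ->
  (forall x, K x -> {for x, continuous f}) ->
  forall eps : R, 0 < eps -> exists2 del : R, 0 < del &
    forall x y, K x -> `|x - y| < del -> `|f x - f y| <= eps.
Proof.
move=> cK cf eps eps0.
have [|r r0 rP] := @compact_uniform K
    (fun del x => forall y, `|x - y| < del -> `|f x - f y| <= eps) cK.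
  move=> x Kx.
  have e20 : 0 < eps / 2 by rewrite divr_gt0.
  have /nbhs_rowP[r r0 rP] : \forall y \near x, `|f x - f y| <= eps / 2.
    exact: (cvgr_dist_le _ _ (cf x Kx)).
  exists (r / 2); first by rewrite divr_gt0.
  move=> y del xy /andP[_ delr] z yz.
  rewrite [f y - f z](_ : _ = (f x - f z) - (f x - f y)); last by ring.
  apply: le_trans (ler_normB _ _) _; rewrite [leRHS]splitr; apply: lerD.
    apply: rP; rewrite -(subrKA y) (splitr r).
    by apply: le_lt_trans (ler_normD _ _) _; rewrite ltrD// (lt_trans yz).
  by apply: rP; apply: lt_le_trans xy _; lra.
exists (r / 2); first by rewrite divr_gt0.
by move=> x y Kx; apply: rP => //; apply/andP; split; lra.
Qed.

Lemma bounded_on_compact K f : compact K ->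
  (forall x, K x -> {for x, continuous f}) ->
  exists2 C : R, 0 < C & forall x, K x -> `|f x| <= C.
Proof.
move=> cK cf.
have [|r r0 rP] := @compact_uniform K (fun del x => `|f x| <= del^-1) cK.
  move=> x Kx.
  have /nbhs_rowP[r r0 rP] : \forall y \near x, `|f x - f y| <= 1.
    exact: (cvgr_dist_le _ _ (cf x Kx)).
  have C0 : 0 < `|f x| + 1 by rewrite ltr_wpDl.
  exists (Num.min r (`|f x| + 1)^-1); first by rewrite lt_min r0 invr_gt0.
  move=> y del; rewrite !lt_min => /andP[xy _] /andP[del0 /andP[_ h]].
  apply: (@le_trans _ _ (`|f x| + 1)).
    rewrite -[f y](subrK (f x)) addrC.
    by apply: le_trans (ler_normD _ _) _; rewrite lerD2l distrC; exact: rP.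
  by rewrite -[leLHS]invrK lef_pV2 ?posrE ?invr_gt0// ltW.
exists (r / 2)^-1; first by rewrite invr_gt0 divr_gt0.
by move=> x Kx; apply: rP => //; apply/andP; split; lra.
Qed.

End Compactness.

(** * Divergence on a box through Riemann sums *)

Section Divergence.
Context {R : realType} {d : nat}.
Local Notation e_ i := (delta_mx ord0 i).
Variables (a w : 'rV[R]_d).
Hypothesis w0 : forall i, 0 < w ord0 i.

Definition cbox : set 'rV[R]_d :=
  [set x | forall i, a ord0 i <= x ord0 i <= a ord0 i + w ord0 i].

Lemma compact_cbox : compact cbox.
Proof.
have -> : cbox = [set v : 'rV[R]_d | forall i,
    `[a ord0 i, a ord0 i + w ord0 i]%classic (v ord0 i)].
  by apply/seteqP; split=> x /= xb i; have := xb i; rewrite in_itv.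
apply: (@rV_compact R d (fun i => `[a ord0 i, a ord0 i + w ord0 i]%classic)).
by move=> i; exact: segment_compact.
Qed.

Section Grid.
Variable M : nat.
Implicit Type k : {ffun 'I_d -> 'I_M.+1}.

Definition gridpt k : 'rV[R]_d :=
  \row_i (a ord0 i + (k i)%:R / M.+1%:R * w ord0 i).

Definition gridS (i : 'I_d) k : {ffun 'I_d -> 'I_M.+1} :=
  [ffun j => if j == i then ordS (k j) else k j].

Lemma gridS_inj i : injective (gridS i).
Proof.
move=> k l /ffunP kl; apply/ffunP => j; have := kl j; rewrite !ffunE.
by case: eqP => // _ /ordS_inj.
Qed.

Definition mesh (i : 'I_d) : R := w ord0 i / M.+1%:R.

Lemma mesh_gt0 i : 0 < mesh i.
Proof. by rewrite divr_gt0. Qed.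

Lemma gridpt_box k i (th : R) : 0 <= th <= 1 ->
  cbox (gridpt k + (th * mesh i) *: e_ i).
Proof.
move=> /andP[th0 th1] j; rewrite !mxE eqxx/=.
have kM : (k j)%:R + 1 <= M.+1%:R :> R by rewrite natr1 ler_nat.
have k0 : 0 <= (k j)%:R :> R by [].
have M0 : 0 < M.+1%:R :> R by [].
have wj := w0 j.
have [->|_] := eqVneq j i; rewrite ?mulr1 ?mulr0 ?addr0 /mesh.
  rewrite -[_ + _ + _]addrA lerDl lerD2l mulrAC mulrA -mulrDl; apply/andP; split.
    by rewrite divr_ge0// addr_ge0 ?mulr_ge0// ltW// ?w0.
  rewrite ler_pdivrMr//; have wi := w0 i.
  have kM' : (k i)%:R + 1 <= M.+1%:R :> R by rewrite natr1 ler_nat.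
  nra.
rewrite lerDl lerD2l mulrAC; apply/andP; split.
  by rewrite divr_ge0// mulr_ge0// ltW.
by rewrite ler_pdivrMr//; nra.
Qed.

(** At the last index the neighbour lies on the upper face and its cyclic substitute on the lower
    one, and V vanishes on both. *)
Lemma grid_shift (V : 'rV[R]_d -> R) i :
  (forall x, cbox x -> x ord0 i = a ord0 i \/ x ord0 i = a ord0 i + w ord0 i ->
    V x = 0) ->
  forall k, V (gridpt k + mesh i *: e_ i) = V (gridpt (gridS i k)).
Proof.
move=> V0 k; have bx := @gridpt_box k i 1.
have [ki|ki] := ltnP (k i).+1 M.+1.
  congr V; apply/rowP => j; rewrite !mxE !ffunE eqxx/=.
  have [->|_] := eqVneq j i; last by rewrite mulr0 addr0.
  rewrite /= modn_small// mulr1 /mesh -addrA; congr (_ + _).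
  by rewrite -[(k i).+1%:R]natr1 !mulrDl mul1r [w _ _ / _]mulrC.
have kE : (k i).+1 = M.+1 by apply/eqP; rewrite eqn_leq ki andbT.
rewrite !V0//.
- by have := @gridpt_box (gridS i k) i 0; rewrite mul0r scale0r addr0; apply; rewrite lexx ler01.
- by left; rewrite mxE ffunE eqxx /= kE modnn mul0r mul0r addr0.
- by have := bx; rewrite mul1r; apply; rewrite lexx ler01.
right; rewrite !mxE !eqxx/= mulr1 /mesh -addrA; congr (_ + _).
have -> : (k i)%:R = M.+1%:R - 1 :> R by have /eqP := congr1 (fun m => m%:R : R) kE; rewrite -natr1 => /eqP <-; rewrite addrK.
have : M.+1%:R != 0 :> R by rewrite pnatr_eq0.
by move: (M.+1%:R : R) => m m0; field.
Qed.

Lemma grid_telescope (V : 'rV[R]_d -> R) i :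
  (forall x, cbox x -> x ord0 i = a ord0 i \/ x ord0 i = a ord0 i + w ord0 i ->
    V x = 0) ->
  \sum_k (V (gridpt k + mesh i *: e_ i) - V (gridpt k)) = 0.
Proof.
move=> V0; rewrite sumrB.
rewrite (eq_bigr (fun k => V (gridpt (gridS i k)))); last first.
  by move=> k _; exact: grid_shift.
rewrite [X in _ - X](reindex_inj (@gridS_inj i)).
exact: subrr.
Qed.

End Grid.

(* Riemann sums of the divergence telescope; the cyclic shift of the grid makes
   the boundary terms, which vanish, disappear without bookkeeping. *)
Lemma riemann_sum_div (V : 'I_d -> 'rV[R]_d -> R) (eta : R) :
  (forall i x, cbox x -> derivable (V i) x (e_ i)) ->
  (forall i x, cbox x -> {for x, continuous (partial i (V i))}) ->
  (forall i x, cbox x ->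
    x ord0 i = a ord0 i \/ x ord0 i = a ord0 i + w ord0 i -> V i x = 0) ->
  0 < eta ->
  exists M0, forall M, (M0 <= M)%N ->
    - (eta * (M.+1 ^ d)%:R) <= \sum_(k : {ffun 'I_d -> 'I_M.+1})
      \sum_i partial i (V i) (gridpt k).
Proof.
move=> dV cV V0 eta0.
have eta'0 : 0 < eta / (d%:R + 1) by rewrite divr_gt0// ltr_wpDl.
have /fin_all_exists2[del del0 delP] : forall i, exists2 del : R, 0 < del &
    forall x y, cbox x -> `|x - y| < del ->
      `|partial i (V i) x - partial i (V i) y| <= eta / (d%:R + 1).
  by move=> i; apply: unif_cont_compact eta'0; [exact: compact_cbox|exact: cV].
pose M0 := (\sum_i Num.bound (w ord0 i / del i))%N.
exists M0 => M M0M.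
have meshd i : mesh M i < del i.
  rewrite /mesh ltr_pdivrMr// mulrC -ltr_pdivrMr//.
  apply: lt_le_trans (archi_boundP _) _; first by rewrite divr_ge0// ltW.
  rewrite ler_nat ltnW// ltnS (leq_trans _ M0M)//.
  by rewrite /M0 (bigD1 i)//= leq_addr.
have step i (k : {ffun 'I_d -> 'I_M.+1}) :
   (mesh M i)^-1 * (V i (gridpt k + mesh M i *: e_ i) - V i (gridpt k))
   - eta / (d%:R + 1) <= partial i (V i) (gridpt k).
  have [|th th01 ->] := @MVT_line R d (V i) (gridpt k) (e_ i) (mesh M i).
    by move=> th th01; apply: dV; exact: gridpt_box.
  rewrite mulKf ?gt_eqF ?mesh_gt0// lerBlDr -lerBlDl.
  apply: le_trans (ler_norm _) _; rewrite distrC; apply: delP.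
    by have := @gridpt_box M k i 0; rewrite mul0r scale0r addr0; apply; rewrite lexx ler01.
  rewrite opprD addNKr normrN; apply: le_lt_trans (meshd i).
  apply: normr_row_le => [|j]; first by rewrite ltW ?mesh_gt0.
  have /andP[th0 th1] := th01; have m0 := mesh_gt0 M i.
  rewrite !mxE eqxx/=; case: eqP => _; rewrite ?mulr1 ?mulr0 ?normr0 ?(ltW m0)//.
  by rewrite normrM (ger0_norm th0) (gtr0_norm m0) ler_piMl// ltW.
have cardM : (#|{: {ffun 'I_d -> 'I_M.+1}}| = M.+1 ^ d)%N by rewrite card_ffun !card_ord.
rewrite exchange_big/=.
apply: (@le_trans _ _ (\sum_(i < d) \sum_(k : {ffun 'I_d -> 'I_M.+1})
  ((mesh M i)^-1 * (V i (gridpt k + mesh M i *: e_ i) - V i (gridpt k))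
   - eta / (d%:R + 1)))); last first.
  by apply: ler_sum => i _; apply: ler_sum => k _; exact: step.
rewrite (eq_bigr (fun=> - (eta / (d%:R + 1) * (M.+1 ^ d)%:R))); last first.
  move=> i _; rewrite sumrB -mulr_sumr grid_telescope; last exact: V0.
  by rewrite mulr0 sub0r sumr_const -cardM mulr_natr.
rewrite sumr_const card_ord mulNrn lerN2 -[leLHS]mulr_natr.
rewrite mulrAC ler_wpM2r//.
rewrite mulrAC ler_pdivrMr ?ltr_wpDl// ler_wpM2l ?(ltW eta0)//.
by rewrite lerDl.
Qed.

Lemma grid_cell (P : nat) (z : 'rV[R]_d) : cbox z -> exists l : 'I_d -> 'I_P.+1,
  forall i, a ord0 i + (l i)%:R / P.+1%:R * w ord0 i <= z ord0 i <=
            a ord0 i + ((l i)%:R + 1) / P.+1%:R * w ord0 i.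
Proof.
move=> bz.
suff /choice[l lP] : forall i, exists l : 'I_P.+1,
    a ord0 i + l%:R / P.+1%:R * w ord0 i <= z ord0 i <=
    a ord0 i + (l%:R + 1) / P.+1%:R * w ord0 i by exists l.
move=> i; have /andP[az zb] := bz i; have wi := w0 i.
have P0 : 0 < P.+1%:R :> R by [].
pose t := (z ord0 i - a ord0 i) / w ord0 i * P.+1%:R.
have t0 : 0 <= t by rewrite mulr_ge0// divr_ge0 ?subr_ge0// ltW.
have tP : t <= P.+1%:R.
  rewrite ger_pMl// ler_pdivrMr// mul1r.
  by rewrite lerBlDl.
have zE : z ord0 i = a ord0 i + t / P.+1%:R * w ord0 i.
  by rewrite /t mulfK ?gt_eqF// divfK ?gt_eqF// addrC subrK.
have /andP[ht1 ht2] := truncn_itv t0.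
have le (u v : R) : (a ord0 i + u / P.+1%:R * w ord0 i <=
    a ord0 i + v / P.+1%:R * w ord0 i) = (u <= v).
  by rewrite lerD2l ler_pM2r// ler_pM2r// invr_gt0.
have [tl|tl] := ltnP (Num.truncn t) P.+1.
  exists (Ordinal tl); rewrite zE !le /= ht1 ltW//.
  by rewrite natr1.
exists ord_max; rewrite zE !le natr1 tP andbT.
by rewrite (le_trans _ ht1)// ler_nat/= ltnW.
Qed.

Definition flux_field (V : 'I_d -> 'rV[R]_d -> R) : Prop :=
  [/\ forall i x, cbox x -> derivable (V i) x (e_ i),
      forall i x, cbox x -> {for x, continuous (partial i (V i))}
    & forall i x, cbox x ->
        x ord0 i = a ord0 i \/ x ord0 i = a ord0 i + w ord0 i -> V i x = 0].

(** A cell of a coarse grid that contains z and has sides below r is a fixed fraction [c] of the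
    box. This fraction depends on the box, on z and on r, but not on the field: later the field
    varies with a large parameter. *)
Lemma divergence_balance (z : 'rV[R]_d) (r : R) : cbox z -> 0 < r ->
  exists2 c : R, 0 < c & forall V A B, flux_field V -> 0 <= A -> 0 <= B ->
    (forall x, cbox x -> \sum_i partial i (V i) x <= A) ->
    (forall x, cbox x -> `|z - x| < r -> \sum_i partial i (V i) x <= - B) ->
    c * B <= A.
Proof.
move=> bz r0.
pose P := (\sum_i Num.bound (w ord0 i / r))%N.
have wP i : w ord0 i / P.+1%:R < r.
  rewrite ltr_pdivrMr// mulrC -ltr_pdivrMr//.
  apply: lt_le_trans (archi_boundP _) _; first by rewrite divr_ge0// ltW.
  by rewrite ler_nat ltnW// ltnS /P (bigD1 i)//= leq_addr.
have [l lP] := grid_cell P bz.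
have P0 : 0 < P.+1%:R ^+ d :> R by rewrite exprn_gt0.
exists (P.+1%:R ^+ d)^-1; first by rewrite invr_gt0.
move=> V A B [dV cV V0] A0 B0 divA divB.
rewrite mulrC ler_pdivrMr//; apply/ler_addgt0Pr => eta eta0.
have eta'0 : 0 < eta / P.+1%:R ^+ d by rewrite divr_gt0.
(* This index makes [M.+1] equal to [M0.+1 * P.+1]: the fine grid then has [M0.+1 ^ d] points in
   each cell of the coarse grid, and [phi] enumerates those in the cell of z. *)
have [M0 /(_ (P + M0 * P.+1)%N)] := riemann_sum_div dV cV V0 eta'0.
have -> : (M0 <= P + M0 * P.+1)%N.
  by apply: leq_trans (leq_addl _ _); rewrite leq_pmulr.
move=> /(_ isT); set M := (P + M0 * P.+1)%N => S1.
have ME : (M.+1 = M0.+1 * P.+1)%N by rewrite mulSn.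
pose phi (s : {ffun 'I_d -> 'I_M0.+1}) : {ffun 'I_d -> 'I_M.+1} :=
  [ffun i => inord (l i * M0.+1 + s i)].
have phiE s i : (phi s i = l i * M0.+1 + s i :> nat)%N.
  rewrite ffunE inordK// ME.
  have : (l i * M0.+1 + s i < (l i).+1 * M0.+1)%N by rewrite mulSn addnC ltn_add2r.
  by move=> /leq_trans; apply; rewrite mulnC leq_mul2l/= ltn_ord.
have phi_inj : injective phi.
  move=> s t /ffunP st; apply/ffunP => i; apply/val_inj/eqP.
  by rewrite /= -(eqn_add2l (l i * M0.+1)) -!phiE st.
have near s : `|z - gridpt (phi s)| < r.
  apply: normr_row_lt => // i; apply: le_lt_trans (wP i).
  rewrite !mxE phiE ME natrD !natrM.
  have s1 : (s i)%:R <= M0.+1%:R :> R by rewrite ler_nat ltnW.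
  have s0 : 0 <= (s i)%:R :> R by [].
  have := lP i; have wi := w0 i.
  have m0 : 0 < M0.+1%:R :> R by [].
  have p0 : 0 < P.+1%:R :> R by [].
  move: (M0.+1%:R) (P.+1%:R) ((s i)%:R) ((l i)%:R) m0 p0 s0 s1 => m p ss ll.
  move=> m0 p0 s0 s1 /andP[h1 h2].
  have E1 : (ll * m + ss) / (m * p) * w ord0 i = ll / p * w ord0 i + (ss / m) * (w ord0 i / p).
    by field; rewrite !gt_eqF.
  have E2 : (ll + 1) / p * w ord0 i = ll / p * w ord0 i + w ord0 i / p.
    by field; rewrite !gt_eqF.
  have u0 : 0 <= ss / m by rewrite divr_ge0// ltW.
  have u1 : ss / m <= 1 by rewrite ler_pdivrMr// mul1r.
  have wp : 0 < w ord0 i / p by rewrite divr_gt0.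
  rewrite E1; rewrite E2 in h2.
  move: (ss / m) (ll / p * w ord0 i) (w ord0 i / p) u0 u1 wp h1 h2 => u q wq *.
  by rewrite ler_norml; apply/andP; split; nra.
have S2 : \sum_(k : {ffun 'I_d -> 'I_M.+1}) \sum_i partial i (V i) (gridpt k) <=
    \sum_(k : {ffun 'I_d -> 'I_M.+1}) (A - (k \in codom phi)%:R * B).
  apply: ler_sum => k _; have bk := @gridpt_box M k.
  have {}bk : cbox (gridpt k).
    move=> j; have := bk j 0; rewrite mul0r scale0r addr0; apply.
    by rewrite lexx ler01.
  case: codomP => [[s ks]|_]; rewrite ?mul1r ?mul0r ?subr0; last exact: divA.
  apply: (@le_trans _ _ (- B)); last by rewrite -[leLHS]add0r lerD2r.
  by apply: divB => //; rewrite ks.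
have := le_trans S1 S2.
have -> : \sum_(k : {ffun 'I_d -> 'I_M.+1}) (A - (k \in codom phi)%:R * B) =
    A * (M.+1%:R ^+ d) - M0.+1%:R ^+ d * B.
  rewrite sumrB sumr_const card_ffun !card_ord -[A *+ _]mulr_natr natrX.
  rewrite -mulr_suml -natr_sum.
  have -> : (\sum_(k : {ffun 'I_d -> 'I_M.+1}) (k \in codom phi) = #|codom phi|)%N.
    by rewrite -sum1_card [RHS]big_mkcond; apply: eq_bigr => k _; case: (k \in _).
  by rewrite card_codom// card_ffun !card_ord natrX.
rewrite natrX ME natrM exprMn.
have : 0 < M0.+1%:R ^+ d :> R by rewrite exprn_gt0.
move: (M0.+1%:R ^+ d) (P.+1%:R ^+ d) P0 => m p p0 m0 H.
rewrite -(ler_pM2l m0); move: H.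
have -> : eta / p * (m * p) = eta * m by field; rewrite gt_eqF.
nra.
Qed.

End Divergence.

(** * Localization of a conserved current *)

Section PosSquare.
Context {R : realType}.

(** The square of the positive part is C^1, as the weights must be, and of higher order than its
    derivative for large arguments. *)
Definition possq (s : R) : R := Num.max 0 s ^+ 2.

Lemma possq_ge0 s : 0 <= possq s. Proof. exact: sqr_ge0. Qed.

Lemma possq_le0 s : s <= 0 -> possq s = 0.
Proof. by move=> s0; rewrite /possq max_l// expr0n. Qed.

Lemma possqE s : 0 <= s -> possq s = s ^+ 2.
Proof. by move=> s0; rewrite /possq max_r. Qed.

Lemma is_derive_possq (s : R) : is_derive s 1 possq (2 * Num.max 0 s).
Proof.
have [s0|s0|<-] := ltgtP 0 s.
- have H : is_derive s 1 (fun t : R => t ^+ 2) (2 * s).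
    by apply: is_derive_eq; rewrite [_ *: _]mulr1 mulr_natl.
  apply: near_eq_is_derive H; near=> t; rewrite possqE//.
  by apply: ltW; near: t; exact: lt_nbhsr.
- rewrite mulr0; have H : is_derive s 1 (fun=> 0 : R) 0 by exact: is_derive_cst.
  apply: near_eq_is_derive H; near=> t; rewrite possq_le0//.
  by apply: ltW; near: t; exact: lt_nbhsl.
rewrite mulr0.
suff H : h^-1 *: (possq (h *: (1 : R) + 0) - possq 0) @[h --> (0 : R)^'] --> (0 : R).
  by split; [exact: cvgP H|exact: cvg_lim H].
apply/cvgrPdist_le => eps eps0; near=> h.
rewrite sub0r normrN addr0 [h *: 1]mulr1 (possq_le0 (lexx 0)) subr0.
have hn0 : h != 0 by near: h; exact: nbhs_dnbhs_neq.
apply: (@le_trans _ _ `|h|).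
  rewrite normrZ normfV ler_pdivrMl ?normr_gt0// (ger0_norm (possq_ge0 h)).
  rewrite -normrM -expr2 (ger0_norm (sqr_ge0 h)).
  have [h0|h0] := leP 0 h; first by rewrite possqE.
  by rewrite possq_le0 ?(ltW h0)// sqr_ge0.
by near: h; exact: (@dnbhs0_le _ R^o).
Unshelve. all: by end_near. Qed.

Lemma possq_derivable s : derivable possq s 1.
Proof. by have [] := is_derive_possq s. Qed.

Lemma possq_derive1 : possq^`()%classic = fun s => 2 * Num.max 0 s.
Proof. by apply/funext => s; rewrite derive1E; have [_ ->] := is_derive_possq s. Qed.

Lemma possq_derive1_continuous : continuous possq^`()%classic.
Proof.
rewrite possq_derive1 => s; apply: cvgMl_tmp.
apply/cvgrPdist_le => eps eps0; near=> t.
apply: (@le_trans _ _ `|s - t|); last by near: t; exact: cvgr_dist_le.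
by rewrite ler_norml; have [] := lerP 0 s; have [] := lerP 0 t;
  have := ler_norm (s - t); have := ler_norm (t - s); rewrite (distrC t s); lra.
Unshelve. all: by end_near.
Qed.

Lemma ln_derivable (s : R) : 0 < s -> derivable (@ln R) s 1.
Proof. by move=> /is_derive1_ln[]. Qed.

Lemma ln_derive1 (s : R) : 0 < s -> (@ln R)^`()%classic s = s^-1.
Proof. by move=> s0; rewrite derive1E; have [_ ->] := is_derive1_ln s0. Qed.

Lemma ln_derive1_continuous (s : R) : 0 < s -> {for s, continuous (@ln R)^`()%classic}.
Proof.
move=> s0; rewrite /prop_for /continuous_at ln_derive1//.
have H : t^-1 @[t --> s] --> s^-1 by exact: inv_continuous (lt0r_neq0 s0).
apply: cvg_trans H; apply: near_eq_cvg.
by near=> t; rewrite ln_derive1//; near: t; exact: lt_nbhsr.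
Unshelve. all: by end_near. Qed.

End PosSquare.
Arguments possq_derivable {R} s.

(** * A divergence-free field tested against a logarithmic weight *)

Section Localization.
Context {R : realType} {d : nat}.
Local Notation e_ i := (delta_mx ord0 i).
Implicit Types (U : set 'rV[R]_d) (f : 'rV[R]_d -> R) (z : 'rV[R]_d).

Lemma open_pos U f : open U -> (forall z, U z -> {for z, continuous f}) ->
  open [set z | U z /\ 0 < f z].
Proof.
move=> oU cf; rewrite openE => z [Uz fz].
have /nbhs_rowP[r1 r10 r1P] := open_nbhs_nbhs (conj oU Uz).
have /nbhs_rowP[r2 r20 r2P] := cf z Uz _ (lt_nbhsr fz).
apply/nbhs_rowP; exists (Num.min r1 r2); first by rewrite lt_min r10.
by move=> y; rewrite lt_min => /andP[/r1P Uy /r2P fy].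
Qed.

Variables (a w : 'rV[R]_d) (D B : set 'rV[R]_d).
Variables (f sigma q : 'rV[R]_d -> R) (P : 'I_d -> 'rV[R]_d -> R).
Variables (C : R) (z0 : 'rV[R]_d).
Hypothesis w0 : forall i, 0 < w ord0 i.
Hypotheses (oB : open B) (boxB : cbox a w `<=` B).
Hypotheses (Cf : Ck 1 B f) (Df : forall z, B z -> (D z <-> 0 < f z)).
Hypotheses (CP : forall j, Ck 1 (D `&` B) (P j)).
Hypothesis (divP : forall z, (D `&` B) z -> \sum_j partial j (P j) z = 0).
Hypothesis (Csigma : Ck 1 setT sigma).
Hypothesis (face : forall z, cbox a w z -> D z -> forall j,
  z ord0 j = a ord0 j \/ z ord0 j = a ord0 j + w ord0 j ->
  P j z = 0 \/ sigma z <= 0).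
Hypothesis C0 : 0 <= C.
Hypothesis flux_in : forall z, cbox a w z -> D z -> 0 < sigma z ->
  \sum_j partial j f z * P j z <= C * f z.
Hypothesis flux_speed : forall z, cbox a w z -> D z -> 0 < sigma z ->
  \sum_j partial j sigma z * P j z <= - q z.
Hypothesis q_ge0 : forall z, cbox a w z -> D z -> 0 < sigma z -> 0 <= q z.
Hypotheses (bz0 : cbox a w z0) (Dz0 : D z0) (sz0 : 0 < sigma z0).
Hypotheses (cq : {for z0, continuous q}) (qz0 : 0 < q z0).

(* The logarithm makes [f * h'(f)] of smaller order than [h(f)] as [L] grows, so
   that an inflow bounded by [C * f] is negligible. *)
Let weight L z := possq (sigma z) * possq (L + ln (f z)).
Let V L j z := if 0 < f z then weight L z * P j z else 0.
Let Bp := [set z | B z /\ 0 < f z].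

Let oBp : open Bp.
Proof. by apply: open_pos => // z Bz; exact: Ck_continuous Cf Bz. Qed.

Let BpE : Bp `<=` D `&` B.
Proof. by move=> z [Bz fz]; split=> //; apply/Df. Qed.

Let C_possq_sigma : Ck 1 setT (fun z => possq (sigma z)).
Proof.
apply: (C1_comp1 openT Csigma).
  by move=> z _; exact: possq_derivable.
by move=> z _; exact: possq_derive1_continuous.
Qed.

Let C_ln : Ck 1 Bp (fun z => ln (f z)).
Proof.
apply: (C1_comp1 oBp).
- by apply: Ck_sub Cf => z [].
- by move=> z [_ fz]; exact: ln_derivable.
- by move=> z [_ fz]; exact: ln_derive1_continuous.
Qed.

Let C_Lln L : Ck 1 Bp (fun z => L + ln (f z)).
Proof. by apply: (CkD oBp _ C_ln); exact: Ck_cst. Qed.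

Let C_possq_ln L : Ck 1 Bp (fun z => possq (L + ln (f z))).
Proof.
apply: (C1_comp1 oBp (C_Lln L)).
  by move=> z _; exact: possq_derivable.
by move=> z _; exact: possq_derive1_continuous.
Qed.

Let C_weight L : Ck 1 Bp (weight L).
Proof. by apply: (CkM oBp _ (C_possq_ln L)); apply: Ck_sub C_possq_sigma. Qed.

Let C_prod L j : Ck 1 Bp (fun z => weight L z * P j z).
Proof. by apply: (CkM oBp (C_weight L)); apply: Ck_sub (CP j); exact: BpE. Qed.

Let VE L j z : Bp z -> V L j z = weight L z * P j z.
Proof. by move=> [_ fz]; rewrite /V fz. Qed.

(** The cutoff vanishes already for [f] below [expR (- L)], so the extension by 0 to [f <= 0], where
    [ln] has only its default value, leaves the field C^1. *)
Let V0 L j z : f z < expR (- L) -> V L j z = 0.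
Proof.
rewrite /V; case: ifP => // fz fe.
rewrite /weight (_ : possq (L + _) = 0) ?mulr0 ?mul0r//; apply: possq_le0.
rewrite -lerBrDl sub0r -[- L]expRK ler_ln ?posrE ?expR_gt0//.
exact: ltW.
Qed.

Let C_V L j : Ck 1 B (V L j).
Proof.
apply: Ck_local => z Bz; have [fz|fz] := ltP 0 (f z).
  exists Bp; first by []. apply: (Ck_eq oBp _ (C_prod L j)) => y By.
  by rewrite VE.
exists [set z | B z /\ 0 < expR (- L) - f z].
  split; last by split=> //; rewrite subr_gt0 (le_lt_trans fz)// expR_gt0.
  apply: open_pos => // y By.
  have : Ck 1 B (fun y => expR (- L) - f y) by apply: (CkB oB _ Cf); exact: Ck_cst.
  by move=> /Ck_continuous; exact.
apply: (Ck_eq _ _ (Ck_cst 1 _ 0)); last first.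
  by move=> y [By]; rewrite subr_gt0 => /V0 ->.
apply: open_pos => // y By.
have : Ck 1 B (fun y => expR (- L) - f y) by apply: (CkB oB _ Cf); exact: Ck_cst.
by move=> /Ck_continuous; exact.
Qed.

Let partial_V L j z : Bp z -> partial j (V L j) z =
  (2 * Num.max 0 (sigma z) * partial j sigma z * possq (L + ln (f z)) +
   possq (sigma z) * (2 * Num.max 0 (L + ln (f z)) * ((f z)^-1 * partial j f z))) * P j z
  + weight L z * partial j (P j) z.
Proof.
move=> Bz; have [_ fz] := Bz.
rewrite (partial_eq j oBp (fun y => @VE L j y) Bz).
rewrite partialM; [|exact: (Ck_derivable (C_weight L) Bz)|
  exact: (Ck_derivable (CP j) (BpE Bz))].
congr (_ * _ + _).
rewrite partialM; [|exact: (Ck_derivable C_possq_sigma I)|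
  exact: (Ck_derivable (C_possq_ln L) Bz)].
have D1 : partial j (fun z => possq (sigma z)) z =
    2 * Num.max 0 (sigma z) * partial j sigma z.
  rewrite (partial_comp1 (Ck_derivable Csigma I) (possq_derivable (sigma z))).
  by rewrite possq_derive1.
have D2 : partial j (fun z => possq (L + ln (f z))) z =
    2 * Num.max 0 (L + ln (f z)) * ((f z)^-1 * partial j f z).
  rewrite (partial_comp1 (Ck_derivable (C_Lln L) Bz) (possq_derivable (L + ln (f z)))).
  rewrite possq_derive1; congr (_ * _).
  rewrite partialD; [|exact: derivable_cst|exact: (Ck_derivable C_ln Bz)].
  rewrite partial_cst add0r.
  rewrite (partial_comp1 (Ck_derivable Cf Bz.1) (ln_derivable fz)).
  by rewrite ln_derive1.
by rewrite D1 D2.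
Qed.

Let flux_V L : flux_field a w (V L).
Proof.
split=> [i z /boxB Bz|i z /boxB Bz|i z bz zi].
- exact: (Ck_derivable (C_V L i) Bz).
- exact: (Ck_continuous (Ck_partial i (C_V L i)) Bz).
rewrite /V; case: ifP => // fz.
have Dz : D z by apply/Df => //; exact: boxB.
have [->|sz] := face bz Dz zi; first by rewrite mulr0.
by rewrite /weight possq_le0// !mul0r.
Qed.

Let div_V L z : Bp z -> \sum_j partial j (V L j) z =
  2 * Num.max 0 (sigma z) * possq (L + ln (f z)) * (\sum_j partial j sigma z * P j z)
  + possq (sigma z) * (2 * Num.max 0 (L + ln (f z)) * ((f z)^-1 *
     \sum_j partial j f z * P j z)).
Proof.
move=> Bz; rewrite (eq_bigr _ (fun j _ => partial_V L j Bz)) big_split/=.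
rewrite -mulr_sumr divP ?mulr0 ?addr0; last exact: BpE.
rewrite !mulr_sumr -big_split/=; apply: eq_bigr => j _.
ring.
Qed.

(** With the parameter [L = m + t] the divergence is at most a multiple of [m + t + l], linear in t,
    because the inflow meets only the derivative of the cutoff. Near [z0] the term with q lowers
    this bound by [kap * t ^+ 2]. For large t this contradicts [divergence_balance]. *)
Lemma localization : False.
Proof.
have cB : compact (cbox a w) by exact: compact_cbox.
have [S S0 Sb] : exists2 S : R, 0 < S & forall z, cbox a w z -> `|sigma z| <= S.
  by apply: bounded_on_compact cB _ => z _; exact: Ck_continuous Csigma I.
have [F F0 Fb] : exists2 F : R, 0 < F & forall z, cbox a w z -> `|f z| <= F.
  by apply: bounded_on_compact cB _ => z /boxB; exact: Ck_continuous Cf.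
have fz0 : 0 < f z0 by apply/Df => //; exact: boxB.
have Bz0 := boxB bz0.
have Cf0 : {for z0, continuous f} := Ck_continuous Cf Bz0.
have Cs0 : {for z0, continuous sigma} := Ck_continuous Csigma I.
have [r r0 rP] : exists2 r : R, 0 < r & forall z, `|z0 - z| < r ->
    [/\ f z0 / 2 < f z, sigma z0 / 2 < sigma z & q z0 / 2 < q z].
  have half (x : R) : 0 < x -> x / 2 < x by move=> x0; lra.
  have /nbhs_rowP[r1 r10 r1P] := Cf0 _ (lt_nbhsr (half _ fz0)).
  have /nbhs_rowP[r2 r20 r2P] := Cs0 _ (lt_nbhsr (half _ sz0)).
  have /nbhs_rowP[r3 r30 r3P] := cq (lt_nbhsr (half _ qz0)).
  exists (Num.min r1 (Num.min r2 r3)); first by rewrite !lt_min r10 r20.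
  by move=> z; rewrite !lt_min => /and3P[/r1P ? /r2P ? /r3P].
have [c c0 cP] := divergence_balance w0 bz0 r0.
(* [m] makes [m + t + ln (f z)] at least t on the ball around [z0]; [l] bounds [ln (f z)] from above
   on the part of the box where f is positive. *)
pose m := `|ln (f z0 / 2)|; pose l := `|ln F|.
have m0 : 0 <= m := normr_ge0 _. have l0 : 0 <= l := normr_ge0 _.
have [k kE] : exists k, k = 2 * S ^+ 2 * C by exists (2 * S ^+ 2 * C).
have k0 : 0 <= k by rewrite kE; apply: mulr_ge0 => //; apply: mulr_ge0; last exact: sqr_ge0.
(* A lower bound on the ball for [2 * sigma z * q z], both functions keeping there at least half of
   their value at [z0]. *)
have [kap kapE] : exists kap, kap = sigma z0 * q z0 / 2 by eexists.
have kap0 : 0 < kap by rewrite kapE divr_gt0// mulr_gt0.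
have upper L : 0 <= L -> forall z, cbox a w z -> \sum_j partial j (V L j) z <=
    k * (L + l) - (if 0 < f z then 2 * Num.max 0 (sigma z) * possq (L + ln (f z)) * q z else 0).
  move=> L0 z bz; have Bz := boxB bz; have [fz|fz] := ltP 0 (f z); last first.
    rewrite subr0; apply: (@le_trans _ _ 0); last by rewrite mulr_ge0// addr_ge0.
    rewrite big1// => j _.
    rewrite (@partial_eq _ _ [set y | B y /\ 0 < expR (- L) - f y] _ (fun=> 0)).
    - by rewrite partial_cst.
    - apply: open_pos => // y By.
      have : Ck 1 B (fun y => expR (- L) - f y) by apply: (CkB oB _ Cf); exact: Ck_cst.
      by move=> /Ck_continuous; exact.
    - by move=> y [_]; rewrite subr_gt0 => /V0 ->.
    - by split=> //; rewrite subr_gt0 (le_lt_trans fz)// expR_gt0.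
  have Dz : D z by apply/Df.
  rewrite div_V//; have [sz|sz] := leP (sigma z) 0.
    rewrite (possq_le0 sz) ?(mulr0, mul0r) addr0 subr0.
    by rewrite mulr_ge0// addr_ge0.
  rewrite [leLHS]addrC; apply: lerD; last first.
    rewrite -mulrN; apply: ler_wpM2l; last exact: flux_speed.
    by rewrite mulr_ge0 ?possq_ge0// mulr_ge0// ltW.
  have h1 : (f z)^-1 * (\sum_j partial j f z * P j z) <= C.
    by rewrite ler_pdivrMl// mulrC; exact: flux_in.
  have h2 : 0 <= Num.max 0 (L + ln (f z)) <= L + l.
    rewrite le_max lexx/= ge_max addr_ge0//= lerD2l.
    apply: le_trans (ler_norm (ln F)); rewrite ler_ln ?posrE//.
    by apply: le_trans (Fb _ bz); exact: ler_norm.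
  have h3 : 0 <= possq (sigma z) <= S ^+ 2.
    rewrite possq_ge0/= possqE ?(ltW sz)// lerXn2r ?nnegrE ?(ltW sz) ?(ltW S0)//.
    by apply: le_trans (Sb _ bz); exact: ler_norm.
  have /andP[h2a h2b] := h2; have /andP[h3a h3b] := h3.
  apply: (@le_trans _ _ (possq (sigma z) * (2 * Num.max 0 (L + ln (f z)) * C))).
    by rewrite ler_wpM2l// ler_wpM2l// mulr_ge0.
  rewrite (_ : k * (L + l) = S ^+ 2 * (2 * (L + l) * C)); last by rewrite kE; ring.
  apply: ler_pM => //; first by rewrite !mulr_ge0.
  by rewrite ler_wpM2r// ler_wpM2l.
have [k' k'E] : exists k', k' = k * (m + l + 1) by eexists.
have k'0 : 0 <= k' by rewrite k'E mulr_ge0// !addr_ge0.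
(* The solution of [c * kap * t = c * kap + (1 + c) * k']: then [c * kap * t ^+ 2] exceeds
   [(1 + c) * k' * t], which dominates [1 + c] times the linear bound. *)
have [t tdef] : exists t, t = 1 + (1 + c) * k' / (c * kap) by eexists.
have t1 : 1 <= t.
  rewrite tdef lerDl; apply: divr_ge0; last by apply: mulr_ge0; apply: ltW.
  by apply: mulr_ge0 => //; apply: addr_ge0 => //; exact: ltW.
have tE : c * kap * t = c * kap + (1 + c) * k'.
  have ckn : c * kap != 0 by rewrite gt_eqF// mulr_gt0.
  by rewrite tdef; move: (c * kap) ckn ((1 + c) * k') => u un v; field.
have A_le : k * (m + t + l) <= k' * t.
  rewrite k'E -mulrA ler_wpM2l//; nra.
have L0 : 0 <= m + t by rewrite addr_ge0// (le_trans _ t1).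
have A0 : 0 <= k * (m + t + l) by rewrite mulr_ge0// addr_ge0.
have B0 : 0 <= kap * t ^+ 2 - k * (m + t + l).
  rewrite subr_ge0; apply: le_trans A_le _; rewrite expr2 mulrA ler_wpM2r ?(le_trans _ t1)//.
  rewrite -(ler_pM2l c0) mulrA tE; move: (c * kap) (mulr_gt0 c0 kap0) => u; nra.
suff : c * (kap * t ^+ 2 - k * (m + t + l)) <= k * (m + t + l).
  rewrite mulrBr lerBlDr expr2 !mulrA tE => H.
  have : (c * kap + (1 + c) * k') * t <= (1 + c) * (k' * t).
    by apply: le_trans H _; rewrite -mulrA mulrDl mul1r lerD// ler_wpM2l// ltW.
  have ck : 0 < c * kap by rewrite mulr_gt0.
  have t0 : 0 < t := lt_le_trans ltr01 t1.
  have := mulr_gt0 ck t0; move: (c * kap) ck (k' * t) => u ck v; nra.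
apply: (cP _ _ _ (flux_V (m + t)) A0 B0).
- move=> z bz; apply: le_trans (upper _ L0 z bz) _.
  rewrite gerDl oppr_le0; case: ltP => fz; rewrite ?lexx//.
  have [sz|sz] := leP (sigma z) 0; first by rewrite ?(mulr0, mul0r).
  rewrite mulr_ge0//; first by rewrite mulr_ge0 ?possq_ge0// mulr_ge0// ltW.
  by apply: q_ge0 => //; apply/Df => //; exact: boxB.
- move=> z bz /rP[fz sz qz]; apply: le_trans (upper _ L0 z bz) _.
  have fz' : 0 < f z by apply: lt_trans fz; rewrite divr_gt0.
  rewrite fz' opprB lerD2l lerN2.
  have sz' : 0 < sigma z by apply: lt_trans sz; rewrite divr_gt0.
  rewrite max_r ?(ltW sz')//.
  have tl : t <= m + t + ln (f z).
    rewrite addrAC lerDr -lerBlDl sub0r.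
    apply: (@le_trans _ _ (ln (f z0 / 2))); last first.
      by rewrite ler_ln ?posrE ?divr_gt0// ltW.
    by rewrite lerNl; apply: le_trans (ler_norm _) _; rewrite normrN.
  have t0 : 0 <= t := le_trans ler01 t1.
  rewrite possqE; last exact: le_trans tl.
  apply: (@le_trans _ _ (2 * (sigma z0 / 2) * t ^+ 2 * (q z0 / 2))).
    by rewrite kapE le_eqVlt; apply/orP; left; apply/eqP; field.
  have q0' : 0 <= q z0 / 2 by rewrite divr_ge0// ltW.
  have s0' : 0 <= sigma z0 / 2 by rewrite divr_ge0// ltW.
  have s2 : 0 <= 2 * (sigma z0 / 2) by rewrite mulr_ge0.
  apply: ler_pM; [|exact: q0'| |exact: ltW].
    by apply: mulr_ge0; [exact: s2|exact: sqr_ge0].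
  apply: ler_pM; [exact: s2|exact: sqr_ge0|by rewrite ler_wpM2l// ltW|].
  by rewrite lerXn2r ?nnegrE// (le_trans t0).
Qed.

End Localization.

(** * Energy current *)

Section Current.
Context {R : realType} {n : nat}.
Implicit Types (W : set 'rV[R]_n.+1) (u : 'rV[R]_n.+1 -> R) (z : 'rV[R]_n.+1).
Variables (a : 'I_n.+1 -> 'I_n.+1 -> 'rV[R]_n.+1 -> R) (u : 'rV[R]_n.+1 -> R).

Definition momentum j z : R := \sum_k a j k z * partial k u z.

Definition lagrangian z : R :=
  \sum_j \sum_k a j k z * partial j u z * partial k u z.

(* The energy density (j = 0) and the energy flux (j > 0). *)
Definition current j z : R :=
  partial ord0 u z * momentum j z - (if j == ord0 then 2^-1 * lagrangian z else 0).

Variable W : set 'rV[R]_n.+1.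
Hypotheses (oW : open W) (Ca : forall j k, Ck 1 W (a j k)) (Cu : Ck 2 W u).

Let C_du j : Ck 1 W (partial j u). Proof. exact: Ck_partial. Qed.

Let C_term j k : Ck 1 W (fun z => a j k z * partial k u z).
Proof. exact: (CkM oW (Ca j k) (C_du k)). Qed.

Lemma momentum_C1 j : Ck 1 W (momentum j).
Proof. by apply: Ck_sum => // k _; exact: C_term. Qed.

Let C_quad j k : Ck 1 W (fun z => a j k z * partial j u z * partial k u z).
Proof. exact: (CkM oW (CkM oW (Ca j k) (C_du j)) (C_du k)). Qed.

Lemma lagrangian_C1 : Ck 1 W lagrangian.
Proof.
by apply: Ck_sum => // j _; apply: Ck_sum => // k _; exact: C_quad.
Qed.

Lemma current_C1 j : Ck 1 W (current j).
Proof.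
apply: (CkB oW (CkM oW (C_du ord0) (momentum_C1 j))).
case: (j == ord0); last exact: Ck_cst.
exact: (CkZ _ oW lagrangian_C1).
Qed.

Hypothesis a_sym : forall j k z, W z -> a j k z = a k j z.
Hypothesis a_time : forall j k z, W z -> partial ord0 (a j k) z = 0.

(** Noether's identity for time translations. The term with the equation drops out. The remaining
    sum of [partial j (partial ord0 u) z * momentum j z] is half the time derivative of the
    Lagrangian, since the coefficients are symmetric and static and the derivatives of u commute. *)
Lemma current_div z : W z ->
  \sum_j \sum_k partial j (fun y => a j k y * partial k u y) z = 0 ->
  \sum_j partial j (current j) z = 0.
Proof.
move=> Wz eqn.
have Dc j : partial j (current j) z =
    partial j (partial ord0 u) z * momentum j z
    + partial ord0 u z * (\sum_k partial j (fun y => a j k y * partial k u y) z)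
    - (if j == ord0 then 2^-1 * partial ord0 lagrangian z else 0).
  rewrite (_ : current j = fun z => partial ord0 u z * momentum j z +
    - (if j == ord0 then 2^-1 * lagrangian z else 0)); last by [].
  rewrite partialD; first last.
  - suff : Ck 1 W (fun z => - (if j == ord0 then 2^-1 * lagrangian z else 0)).
      by move=> /Ck_derivable; exact.
    apply: (CkN oW); case: (j == ord0); last exact: Ck_cst.
    exact: (CkZ _ oW lagrangian_C1).
  - exact: (Ck_derivable (CkM oW (C_du ord0) (momentum_C1 j)) Wz).
  rewrite partialM; [|exact: (Ck_derivable (C_du ord0) Wz)|
    exact: (Ck_derivable (momentum_C1 j) Wz)].
  rewrite (partial_sum (F := fun k y => a j k y * partial k u y) _ _ oW)//.
  congr (_ + _); have [->|_] := eqVneq j ord0; last first.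
    by rewrite (_ : (fun=> - 0) = fun=> 0) ?partial_cst ?oppr0//; apply/funext => ?; rewrite oppr0.
  rewrite (_ : (fun z => - _) = fun z => (- 2^-1) * lagrangian z); last first.
    by apply/funext => y; rewrite mulNr.
  rewrite partialM; [|exact: derivable_cst|exact: (Ck_derivable lagrangian_C1 Wz)].
  by rewrite partial_cst mul0r add0r mulNr.
have Dl : partial ord0 lagrangian z =
    2 * \sum_j partial j (partial ord0 u) z * momentum j z.
  rewrite (partial_sum (F := fun j y => \sum_k a j k y * partial j u y * partial k u y) _ _ oW)//; last first.
    by move=> j; apply: Ck_sum => // k _; exact: C_quad.
  rewrite mulr_natl mulr2n.
  have E : \sum_j partial j (partial ord0 u) z * momentum j z =
     \sum_j \sum_k a j k z * partial j (partial ord0 u) z * partial k u z.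
    apply: eq_bigr => j _; rewrite mulr_sumr; apply: eq_bigr => k _; ring.
  have E' : \sum_j partial j (partial ord0 u) z * momentum j z =
     \sum_j \sum_k a j k z * partial j u z * partial k (partial ord0 u) z.
    rewrite E exchange_big/=; apply: eq_bigr => j _; apply: eq_bigr => k _.
    rewrite a_sym//; ring.
  rewrite {1}E E' -big_split/=; apply: eq_bigr => j _.
  rewrite (partial_sum (F := fun k y => a j k y * partial j u y * partial k u y) _ _ oW)//.
  rewrite -big_split/=; apply: eq_bigr => k _.
  rewrite partialM; [|exact: (Ck_derivable (CkM oW (Ca j k) (C_du j)) Wz)|
    exact: (Ck_derivable (C_du k) Wz)].
  rewrite partialM; [|exact: (Ck_derivable (Ca j k) Wz)|exact: (Ck_derivable (C_du j) Wz)].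
  rewrite (a_time j k Wz) mul0r add0r (Schwarz ord0 j oW Cu Wz) (Schwarz ord0 k oW Cu Wz).
  reflexivity.
rewrite (eq_bigr _ (fun j _ => Dc j)) sumrB big_split/= -mulr_sumr eqn mulr0 addr0.
rewrite -big_mkcond big_pred1_eq Dl mulrA mulVf ?mul1r ?subrr//.
Qed.

End Current.

(** * Algebra of the energy current at a point *)

Section Pointwise.
Context {R : realType} {n : nat}.
Variables (A : 'I_n.+1 -> 'I_n.+1 -> R) (v : 'I_n.+1 -> R).
Hypothesis A_sym : forall j k, A j k = A k j.
Local Notation l0 := (lift ord0).

Definition sform (v w : 'I_n -> R) : R := \sum_j \sum_k A (l0 j) (l0 k) * v j * w k.

Hypothesis A_neg : forall w, sform w w <= 0.

Lemma sformC w1 w2 : sform w1 w2 = sform w2 w1.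
Proof.
rewrite /sform exchange_big/=; apply: eq_bigr => j _; apply: eq_bigr => k _.
by rewrite A_sym mulrAC.
Qed.

Lemma sform_comb (c : R) w1 w2 : sform (fun i => c * w1 i + w2 i) (fun i => c * w1 i + w2 i)
  = c ^+ 2 * sform w1 w1 + 2 * c * sform w1 w2 + sform w2 w2.
Proof.
rewrite mulr_natl mulr2n mulrDl {2}(sformC w1) /sform !mulr_sumr -!big_split/=.
apply: eq_bigr => j _; rewrite !mulr_sumr -!big_split/=; apply: eq_bigr => k _; ring.
Qed.

(** Cauchy-Schwarz for a semidefinite form: a vector where the form vanishes is a maximum, so there
    is no linear part there. *)
Lemma sform_null w1 : sform w1 w1 = 0 -> forall w2, sform w1 w2 = 0.
Proof.
move=> w10 w2; set b := sform w1 w2; pose q := sform w2 w2.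
have q0 : q <= 0 by exact: A_neg.
have [//|b0] := eqVneq b 0.
(* This coefficient gives the form the value 1 at the combination. *)
have := A_neg (fun i => ((1 - q) / (2 * b)) * w1 i + w2 i).
rewrite sform_comb w10 mulr0 add0r -/b -/q.
have -> : 2 * ((1 - q) / (2 * b)) * b = 1 - q by field.
lra.
Qed.

Let mom j := \sum_k A j k * v k.

Lemma momE j : mom j = A j ord0 * v ord0 + \sum_k A j (l0 k) * v (l0 k).
Proof. by rewrite /mom big_ord_recl. Qed.

Lemma smomE (s : 'I_n -> R) : \sum_j s j * mom (l0 j) =
  v ord0 * (\sum_j s j * A (l0 j) ord0) + sform s (fun k => v (l0 k)).
Proof.
rewrite /sform mulr_sumr -big_split/=; apply: eq_bigr => j _.
rewrite momE mulrDr mulr_sumr; congr (_ + _); first by ring.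
by apply: eq_bigr => k _; ring.
Qed.

Lemma lagE : \sum_j \sum_k A j k * v j * v k =
  2 * v ord0 * mom ord0 - A ord0 ord0 * v ord0 ^+ 2 + sform (fun k => v (l0 k)) (fun k => v (l0 k)).
Proof.
rewrite big_ord_recl.
have -> : \sum_k A ord0 k * v ord0 * v k = v ord0 * mom ord0.
  by rewrite /mom mulr_sumr; apply: eq_bigr => k _; ring.
have -> : \sum_(i < n) \sum_k A (l0 i) k * v (l0 i) * v k =
    v ord0 * (\sum_(i < n) A ord0 (l0 i) * v (l0 i)) +
    sform (fun k => v (l0 k)) (fun k => v (l0 k)).
  rewrite /sform mulr_sumr -big_split/=; apply: eq_bigr => i _.
  by rewrite big_ord_recl/= (A_sym (l0 i) ord0); congr (_ + _); ring.
rewrite momE; ring.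
Qed.

(** Here [s] is the spatial gradient of a cutoff whose time derivative is -1. Completing the square
    with the spatial part of [v] shifted by [v ord0] times [s] absorbs the mixed term of the flux.
    Of the coefficient [A ord0 ord0 / 2] in the energy density the hypothesis consumes one half. *)
Lemma current_speed (s : 'I_n -> R) :
  \sum_j s j * A (l0 j) ord0 - 2^-1 * sform s s <= A ord0 ord0 / 4 ->
  - (v ord0 * mom ord0 - 2^-1 * (\sum_j \sum_k A j k * v j * v k)) +
    \sum_j s j * (v ord0 * mom (l0 j)) <= - (A ord0 ord0 / 4 * v ord0 ^+ 2).
Proof.
move=> hs.
rewrite (eq_bigr (fun j => v ord0 * (s j * mom (l0 j)))); last by move=> j _; ring.
rewrite -mulr_sumr smomE lagE.
have := A_neg (fun i => v ord0 * s i + v (l0 i)); rewrite sform_comb.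
have := ler_wpM2r (sqr_ge0 (v ord0)) hs.
move: (sform s s) (sform s _) (sform _ _) (\sum_j _) (mom _) => *.
lra.
Qed.

Lemma current_boundary (s : 'I_n -> R) : sform s s = 0 ->
  \sum_j s j * A (l0 j) ord0 <= 0 -> \sum_j s j * (v ord0 * mom (l0 j)) <= 0.
Proof.
move=> s0 bs.
rewrite (eq_bigr (fun j => v ord0 * (s j * mom (l0 j)))); last by move=> j _; ring.
rewrite -mulr_sumr smomE sform_null// addr0 mulrA -expr2.
by rewrite mulr_ge0_le0// sqr_ge0.
Qed.

End Pointwise.

(** * Comparison along coordinate lines *)

Section LineComparison.
Context {R : realType} {d : nat}.
Local Notation e_ i := (delta_mx ord0 i).
Implicit Types (x y z : 'rV[R]_d).

Lemma line_continuous (f : 'rV[R]_d -> R) (X : set 'rV[R]_d) z v (s l : R) :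
  (forall y, X y -> {for y, continuous f}) ->
  (forall t, 0 <= t <= l -> X (z + (s * t) *: v)) ->
  {within `[0, l], continuous (fun t => f (z + (s * t) *: v))}.
Proof.
move=> cf Xl; apply: continuous_in_subspaceT => t; rewrite inE/= in_itv/= => tl.
apply: (@continuous_comp _ _ _ (fun t => z + (s * t) *: v) f); last exact/cf/Xl.
apply: cvgD; first exact: cvg_cst.
by apply: cvgZr_tmp; apply: cvgMl_tmp; exact: cvg_id.
Qed.

(** Along the signed axis f decreases at rate at least c, so it vanishes within the length
    [f z / c], and by monotonicity it is nonnegative until then. *)
Lemma descend_to_zero (f : 'rV[R]_d -> R) (X : set 'rV[R]_d) z (s c : R) i :
  0 < c -> s ^+ 2 = 1 ->
  (forall y, X y -> {for y, continuous f}) ->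
  (forall y, X y -> derivable f y (e_ i)) ->
  (forall y, X y -> c <= s * partial i f y) -> 0 < f z ->
  (forall t, 0 <= t <= f z / c -> X (z + (- s * t) *: e_ i)) ->
  exists t, [/\ 0 <= t <= f z / c, f (z + (- s * t) *: e_ i) = 0 &
    forall r, 0 <= r <= t -> 0 <= f (z + (- s * r) *: e_ i)].
Proof.
move=> c0 s1 cf df fc fz Xl.
pose phi t := f (z + (- s * t) *: e_ i).
have step t1 t2 : 0 <= t1 -> t1 <= t2 -> t2 <= f z / c ->
    phi t2 <= phi t1 - c * (t2 - t1).
  move=> t10 t12 t2l; rewrite /phi.
  have E : z + (- s * t2) *: e_ i = z + (- s * t1) *: e_ i + (- s * (t2 - t1)) *: e_ i.
    by rewrite -addrA -scalerDl -mulrDr [t1 + _]addrC subrK.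
  have pt (th : R) : 0 <= th <= 1 ->
      X (z + (- s * t1) *: e_ i + (th * (- s * (t2 - t1))) *: e_ i).
    move=> /andP[th0 th1]; rewrite -addrA -scalerDl mulrCA -mulrDr.
    apply: Xl; apply/andP; split; nra.
  have [|th th01] := @MVT_line R d f (z + (- s * t1) *: e_ i) (e_ i) (- s * (t2 - t1)).
    by move=> th th01; apply: df; exact: pt.
  rewrite -E => /eqP; rewrite subr_eq => /eqP ->.
  have := fc _ (pt th th01); rewrite /partial => H.
  rewrite addrC lerD2l mulrAC mulNr mulNr lerN2 ler_wpM2r// subr_ge0//.
have l0 : 0 <= f z / c by rewrite divr_ge0// ltW.
have phi0 : phi 0 = f z by rewrite /phi mulr0 scale0r addr0.
have phil : phi (f z / c) <= 0.
  apply: le_trans (step 0 _ (lexx 0) l0 (lexx _)) _.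
  by rewrite phi0 subr0 mulrCA divff ?mulr1 ?subrr// gt_eqF.
have cphi : {within `[0, f z / c], continuous phi}.
  by apply: (line_continuous cf) => t; exact: Xl.
have [t tl t0] : exists2 t, t \in `[0, f z / c]%R & phi t = 0.
  apply: IVT => //.
  by rewrite phi0 ge_min le_max phil orbT (ltW fz).
rewrite in_itv/= in tl; have /andP[tl0 tl1] := tl.
exists t; split=> // r /andP[r0 rt]; rewrite -/(phi r).
have := step r t r0 rt tl1; rewrite t0 => h.
have h' : 0 <= c * (t - r) by rewrite mulr_ge0 ?(ltW c0)// subr_ge0.
lra.
Qed.

Lemma closed_nonneg (X B : set 'rV[R]_d) (f : 'rV[R]_d -> R) : closed X -> X `<=` B ->
  (forall z, B z -> {for z, continuous f}) -> closed (X `&` [set z | 0 <= f z]).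
Proof.
move=> cX XB cf z cz.
have Xz : X z by apply: cX => A /cz[y [[Xy _] Ay]]; exists y.
split=> //=; rewrite leNgt; apply/negP => fz.
have [y [[_ /= fy] fy']] := cz _ (cf z (XB z Xz) _ (lt_nbhsl fz)).
by move: fy'; rewrite /= ltNge fy.
Qed.

(** Compare g at z with its value, at most 0, at the point where the descent along the axis meets
    [f = 0]; the distance is at most [f z / c]. The descent from a point of [X'] stays in [X], and
    the derivative of g is bounded only over [f >= 0], where g is known to be regular. *)
Lemma linear_flux_bound (f g : 'rV[R]_d -> R) (X X' W : set 'rV[R]_d) (s c : R) i :
  0 < c -> s ^+ 2 = 1 -> compact X ->
  (forall y, X y -> {for y, continuous f}) ->
  (forall y, X y -> derivable f y (e_ i)) ->
  (forall y, X y -> c <= s * partial i f y) ->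
  open W -> Ck 1 W g -> X `&` [set z | 0 <= f z] `<=` W ->
  (forall z, X z -> f z = 0 -> g z <= 0) ->
  (forall z, X' z -> 0 < f z ->
    forall t, 0 <= t <= f z / c -> X (z + (- s * t) *: e_ i)) ->
  exists2 C : R, 0 <= C & forall z, X' z -> 0 < f z -> g z <= C * f z.
Proof.
move=> c0 s1 cX cf df fc oW Cg KW g0 X'X.
have cK : compact (X `&` [set z | 0 <= f z]).
  apply: (subclosed_compact _ cX); last by move=> z [].
  apply: (@closed_nonneg X X) => //.
  by apply: compact_closed => //; exact: norm_hausdorff.
have [M M0 MP] : exists2 M : R, 0 < M &
    forall z, (X `&` [set z | 0 <= f z]) z -> `|partial i g z| <= M.
  apply: (bounded_on_compact cK) => z /KW Wz.
  exact: (Ck_continuous (Ck_partial i Cg) Wz).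
exists (M / c); first by rewrite divr_ge0// ltW.
move=> z X'z fz; have Xl := X'X z X'z fz.
have [t [tl ft fr]] := descend_to_zero c0 s1 cf df fc fz Xl.
have /andP[t0 t1] := tl.
have Kt th : 0 <= th <= 1 -> (X `&` [set z | 0 <= f z]) (z + (th * (- s * t)) *: e_ i).
  move=> /andP[th0 th1]; rewrite mulrCA; split; last by apply: fr; apply/andP; split; nra.
  by apply: Xl; apply/andP; split; nra.
have [|th th01 E] := @MVT_line R d g z (e_ i) (- s * t).
  by move=> th th01; apply: (Ck_derivable Cg); exact/KW/Kt.
have gt : g (z + (- s * t) *: e_ i) <= 0 by apply: g0 => //; exact: Xl.
have sn : `|s| = 1 by apply/eqP; rewrite -(@eqrXn2 _ 2)// real_normK ?num_real// s1 expr1n.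
have HM := MP _ (Kt th th01).
apply: (@le_trans _ _ (M * t)).
  have : `|- s * t * partial i g (z + (th * (- s * t)) *: e_ i)| <= t * M.
    rewrite normrM normrM normrN sn mul1r (ger0_norm t0); exact: ler_wpM2l.
  rewrite /partial -E ler_norml => /andP[h1 h2]; lra.
rewrite -mulrA ler_pM2l//; apply: le_trans t1 _.
by rewrite mulrC.
Qed.

End LineComparison.

(** * Splitting of space-time into time and space *)

Section SpaceTime.
Context {R : realType} {n : nat}.
Implicit Types (x y p : 'rV[R]_n) (z : 'rV[R]_n.+1) (U : set 'rV[R]_n).
Local Notation e_ i := (delta_mx ord0 i).

Definition event (t : R) x : 'rV[R]_n.+1 :=
  \row_k (if unlift ord0 k is Some i then x ord0 i else t).

Lemma spaceE z i : space z ord0 i = z ord0 (lift ord0 i).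
Proof. by rewrite /space mxE. Qed.

Lemma space_event t x : space (event t x) = x.
Proof. by apply/rowP => i; rewrite spaceE mxE liftK. Qed.

Lemma time_event t x : time (event t x) = t.
Proof. by rewrite /time mxE unlift_none. Qed.

Lemma event_eta z : event (time z) (space z) = z.
Proof.
apply/rowP => i; rewrite mxE; case: (unliftP ord0 i) => [j ->|->//].
exact: spaceE.
Qed.

Lemma norm_space z : `|space z| <= `|z|.
Proof. by apply: normr_row_le => // i; rewrite spaceE; exact: coord_le. Qed.

Lemma spaceB z z' : space (z - z') = space z - space z'.
Proof. by apply/rowP => i; rewrite !mxE. Qed.

Lemma norm_event_lt t x t' x' (r : R) : `|t - t'| < r -> `|x - x'| < r ->
  `|event t x - event t' x'| < r.
Proof.
move=> ht hx; apply: normr_row_lt => [|i]; first exact: le_lt_trans ht.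
rewrite !mxE; case: (unliftP ord0 i) => [j _|_//].
by apply: le_lt_trans hx; have := coord_le (x - x') j; rewrite !mxE.
Qed.

(** Since the norm is the sup norm, a box with cubic base is a time interval times a closed ball. *)
Lemma cbox_event T1 T p (rho : R) z : 0 <= rho ->
  cbox (event T1 (p - const_mx rho)) (event T (const_mx (2 * rho))) z <->
  T1 <= time z <= T1 + T /\ `|p - space z| <= rho.
Proof.
move=> rho0; split=> [bz|[tz pz]] => [|i].
  split; first by have := bz ord0; rewrite !mxE unlift_none.
  apply: normr_row_le => // i; have := bz (lift ord0 i).
  by rewrite -spaceE !mxE liftK !mxE ler_norml => /andP[h1 h2]; apply/andP; split; lra.
rewrite !mxE; case: (unliftP ord0 i) => [j ->|->//].
have := le_trans (coord_le (p - space z) j) pz.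
by rewrite -spaceE !mxE ler_norml => /andP[h1 h2]; apply/andP; split; lra.
Qed.

Lemma open_cylinder U : open U -> open (cylinder U : set 'rV[R]_n.+1).
Proof.
move=> oU; rewrite openE => z Uz; apply/nbhs_rowP.
have /nbhs_rowP[r r0 rU] := open_nbhs_nbhs (conj oU Uz).
exists r => // y zy; apply: rU; rewrite -spaceB.
exact: le_lt_trans (norm_space _) zy.
Qed.

Lemma Ck_space k U f : open U -> Ck k U f ->
  Ck k (cylinder U) (fun z : 'rV[R]_n.+1 => f (space z)).
Proof.
move=> oU Cf; apply: (Ck_comp (open_cylinder oU) oU _ Cf) => // j.
apply: (Ck_eq (open_cylinder oU) _ (Ck_coord k (lift ord0 j) (open_cylinder oU))).
by move=> z _; rewrite spaceE.
Qed.

Lemma derive_space U f z v : open U -> Ck 1 U f -> U (space z) ->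
  'D_v (fun z : 'rV[R]_n.+1 => f (space z)) z =
  \sum_j partial j f (space z) * v ord0 (lift ord0 j).
Proof.
move=> oU Cf Uz.
have Cs (j : 'I_n) : Ck 1 setT (fun y : 'rV[R]_n.+1 => space y ord0 j).
  apply: (Ck_eq openT _ (Ck_coord 1 (lift ord0 j) openT)).
  by move=> y _; rewrite spaceE.
have [_ ->] := chain_derive v openT oU Cf Cs I Uz.
apply: eq_bigr => j _; congr (_ * _).
have [_ <-] := is_derive_coord (lift ord0 j) z v.
by congr (derive _ z v); apply/funext => y; rewrite spaceE.
Qed.

Lemma partial0_space U f z : open U -> Ck 1 U f -> U (space z) ->
  partial ord0 (fun z : 'rV[R]_n.+1 => f (space z)) z = 0.
Proof.
move=> oU Cf Uz; rewrite /partial (derive_space _ oU Cf Uz) big1// => j _.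
by rewrite mxE eqxx/= (negbTE (neq_lift _ _)) mulr0 || rewrite mxE /= mulr0.
Qed.

Lemma partialS_space U f z i : open U -> Ck 1 U f -> U (space z) ->
  partial (lift ord0 i) (fun z : 'rV[R]_n.+1 => f (space z)) z = partial i f (space z).
Proof.
move=> oU Cf Uz; rewrite /partial (derive_space _ oU Cf Uz) (bigD1 i)//=.
rewrite mxE !eqxx mulr1 big1 ?addr0// => j ji.
by rewrite mxE eqxx (inj_eq lift_inj) (negbTE ji) mulr0.
Qed.

End SpaceTime.

(** * Uniqueness of solutions with tame boundary *)

Section Uniqueness.
Context {R : realType} {n : nat}.
Implicit Types (x y p : 'rV[R]_n) (z : 'rV[R]_n.+1).
Local Notation e_ i := (delta_mx ord0 i).
Variables (D U : set 'rV[R]_n) (W : set 'rV[R]_n.+1).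
Variables (b : 'I_n.+1 -> 'I_n.+1 -> 'rV[R]_n -> R) (u : 'rV[R]_n.+1 -> R).
Let a j k z := b j k (space z).
Hypotheses (oD : open D) (cD : compact (closure D)).
Hypotheses (oU : open U) (DU : closure D `<=` U) (Cb : forall j k, Ck 1 U (b j k)).
Hypothesis b_sym : forall j k x, closure D x -> b j k x = b k j x.
Hypothesis b_pos : forall x, closure D x -> 0 < b ord0 ord0 x.
Hypothesis b_neg : forall x, closure D x ->
  forall v, sform (fun j k => b j k x) v v <= 0.
Hypotheses (oW : open W) (DW : cylinder (closure D) `<=` W) (Cu : Ck 2 W u).
Hypothesis eqn : forall z, cylinder D z ->
  \sum_j \sum_k partial j (fun w => a j k w * partial k u w) z = 0.

Let flux j z := current a u (lift ord0 j) z.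

(* The last clause controls the energy flowing into D near p. *)
Definition tame_boundary p : Prop := exists B f (r : R),
  [/\ [/\ open B, B p, Ck 1 B f & forall x, B x -> (D x <-> 0 < f x)], 0 < r &
   forall T1 T2 : R, exists2 C : R, 0 <= C & forall z, `|p - space z| < r ->
     T1 <= time z <= T2 -> D (space z) ->
     \sum_j partial j f (space z) * flux j z <= C * f (space z)].

Lemma tame_interior p : D p -> tame_boundary p.
Proof.
move=> Dp; exists D, (fun=> 1), 1; split; last 2 first.
- exact: ltr01.
- move=> T1 T2; exists 0; first exact: lexx.
  move=> z _ _ _; rewrite mul0r big1// => j _; by rewrite partial_cst mul0r.
split; [exact: oD|exact: Dp|exact: Ck_cst|].
by move=> x Dx; split=> _; [exact: ltr01|exact: Dx].
Qed.

Let WU := W `&` cylinder U.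

Let oWU : open WU. Proof. by apply: openI => //; exact: open_cylinder. Qed.

Let Ca j k : Ck 1 WU (a j k).
Proof. by apply: (@Ck_sub _ _ _ (cylinder U)) (Ck_space oU (Cb j k)) => z []. Qed.

Let Cu' : Ck 2 WU u. Proof. by apply: Ck_sub Cu => z []. Qed.

Let C_current j : Ck 1 WU (current a u j).
Proof. exact: (current_C1 oWU Ca Cu'). Qed.

Let cylWU : cylinder (closure D) `<=` WU.
Proof. by move=> z Dz; split; [exact: DW|apply: DU; exact: Dz]. Qed.

Let DcD : D `<=` closure D. Proof. exact: subset_closure. Qed.

(** Through [linear_flux_bound], a sign of the flux on the zero set of f becomes a bound by a
    multiple of f inside D. The function f is C^2 because its gradient is a factor of the function
    that is compared. *)
Lemma tame_of_flux p B f : closure D p -> open B -> B p -> Ck 2 B f ->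
  (forall x, B x -> (D x <-> 0 < f x)) -> (exists i, partial i f p != 0) ->
  (forall z, B (space z) -> closure D (space z) -> f (space z) = 0 ->
     \sum_j partial j f (space z) * flux j z <= 0) ->
  tame_boundary p.
Proof.
move=> cDp oB Bp C2f Df [i fi] fl; have Cf := CkW C2f.
have [s s1 sf] : exists2 s : R, s ^+ 2 = 1 & 0 < s * partial i f p.
  case: (ltgtP (partial i f p) 0) fi => // h _.
    by exists (- 1); rewrite ?sqrrN ?expr1n// mulN1r oppr_gt0.
  by exists 1; rewrite ?expr1n// mul1r.
pose c := s * partial i f p / 2.
have c0 : 0 < c by rewrite divr_gt0.
have Csf : {for p, continuous (fun x => s * partial i f x)}.
  by apply: cvgMl_tmp; exact: (Ck_continuous (Ck_partial i Cf) Bp).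
have hc : c < s * partial i f p by rewrite /c; lra.
have /nbhs_rowP[r1 r10 r1P] := Csf _ (lt_nbhsr hc).
have /nbhs_rowP[r2 r20 r2P] := open_nbhs_nbhs (conj oB Bp).
have [rho rho0 rhoP] : exists2 rho : R, 0 < rho &
    forall x, `|p - x| <= 2 * rho -> B x /\ c <= s * partial i f x.
  exists (Num.min r1 r2 / 4); first by rewrite divr_gt0// lt_min r10.
  move=> x hx; have /andP[h1 h2] : (`|p - x| < r1) && (`|p - x| < r2).
    rewrite -lt_min; apply: le_lt_trans hx _.
    have : 0 < Num.min r1 r2 by rewrite lt_min r10.
    lra.
  by split; [exact: r2P|apply/ltW; exact: r1P].
have sn : `|s| = 1 by apply/eqP; rewrite -(@eqrXn2 _ 2)// real_normK ?num_real// s1 expr1n.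
(* The current is known to be regular only near the closed cylinder over D, so the zeros of f have
   to be limits of points of D: move a little along the axis in the direction of growth. *)
have zero_closure x : `|p - x| < 2 * rho -> 0 <= f x -> closure D x.
  move=> px; rewrite le_eqVlt => /orP[/eqP fx|fx]; last first.
    by apply/DcD/Df => //; have [] := rhoP x (ltW px).
  move=> A /nbhs_rowP[r r0 rA].
  pose t := Num.min (r / 2) ((2 * rho - `|p - x|) / 2).
  have t0 : 0 < t by rewrite lt_min !divr_gt0// subr_gt0.
  have nd : `|e_ i : 'rV[R]_n| <= 1.
    apply: normr_row_le => // l; rewrite mxE eqxx/=.
    by case: eqP; rewrite ?normr1 ?normr0 ?ler01.
  have near th : 0 <= th <= 1 -> `|p - (x + (th * (s * t)) *: e_ i)| <= 2 * rho /\
      `|x - (x + (th * (s * t)) *: e_ i)| < r.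
    move=> /andP[th0 th1].
    have h : `|(th * (s * t)) *: (e_ i : 'rV[R]_n)| <= t.
      rewrite normrZ normrM normrM sn mul1r (ger0_norm th0) (gtr0_norm t0).
      rewrite -[leRHS]mulr1; apply: ler_pM => //; first by rewrite mulr_ge0// ltW.
      by rewrite ler_piMl// ltW.
    split.
      rewrite opprD addrA; apply: le_trans (ler_normB _ _) _.
      have : t <= (2 * rho - `|p - x|) / 2 by rewrite /t ge_min lexx orbT.
      by move: h; move: `|_ *: _| `|p - x| px => *; lra.
    rewrite opprD addNKr normrN; apply: le_lt_trans h _.
    have : t <= r / 2 by rewrite /t ge_min lexx.
    lra.
  have [|th th01 E] := @MVT_line R n f x (e_ i) (s * t).
    by move=> th /near[/rhoP[Bx _] _]; exact: (Ck_derivable Cf Bx).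
  have one01 : 0 <= (1 : R) <= 1 by rewrite lexx ler01.
  have [n1 n2] := near 1 one01; rewrite mul1r in n1 n2.
  exists (x + (s * t) *: e_ i); split; last exact: rA.
  apply/Df; first by have [] := rhoP _ n1.
  have [/rhoP[_ cth] _] := near th th01.
  move: E; rewrite -fx subr0 => ->; rewrite mulrAC mulr_gt0//.
  exact: lt_le_trans cth.
have [Dp|nDp] := pselect (D p); first exact: tame_interior.
have fp : f p <= 0 by rewrite leNgt; apply/negP => /(Df _ Bp).
have crho : f p < c * rho / 2 by apply: le_lt_trans fp _; rewrite divr_gt0// mulr_gt0.
have /nbhs_rowP[r3 r30 r3P] := Ck_continuous Cf Bp (lt_nbhsl crho).
(* A start within [rho / 2] of p with [f < c * rho / 2] makes the descent shorter than [rho / 2], so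
   that it stays within rho. *)
exists B, f, (Num.min r3 (rho / 2)); split=> //; first by rewrite lt_min r30 divr_gt0.
move=> T1 T2.
pose X := cbox (event T1 (p - const_mx rho)) (event (T2 - T1) (const_mx (2 * rho))).
have XP z : X z <-> T1 <= time z <= T2 /\ `|p - space z| <= rho.
  have := cbox_event T1 (T2 - T1) p z (ltW rho0).
  by rewrite [T1 + _]addrC subrK.
have Xrho z : X z -> B (space z) /\ c <= s * partial i f (space z).
  by move=> /XP[_ pz]; apply: rhoP; apply: le_trans pz _; lra.
have CfS : Ck 1 (cylinder B) (fun z : 'rV[R]_n.+1 => f (space z)) by exact: Ck_space.
have oWB : open (WU `&` cylinder B) by apply: openI => //; exact: open_cylinder.
have Cg : Ck 1 (WU `&` cylinder B)
    (fun z => \sum_j partial j f (space z) * flux j z).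
  apply: (Ck_sum _ oWB) => j _; apply: (CkM oWB).
    have C := Ck_space oB (Ck_partial j C2f).
    by apply: (Ck_sub _ C) => z [].
  by apply: (Ck_sub _ (C_current (lift ord0 j))) => z [].
have [|||||||||C C0 CP] := @linear_flux_bound R n.+1 (fun z => f (space z))
    (fun z => \sum_j partial j f (space z) * flux j z) X
    [set z | `|p - space z| < Num.min r3 (rho / 2) /\ T1 <= time z <= T2]
    (WU `&` cylinder B) s c (lift ord0 i) c0 s1.
- exact: compact_cbox.
- by move=> z /Xrho[Bz _]; exact: (Ck_continuous CfS Bz).
- by move=> z /Xrho[Bz _]; exact: (Ck_derivable CfS Bz).
- by move=> z /Xrho[Bz cz]; rewrite (partialS_space _ oB Cf Bz).
- exact: oWB.
- exact: Cg.
- move=> z [Xz fz]; have [Bz _] := Xrho z Xz; split=> //; apply: cylWU.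
  apply: zero_closure => //; have [_ pz] := (XP z).1 Xz; apply: le_lt_trans pz _; lra.
- move=> z Xz fz; have [Bz _] := Xrho z Xz; apply: fl => //.
  apply: zero_closure; last by rewrite fz.
  have [_ pz] := (XP z).1 Xz; apply: le_lt_trans pz _; lra.
- move=> z [pz tz] fz t /andP[t0 t1]; apply/XP.
  move: pz; rewrite lt_min => /andP[/r3P/= fc pz].
  have ts : time (z + (- s * t) *: e_ (lift ord0 i)) = time z.
    by rewrite /time !mxE (negbTE (neq_lift _ _)) andbF mulr0 addr0.
  have ss : space (z + (- s * t) *: e_ (lift ord0 i)) = space z + (- s * t) *: e_ i.
    by apply/rowP => l; rewrite spaceE !mxE (inj_eq lift_inj).
  split; first by rewrite ts.
  rewrite ss opprD addrA; apply: le_trans (ler_normB _ _) _.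
  have : `|(- s * t) *: (e_ i : 'rV[R]_n)| <= rho / 2.
    rewrite normrZ normrM normrN sn mul1r (ger0_norm t0) -[leRHS]mulr1.
    apply: ler_pM => //; last first.
      apply: normr_row_le => // l; rewrite mxE eqxx/=.
      by case: eqP; rewrite ?normr1 ?normr0 ?ler01.
    apply: le_trans t1 _; rewrite ler_pdivrMr//; apply: le_trans (ltW fc) _.
    by rewrite le_eqVlt; apply/orP; left; apply/eqP; ring.
  move: pz; move: `|_ *: _| `|_| => *; lra.
exists C => // z pz tz Dz.
have Bz : B (space z).
  have [|//] := rhoP (space z); move: pz; rewrite lt_min => /andP[_ pz].
  by apply: le_trans (ltW pz) _; lra.
by apply: CP => //; apply/Df.
Qed.

(** All terms on the left are of first order in [kap], the quadratic one because [kap <= 1], while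
    near p the coefficient [b ord0 ord0] stays above half of its value at p. *)
Lemma slow_cone p : closure D p -> exists kap rho : R, [/\ 0 < kap, 0 < rho &
  forall x, closure D x -> `|p - x| <= rho -> forall s : 'I_n -> R,
    (forall j, `|s j| <= kap) ->
    \sum_j s j * b (lift ord0 j) ord0 x - 2^-1 * sform (fun j k => b j k x) s s
      <= b ord0 ord0 x / 4].
Proof.
move=> cDp; have Up := DU cDp.
pose N x := \sum_j \sum_k `|b j k x|.
have cN : {for p, continuous N}.
  apply: (@cvg_sum_R _ _ _ (nbhs p)) => j _; apply: (@cvg_sum_R _ _ _ (nbhs p)) => k _.
  by apply: cvg_norm; exact: (Ck_continuous (Cb j k) Up).
have N_ge j k x : `|b j k x| <= N x.
  rewrite /N (bigD1 j)//= (bigD1 k)//= -addrA lerDl.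
  by rewrite addr_ge0// sumr_ge0// => i _; rewrite sumr_ge0.
have N0 x : 0 <= N x by apply: le_trans (N_ge ord0 ord0 x).
pose M := N p + 1.
have M0 : 0 < M by rewrite ltr_wpDl.
have NM : N p < M by rewrite ltrDl.
have b0 := b_pos cDp.
have hb : b ord0 ord0 p / 2 < b ord0 ord0 p by lra.
have /nbhs_rowP[r1 r10 r1P] := cN _ (lt_nbhsl NM).
have /nbhs_rowP[r2 r20 r2P] := Ck_continuous (Cb ord0 ord0) Up (lt_nbhsr hb).
(* There are n terms in the linear sum and [n ^ 2] in the quadratic form, each at most [kap * M];
   the 1 ensures positivity when n = 0. *)
pose q := (n%:R + n%:R ^+ 2 + 1 : R).
have q0 : 0 < q by rewrite ltr_wpDl// addr_ge0// sqr_ge0.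
(* The factor 8 is 2, for the loss of [b ord0 ord0] near p, times 4 from the claim. *)
pose kap := Num.min 1 (b ord0 ord0 p / (8 * q * M)).
have kap0 : 0 < kap by rewrite lt_min ltr01 divr_gt0// !mulr_gt0.
exists kap, (Num.min r1 r2 / 2); split=> //; first by rewrite divr_gt0// lt_min r10.
move=> x Dx px s sk.
have /andP[/r1P/= h1 /r2P/= h2] : (`|p - x| < r1) && (`|p - x| < r2).
  rewrite -lt_min; apply: le_lt_trans px _.
  have : 0 < Num.min r1 r2 by rewrite lt_min r10.
  lra.
have bM j k : `|b j k x| <= M by apply: le_trans (N_ge j k x) (ltW h1).
have sumcE (c : R) : n%:R * c = \sum_(j < n) c by rewrite sumr_const card_ord mulr_natl.
have kap1 : kap <= 1 by rewrite ge_min lexx.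
have s1 : \sum_j s j * b (lift ord0 j) ord0 x <= n%:R * (kap * M).
  rewrite sumcE; apply: ler_sum => j _; apply: le_trans (ler_norm _) _; rewrite normrM.
  exact: ler_pM.
have s2 : - sform (fun j k => b j k x) s s <= n%:R ^+ 2 * (kap * M).
  rewrite /sform -sumrN expr2 -mulrA sumcE.
  apply: ler_sum => j _; rewrite -sumrN.
  rewrite sumcE; apply: ler_sum => k _; apply: le_trans (ler_norm _) _; rewrite normrN !normrM.
  rewrite -[leRHS]mulr1 [kap * M]mulrC; apply: ler_pM.
  - by rewrite mulr_ge0.
  - exact: normr_ge0.
  - by apply: ler_pM.
  - exact: le_trans (sk k) kap1.
have kb : kap * M * q * 8 <= b ord0 ord0 p.
  rewrite -mulrA [kap * M * _]mulrAC -mulrA.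
  have : kap <= b ord0 ord0 p / (8 * q * M) by rewrite ge_min lexx orbT.
  rewrite ler_pdivlMr; last by rewrite !mulr_gt0.
  by move=> h; apply: le_trans _ h; rewrite le_eqVlt; apply/orP; left; apply/eqP; ring.
have km0 : 0 <= kap * M by rewrite mulr_ge0// ltW.
have n0 : 0 <= n%:R ^+ 2 :> R by rewrite sqr_ge0.
rewrite /q in kb; move: s1 s2 kb h2 (mulr_ge0 n0 km0).
move: (kap * M) km0 (n%:R : R) (\sum_j _) (sform _ _ _) => *; nra.
Qed.

Definition quiet (t0 : R) := forall z, cylinder D z -> time z < t0 -> u z = 0.

Lemma quiet_partial t0 z j : quiet t0 -> cylinder D z -> time z < t0 ->
  partial j u z = 0.
Proof.
move=> qt Dz tz.
have o : open [set z | cylinder D z /\ 0 < t0 - time z].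
  apply: open_pos; first exact: open_cylinder.
  move=> y _; apply: cvgB; first exact: cvg_cst.
  exact: coord_continuous.
rewrite (partial_eq j o (g := fun=> 0)); first by rewrite partial_cst.
  by move=> y [Dy]; rewrite subr_gt0; exact: qt.
by split=> //=; rewrite subr_gt0.
Qed.

Lemma quiet_current t0 z j : quiet t0 -> cylinder D z -> time z < t0 ->
  current a u j z = 0.
Proof.
move=> qt Dz tz; rewrite /current (quiet_partial _ qt)// mul0r sub0r.
case: ifP => _; rewrite ?oppr0// /lagrangian big1 ?mulr0 ?oppr0// => i _.
by rewrite big1// => k _; rewrite (quiet_partial k qt)// mulr0.
Qed.

(** The weight lives below the paraboloid [sig = 0], and the spatial slopes of [sig] over the box do
    not exceed the [kap] of [slow_cone]. A point with a nonzero time derivative would have positive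
    energy decay [q], which [localization] excludes. The radius is found before [t0], which is what
    allows iteration. *)
Lemma local_step p : closure D p -> tame_boundary p -> exists2 r : R, 0 < r &
  forall t0, quiet t0 -> forall z, cylinder D z -> `|p - space z| < r ->
    time z < t0 + r -> partial ord0 u z = 0.
Proof.
move=> cDp [B [f [r1 [[oB Bp Cf Df] r10 fluxB]]]].
have [kap [rho1 [kap0 rho10 cone]]] := slow_cone cDp.
have /nbhs_rowP[r2 r20 r2P] := open_nbhs_nbhs (conj oB Bp).
have [rho [rho0 rhor1 rhor2 rhorho1]] : exists rho : R, [/\ 0 < rho, rho < r1, rho < r2 & rho <= rho1].
  exists (Num.min r1 (Num.min r2 rho1) / 2).
  have m0 : 0 < Num.min r1 (Num.min r2 rho1) by rewrite !lt_min r10 r20.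
  have : Num.min r1 (Num.min r2 rho1) <= r1 by rewrite ge_min lexx.
  have : Num.min r1 (Num.min r2 rho1) <= r2 by rewrite !ge_min lexx orbT.
  have : Num.min r1 (Num.min r2 rho1) <= rho1 by rewrite !ge_min lexx !orbT.
  by move=> *; split; lra.
(* [K] makes the largest slope [2 * K * rho] equal to [kap]; [tau] is the height of the apex above
   [t0], so the paraboloid is not above [t0] on the lateral faces. *)
pose K := kap / (2 * rho).
have K0 : 0 < K by rewrite divr_gt0// mulr_gt0.
pose tau := K * rho ^+ 2.
have tau0 : 0 < tau by rewrite mulr_gt0// exprn_gt0.
have Nn0 : 0 < n%:R + 1 :> R by rewrite ltr_wpDl.
(* Within this radius neither the time elapsed since [t0] nor [K * sq] exceeds [tau / 4], so [sig]
   is positive at [z0]. *)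
exists (Num.min (tau / 4) (rho / (2 * (n%:R + 1)))).
  by rewrite lt_min !divr_gt0// mulr_gt0.
move=> t0 qt z0 Dz0; rewrite lt_min => /andP[_ pz0] tz0.
have {}tz0 : time z0 < t0 + tau / 4.
  by apply: lt_le_trans tz0 _; rewrite lerD2l ge_min lexx.
have [tz|tz] := ltP (time z0) t0; first exact: quiet_partial qt Dz0 tz.
have [//|un0] := eqVneq (partial ord0 u z0) 0; exfalso.
have pz0' : `|p - space z0| < rho.
  apply: lt_le_trans pz0 _; rewrite ler_pdivrMr ?mulr_gt0// ler_peMr ?(ltW rho0)//.
  have : 0 <= n%:R :> R by []. lra.
pose g (i : 'I_n) x := (x ord0 i - p ord0 i) * (x ord0 i - p ord0 i).
pose sq x := \sum_(i < n) g i x : R.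
pose sig z := t0 + tau + ((-1) * time z + (- K) * sq (space z)).
(* [C] depends on [t0], which does no harm: [localization] is contradictory for every C. *)
have [C C0 CP] := fluxB (t0 - 1) (t0 - 1 + (tau + 2)).
pose aa := event (t0 - 1) (p - const_mx rho).
pose ww := event (tau + 2) (const_mx (2 * rho)) : 'rV[R]_n.+1.
have boxP z : cbox aa ww z <-> t0 - 1 <= time z <= t0 - 1 + (tau + 2) /\ `|p - space z| <= rho.
  by apply: cbox_event; exact: ltW.
have w0 i : 0 < ww ord0 i.
  rewrite mxE; case: (unliftP ord0 i) => [j _|_]; first by rewrite mxE mulr_gt0.
  by rewrite addr_gt0.
have oDB : open (cylinder D `&` cylinder B) by apply: openI; exact: open_cylinder.
have DWU : cylinder D `<=` WU by move=> z Dz; apply: cylWU; exact: DcD.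
have sq0 x : 0 <= sq x by rewrite sumr_ge0// => i _; rewrite /g -expr2 sqr_ge0.
have Ccoord (i : 'I_n) : Ck 1 setT (fun x : 'rV[R]_n => x ord0 i - p ord0 i).
  by apply: (CkB openT); [exact: (Ck_coord _ _ openT)|exact: Ck_cst].
have Cg i : Ck 1 setT (g i) by exact: (CkM openT).
have Csq : Ck 1 setT sq by apply: (Ck_sum _ openT) => i _; exact: Cg.
have Ctime : Ck 1 setT (fun z : 'rV[R]_n.+1 => (-1) * time z).
  exact: (CkZ _ openT (Ck_coord 1 ord0 openT)).
have Csp : Ck 1 setT (fun z : 'rV[R]_n.+1 => (- K) * sq (space z)).
  exact: (CkZ _ openT (Ck_space openT Csq)).
have Csig : Ck 1 setT sig.
  by apply: (CkD openT); [exact: Ck_cst|exact: (CkD openT)].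
have Psq i x : partial i sq x = 2 * (x ord0 i - p ord0 i).
  rewrite (partial_sum (F := g) _ _ openT Cg I) (bigD1 i)//= big1 => [|j ji].
    rewrite addr0 partialM; try exact: (Ck_derivable (Ccoord i) I).
    rewrite partialD; [|by have [] := is_derive_coord i x (e_ i)|exact: derivable_cst].
    by rewrite partial_coord partial_cst eqxx addr0 mul1r mulr1 -mulr2n mulr_natl.
  rewrite partialM; try exact: (Ck_derivable (Ccoord j) I).
  rewrite partialD; [|by have [] := is_derive_coord j x (e_ i)|exact: derivable_cst].
  by rewrite partial_coord partial_cst eq_sym (negbTE ji) addr0 mul0r mulr0 addr0.
have Psig j z : partial j sig z = - (j == ord0)%:R +
    (- K) * partial j (fun z => sq (space z)) z.
  rewrite partialD; [|exact: derivable_cst|exact: (Ck_derivable (CkD openT Ctime Csp) I)].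
  rewrite partial_cst add0r partialD;
    [|exact: (Ck_derivable Ctime I)|exact: (Ck_derivable Csp I)].
  rewrite !partialZ; [|exact: (Ck_derivable (Ck_space openT Csq) I)|].
    by congr (_ + _); rewrite mulN1r /time partial_coord.
  by have [] := is_derive_coord ord0 z (e_ j).
have Psig0 z : partial ord0 sig z = -1.
  by rewrite Psig eqxx (partial0_space openT Csq I) mulr0 addr0.
have PsigS z i : partial (lift ord0 i) sig z = - K * (2 * (space z ord0 i - p ord0 i)).
  rewrite Psig (partialS_space _ openT Csq I) Psq.
  by rewrite eq_sym (negbTE (neq_lift _ _)) oppr0 add0r.
pose q z := a ord0 ord0 z / 4 * partial ord0 u z ^+ 2.
have := @localization R n.+1 aa ww (cylinder D) (cylinder B) (fun z => f (space z)) sig q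
  (current a u) C z0 w0 (open_cylinder oB).
apply.
- move=> z /boxP[_ pz]; apply: r2P; exact: le_lt_trans pz rhor2.
- exact: Ck_space.
- by move=> z; exact: Df.
- by move=> j; apply: Ck_sub (C_current j) => z [/DWU].
- move=> z [Dz Bz].
  apply: (@current_div _ _ _ _ (cylinder D `&` cylinder B)) => //.
  + by move=> j k; apply: Ck_sub (Ca j k) => y [/DWU].
  + by apply: Ck_sub Cu' => y [/DWU].
  + by move=> j k y [Dy _]; apply: b_sym; exact: DcD.
  + move=> j k y [Dy _]; apply: (partial0_space oU (Cb j k)); exact/DU/DcD.
  + exact: eqn.
- exact: Csig.
- move=> z bz Dz j zj.
  (* Before [t0], and so on the bottom face, the current vanishes; from [t0] on, [sig] is not
     positive on the lateral faces and on the top. *)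
  have [tz1|tz1] := ltP (time z) t0; first by left; exact: quiet_current qt Dz tz1.
  right; have [tb pz] := (boxP z).1 bz; rewrite /sig.
  move: zj; rewrite !mxE; case: (unliftP ord0 j) => [i ->|->].
    rewrite -spaceE !mxE -spaceE => zi.
    have : rho ^+ 2 <= sq (space z).
      rewrite /sq (bigD1 i)//=.
      have -> : g i (space z) = rho ^+ 2.
        by rewrite /g; case: zi => ->; ring.
      by rewrite lerDl sumr_ge0// => k _; rewrite /g -expr2 sqr_ge0.
    by rewrite -(ler_pM2l K0) -/tau => *; lra.
  rewrite -/(time z) => zj; have := mulr_ge0 (ltW K0) (sq0 (space z)).
  by case: zj => h; lra.
- exact: C0.
- move=> z /boxP[tb pz] Dz sz; rewrite big_ord_recl.
  have Bz : B (space z) by apply: r2P; exact: le_lt_trans pz rhor2.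
  rewrite (partial0_space oB Cf Bz) mul0r add0r.
  rewrite (eq_bigr (fun j => partial j f (space z) * flux j z)); last first.
    by move=> j _; rewrite (partialS_space _ oB Cf Bz).
  by apply: CP => //; exact: le_lt_trans pz rhor1.
- move=> z /boxP[tb pz] Dz sz; rewrite big_ord_recl Psig0.
  have cDz : closure D (space z) by exact: DcD.
  rewrite mulN1r /current eqxx.
  have := @current_speed R n (fun j k => a j k z) (fun k => partial k u z)
    (fun j k => b_sym j k cDz) (b_neg cDz) (fun i => - K * (2 * (space z ord0 i - p ord0 i))).
  move=> H; apply: le_trans (H _) => //; last first.
    apply: cone => //; first exact: le_trans pz rhorho1.
    move=> j; rewrite normrM normrN (gtr0_norm K0) normrM (@ger0_norm _ 2)//.
    have hj : `|space z ord0 j - p ord0 j| <= rho.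
      rewrite distrC; have := le_trans (coord_le (p - space z) j) pz.
      by have -> : (p - space z) ord0 j = p ord0 j - space z ord0 j by rewrite !mxE.
    apply: (@le_trans _ _ (K * (2 * rho))); first by rewrite ler_pM2l// ler_pM2l.
    by rewrite /K divfK// mulf_neq0// gt_eqF.
  rewrite le_eqVlt; apply/orP; left; apply/eqP; congr (_ + _).
  apply: eq_bigr => j _; rewrite PsigS; congr (_ * _).
  by rewrite (_ : lift ord0 j == ord0 = false) ?subr0// eq_sym (negbTE (neq_lift _ _)).
- move=> z _ Dz _; rewrite /q mulr_ge0 ?sqr_ge0// divr_ge0// ltW// b_pos//.
  exact: DcD.
- apply/boxP; split; last exact: ltW.
  apply/andP; split; lra.
- exact: Dz0.
- have : sq (space z0) <= rho ^+ 2 / 4.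
    apply: (@le_trans _ _ (\sum_(i < n) (rho / (2 * (n%:R + 1))) ^+ 2)).
      apply: ler_sum => i _; rewrite /g -expr2 -real_normK ?num_real//.
      rewrite lerXn2r ?nnegrE//; first by rewrite divr_ge0 ?(ltW rho0)// mulr_ge0// ltW.
      rewrite distrC; have := le_trans (coord_le (p - space z0) i) (ltW pz0).
      by have -> : (p - space z0) ord0 i = p ord0 i - space z0 ord0 i by rewrite !mxE.
    rewrite sumr_const card_ord -[leLHS]mulr_natl expr_div_n mulrCA.
    rewrite ler_pM2l ?exprn_gt0// ler_pdivrMr; last by rewrite exprn_gt0// mulr_gt0.
    have : 0 <= n%:R :> R by [].
    by move: (n%:R : R) => m m0; rewrite exprMn; nra.
  move=> h; have : K * sq (space z0) <= tau / 4 by rewrite /tau -mulrA ler_pM2l.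
  rewrite /sig; lra.
- have Wz0 := DWU z0 Dz0.
  apply: cvgM; last first.
    rewrite expr2; apply: cvgM; exact: (Ck_continuous (CkW (Ck_partial ord0 Cu')) Wz0).
  by apply: cvgMr_tmp; exact: (Ck_continuous (Ca ord0 ord0) Wz0).
- rewrite /q mulr_gt0//; first by rewrite divr_gt0// b_pos//; exact: DcD.
  by rewrite lt_def sqr_ge0 andbT expf_neq0.
Qed.

(** The vanishing of the time derivative is integrated from [t0 - 1], where u is 0. The step is
    uniform because [local_step] covers a neighbourhood of each point of the compact closure. *)
Lemma quiet_step : (forall p, closure D p -> tame_boundary p) ->
  exists2 del : R, 0 < del & forall t0, quiet t0 -> quiet (t0 + del).
Proof.
move=> tame.
have [|r r0 rP] := @compact_uniform R n (closure D) (fun del x =>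
    forall t0, quiet t0 -> forall t, t < t0 + del -> D x -> u (event t x) = 0) cD.
  move=> p cDp; have [r r0 rP] := local_step cDp (tame p cDp).
  exists r => // y del py /andP[del0 delr] t0 qt t tt Dy.
  have DE t' : cylinder D (event t' y) by rewrite /cylinder/= space_event.
  have [tt0|tt0] := ltP t t0; first by apply: qt; rewrite ?time_event.
  have E s : event t y = event s y + (t - s) *: e_ ord0.
    apply/rowP => i; rewrite !mxE; case: (unliftP ord0 i) => [j ->|->].
      by rewrite (eq_sym (lift _ _)) (negbTE (neq_lift _ _)) andbF mulr0 addr0.
    by rewrite !eqxx mulr1 addrC subrK.
  have E' th : event (t0 - 1) y + (th * (t - (t0 - 1))) *: e_ ord0 =
      event (t0 - 1 + th * (t - (t0 - 1))) y.
    apply/rowP => i; rewrite !mxE; case: (unliftP ord0 i) => [j ->|->].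
      by rewrite (eq_sym (lift _ _)) (negbTE (neq_lift _ _)) andbF mulr0 addr0.
    by rewrite !eqxx mulr1.
  have [|th /andP[th0 th1]] := @MVT_line R n.+1 u (event (t0 - 1) y) (e_ ord0) (t - (t0 - 1)).
    move=> th _; rewrite E'; apply: (Ck_derivable Cu).
    by apply: DW; apply: DcD; exact: DE.
  rewrite -E E' (qt (event (t0 - 1) y)) ?time_event//; last by rewrite ltrBlDl ltrDr.
  rewrite subr0 => ->; rewrite -/(partial ord0 u _) (rP t0)// ?mulr0 ?space_event//.
  rewrite time_event; apply: le_lt_trans (lt_le_trans tt _); last by rewrite lerD2l ltW.
  have : th * (t - (t0 - 1)) <= t - (t0 - 1) by rewrite ler_piMl// subr_ge0; lra.
  lra.
exists (r / 2); first by rewrite divr_gt0.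
move=> t0 qt z Dz tz; rewrite -(event_eta z).
have rr : 0 < r / 2 < r by apply/andP; split; lra.
exact: (rP (r / 2) (space z) rr (DcD Dz) t0 qt).
Qed.

Theorem energy_uniqueness : (forall p, closure D p -> tame_boundary p) ->
  (exists T, quiet T) -> forall z, cylinder D z -> u z = 0.
Proof.
move=> /quiet_step[del del0 step] [T qT] z Dz.
have qk k : quiet (T + k%:R * del).
  elim: k => [|k IH]; first by rewrite mul0r addr0.
  by rewrite -natr1 mulrDl mul1r addrA; exact: step.
apply: (qk (Num.bound `|(time z - T) / del|)) => //.
rewrite -ltrBlDl -ltr_pdivrMr//.
by apply: le_lt_trans (ler_norm _) _; exact: archi_boundP.
Qed.

End Uniqueness.

(** * Lorentzian linear algebra *)

Section Lorentz.
Context {R : realType} {n : nat}.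
Implicit Types (A P : 'M[R]_n.+1) (v w : 'rV[R]_n.+1).

Definition bform A v w : R := (v *m A *m w^T) ord0 ord0.

Lemma bformE A v w : bform A v w = \sum_j \sum_k A j k * v ord0 j * w ord0 k.
Proof.
rewrite /bform mxE exchange_big/=; apply: eq_bigr => k _.
rewrite !mxE mulr_suml; apply: eq_bigr => j _.
by rewrite [v _ _ * _]mulrC.
Qed.

Definition minkowski : 'M[R]_n.+1 := diag_mx (\row_j (if j == ord0 then 1 else -1)).

Lemma minkowskiE v w : bform minkowski v w =
  v ord0 ord0 * w ord0 ord0 - \sum_(i < n) v ord0 (lift ord0 i) * w ord0 (lift ord0 i).
Proof.
rewrite /bform mul_mx_diag mxE big_ord_recl !mxE eqxx mulr1; congr (_ + _).
rewrite -sumrN; apply: eq_bigr => i _; rewrite !mxE eq_sym (negbTE (neq_lift _ _)).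
by rewrite mulrN1 mulNr.
Qed.

Lemma minkowski_det : \det minkowski = (-1) ^+ n.
Proof.
rewrite det_diag big_ord_recl mxE eqxx mul1r (eq_bigr (fun=> -1)).
  by rewrite prodr_const card_ord.
by move=> i _; rewrite mxE eq_sym (negbTE (neq_lift _ _)).
Qed.

Lemma bform_congr A P v w : bform (P *m A *m P^T) v w = bform A (v *m P) (w *m P).
Proof. by rewrite /bform trmx_mul !mulmxA. Qed.

(** Expand the sum of the squares of [w0 * v_i - v0 * w_i]: orthogonality turns the mixed sum [wv]
    into [w0 * v0], and the rest is controlled by the positive value of the form at w. *)
Lemma minkowski_orth v w : 0 < bform minkowski w w -> bform minkowski w v = 0 ->
  bform minkowski v v <= 0.
Proof.
rewrite !minkowskiE.
set w0 := w ord0 ord0; set v0 := v ord0 ord0.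
set ww := \sum_i _; set wv := \sum_i _; set vv := \sum_i _ => hw hv.
have : 0 <= \sum_(i < n) (w0 * v ord0 (lift ord0 i) - v0 * w ord0 (lift ord0 i)) ^+ 2.
  by rewrite sumr_ge0// => i _; rewrite sqr_ge0.
have -> : \sum_(i < n) (w0 * v ord0 (lift ord0 i) - v0 * w ord0 (lift ord0 i)) ^+ 2 =
    w0 ^+ 2 * vv - 2 * w0 * v0 * wv + v0 ^+ 2 * ww.
  rewrite /vv /wv /ww !mulr_sumr -sumrN -!big_split/=; apply: eq_bigr => i _; ring.
have ww0 : 0 <= ww by rewrite sumr_ge0// => i _; rewrite -expr2 sqr_ge0.
have -> : wv = w0 * v0 by apply/esym/eqP; rewrite -subr_eq0 hv.
have w0n : 0 < w0 ^+ 2 by rewrite expr2; apply: le_lt_trans ww0 _; rewrite -subr_gt0.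
move=> h; rewrite -(pmulr_rle0 _ w0n).
have : 0 <= v0 ^+ 2 * (w0 * w0 - ww) by rewrite mulr_ge0 ?sqr_ge0// ltW.
nra.
Qed.

Lemma lorentz_orth A v w : lorentz_signature A -> 0 < bform A w w ->
  bform A w v = 0 -> bform A v v <= 0.
Proof.
move=> [P uP PA].
have E x y : bform A x y = bform minkowski (x *m invmx P) (y *m invmx P).
  by rewrite /minkowski -PA bform_congr !mulmxKV.
by rewrite !E; exact: minkowski_orth.
Qed.

Lemma lorentz_det A : lorentz_signature A -> 0 < (-1) ^+ n * \det A.
Proof.
move=> [P uP PA].
have : \det (P *m A *m P^T) = (-1) ^+ n by rewrite PA; exact: minkowski_det.
rewrite !det_mulmx det_tr => h.
have dP : \det P != 0 by rewrite -unitfE -unitmxE.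
have d2 : 0 < \det P ^+ 2 by rewrite lt_def sqr_ge0 andbT expf_neq0.
rewrite -(pmulr_rgt0 _ d2).
have -> : \det P ^+ 2 * ((-1) ^+ n * \det A) = (-1) ^+ n * (\det P * \det A * \det P) by ring.
by rewrite h -exprD addnn -mul2n exprM sqrrN !expr1n.
Qed.

(* If [(-1)^n Delta > 0], the row [w] of the adjugate is a timelike covector
   orthogonal to all the spatial ones, by Cramer's rule. *)
Lemma lorentz_spatial_neg A (v : 'rV[R]_n) : lorentz_signature A ->
  0 < (-1) ^+ n * \det (row' ord0 (col' ord0 A)) ->
  \sum_j \sum_k A (lift ord0 j) (lift ord0 k) * v ord0 j * v ord0 k <= 0.
Proof.
move=> LA hD; have dA := lorentz_det LA.
pose w := row ord0 (\adj A); pose v' := no_time v.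
have wA x : bform A w x = \det A * x ord0 ord0.
  rewrite /bform /w -row_mul mul_adj_mx mxE big_ord_recl !mxE eqxx mulr1n.
  rewrite big1 ?addr0// => i _; rewrite !mxE (negbTE (neq_lift _ _)) mulr0n.
  by rewrite mul0r.
have v'0 : v' ord0 ord0 = 0 by rewrite mxE unlift_none.
have v'S j : v' ord0 (lift ord0 j) = v ord0 j by rewrite mxE liftK.
have ww : 0 < bform A w w.
  rewrite wA !mxE /cofactor expr0 mul1r.
  have s2 : (-1) ^+ n * (-1) ^+ n = 1 :> R by rewrite -exprD addnn -mul2n exprM sqrrN !expr1n.
  have := mulr_gt0 dA hD.
  by rewrite mulrACA s2 mul1r.
have := lorentz_orth LA ww (v := v'); rewrite wA v'0 mulr0 => /(_ erefl).
rewrite bformE big_ord_recl big1 => [|k _]; last by rewrite v'0 mulr0 mul0r.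
rewrite add0r; congr (_ <= 0); apply: eq_bigr => j _.
rewrite big_ord_recl v'0 mulr0 add0r; apply: eq_bigr => k _.
by rewrite !v'S.
Qed.

End Lorentz.

(** * Sides of a closed surface *)

Section Signs.
Context {R : realType} {d : nat}.
Implicit Types (x y z v : 'rV[R]_d) (f g : 'rV[R]_d -> R) (U : set 'rV[R]_d).
Local Notation e_ i := (delta_mx ord0 i).

Lemma sign_segment f x v :
  (forall t : R, 0 <= t <= 1 -> {for x + t *: v, continuous f}) ->
  (forall t : R, 0 <= t <= 1 -> f (x + t *: v) != 0) ->
  (0 < f x) = (0 < f (x + v)).
Proof.
move=> cf fn0; pose X := [set y | exists2 t : R, 0 <= t <= 1 & y = x + t *: v].
have cphi : {within `[0, 1], continuous (fun t : R => f (x + (1 * t) *: v))}.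
  apply: (@line_continuous R d f X x v 1 1).
    by move=> y [t t01 ->]; exact: cf.
  by move=> t t01; exists t; rewrite ?mul1r.
have f0 : f x != 0 by have := fn0 0; rewrite scale0r addr0; apply; rewrite lexx ler01.
have f1 : f (x + v) != 0 by have := fn0 1; rewrite scale1r; apply; rewrite lexx ler01.
have noz : ~ (Num.min (f x) (f (x + v)) <= 0 <= Num.max (f x) (f (x + v))).
  move=> h; have [|t] := @IVT R _ 0 1 0 ler01 cphi.
    by rewrite mul1r scale0r addr0 mul1r scale1r.
  rewrite in_itv/= mul1r => /fn0/eqP; exact.
case: (ltgtP 0 (f x)) f0 => // h0 _; case: (ltgtP 0 (f (x + v))) f1 => // h1 _.
  by case: noz; rewrite ge_min le_max (ltW h1) (ltW h0) orbT.
by case: noz; rewrite ge_min le_max (ltW h1) (ltW h0) orbT.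
Qed.

Lemma norm_delta_le i : `|e_ i : 'rV[R]_d| <= 1.
Proof.
apply: normr_row_le => // l; rewrite mxE eqxx/=.
by case: eqP; rewrite ?normr1 ?normr0 ?ler01.
Qed.

(** A substitute for the implicit function theorem: growth at rate at least c along one signed axis
    is all that the separation argument takes from a nonzero gradient. *)
Lemma axis_growth U f x i : open U -> Ck 1 U f -> U x -> partial i f x != 0 ->
  exists s c rho : R, [/\ `|s| = 1, 0 < c, 0 < rho,
    forall y, `|x - y| < rho -> U y &
    forall y t, 0 <= t -> `|x - y| + t < rho -> f y + c * t <= f (y + (s * t) *: e_ i)].
Proof.
move=> oU Cf Ux fi.
have [s sn sf] : exists2 s : R, `|s| = 1 & 0 < s * partial i f x.
  case: (ltgtP (partial i f x) 0) fi => // h _.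
    by exists (- 1); rewrite ?normrN ?normr1// mulN1r oppr_gt0.
  by exists 1; rewrite ?normr1// mul1r.
have ss : s * s = 1 by rewrite -expr2 -real_normK ?num_real// sn expr1n.
pose c := s * partial i f x / 2.
have c0 : 0 < c by rewrite divr_gt0.
have Csf : {for x, continuous (fun x => s * partial i f x)}.
  by apply: cvgMl_tmp; exact: (Ck_continuous (Ck_partial i Cf) Ux).
have hc : c < s * partial i f x by rewrite /c; lra.
have /nbhs_rowP[r1 r10 r1P] := Csf _ (lt_nbhsr hc).
have /nbhs_rowP[r2 r20 r2P] := open_nbhs_nbhs (conj oU Ux).
exists s, c, (Num.min r1 r2); split=> //; first by rewrite lt_min r10.
  by move=> y; rewrite lt_min => /andP[_ /r2P].
move=> y t t0; rewrite lt_min => /andP[h1 h2].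
have near th : 0 <= th <= 1 -> `|x - (y + (th * (s * t)) *: e_ i)| <= `|x - y| + t.
  move=> /andP[th0 th1]; rewrite opprD addrA.
  apply: le_trans (ler_normB _ _) _; rewrite lerD2l.
  rewrite normrZ normrM normrM sn mul1r (ger0_norm th0) (ger0_norm t0).
  rewrite -[leRHS]mulr1; apply: ler_pM; rewrite ?norm_delta_le//.
    by rewrite mulr_ge0.
  by rewrite ler_piMl.
have [|th th01 E] := @MVT_line R d f y (e_ i) (s * t).
  move=> th /near h; apply: (Ck_derivable Cf); apply: r2P.
  exact: le_lt_trans h h2.
have /r1P/ltW h : `|x - (y + (th * (s * t)) *: e_ i)| < r1.
  exact: le_lt_trans (near th th01) h1.
have := ler_wpM2r t0 h.
rewrite (_ : s * _ * t = f (y + (s * t) *: e_ i) - f y); first by lra.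
by rewrite E [LHS]mulrAC.
Qed.

Lemma positive_nearby U f x i (del : R) : open U -> Ck 1 U f -> U x ->
  partial i f x != 0 -> f x = 0 -> 0 < del -> exists2 y, `|x - y| < del & 0 < f y.
Proof.
move=> oU Cf Ux fi fx del0.
have [s [c [rho [sn c0 rho0 _ gr]]]] := axis_growth oU Cf Ux fi.
pose t := Num.min del rho / 2.
have m0 : 0 < Num.min del rho by rewrite lt_min del0.
have t0 : 0 < t by rewrite divr_gt0.
have tm : t < Num.min del rho by rewrite /t; lra.
move: tm; rewrite lt_min => /andP[td tr].
exists (x + (s * t) *: e_ i).
  rewrite opprD addNKr normrN normrZ normrM sn mul1r (gtr0_norm t0).
  by apply: le_lt_trans td; rewrite ler_piMr ?(ltW t0)// norm_delta_le.
have := gr x t (ltW t0); rewrite subrr normr0 add0r fx add0r => /(_ tr).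
by apply: lt_le_trans; rewrite mulr_gt0.
Qed.

(* Near a zero of [f] with nonzero gradient the side [f > 0] is connected, so a
   function without zeros on it has a constant sign there. *)
Lemma side_sign U f g x i : open U -> Ck 1 U f -> U x -> partial i f x != 0 ->
  f x = 0 -> (forall y, U y -> {for y, continuous g}) ->
  (forall y, U y -> f y != 0 -> g y != 0) ->
  exists2 del : R, 0 < del &
    exists c : bool, forall y, `|x - y| < del -> 0 < f y -> (0 < g y) = c.
Proof.
move=> oU Cf Ux fi fx cg fg.
have [s [c [rho [sn c0 rho0 rhoU gr]]]] := axis_growth oU Cf Ux fi.
have [tau tauE] : exists tau, tau = rho / 4 by eexists.
have tau0 : 0 < tau by rewrite tauE divr_gt0.
pose top y := y + (s * tau) *: e_ i.
have nt t : 0 <= t <= 1 -> `|(s * tau * t) *: (e_ i : 'rV[R]_d)| <= tau.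
  move=> /andP[t0 t1]; rewrite normrZ !normrM sn mul1r (gtr0_norm tau0) (ger0_norm t0).
  rewrite -[leRHS]mulr1; apply: ler_pM; rewrite ?norm_delta_le//.
    by rewrite mulr_ge0// ltW.
  by rewrite ler_piMr// ltW.
have one01 : 0 <= (1 : R) <= 1 by rewrite ler01 lexx.
have xtop : `|x - top x| <= tau.
  by rewrite /top opprD addNKr normrN -[s * tau]mulr1; exact: nt.
have ftop : 0 < f (top x).
  have := gr x tau (ltW tau0); rewrite subrr normr0 add0r fx add0r => h.
  by apply: lt_le_trans (h _); [rewrite mulr_gt0|rewrite tauE; lra].
have Utop : U (top x) by apply: rhoU; apply: le_lt_trans xtop _; rewrite tauE; lra.
have /nbhs_rowP[r r0 rP] := Ck_continuous Cf Utop (lt_nbhsr ftop).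
exists (Num.min r tau); first by rewrite lt_min r0.
exists (0 < g (top x)) => y; rewrite lt_min => /andP[yr yt] fy.
(* The climb from y to [top y] increases f, so it stays on the positive side. *)
have up : (0 < g y) = (0 < g (top y)).
  have near t : 0 <= t <= 1 -> U (y + t *: ((s * tau) *: e_ i)) /\
      f (y + t *: ((s * tau) *: e_ i)) != 0.
    move=> /andP[t0 t1]; rewrite scalerA [t * _]mulrC; split.
      apply: rhoU; rewrite opprD addrA; apply: le_lt_trans (ler_normB _ _) _.
      have := nt t; rewrite t0 t1 => /(_ isT); move: yt; rewrite !tauE; lra.
    rewrite gt_eqF// -mulrA; apply: lt_le_trans (gr y (tau * t) _ _).
    - by apply: lt_le_trans fy _; rewrite lerDl !mulr_ge0// ltW.
    - by rewrite mulr_ge0// ltW.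
    have : tau * t <= tau by rewrite ler_piMr// ltW.
    move: yt; rewrite !tauE; lra.
  by apply: sign_segment => t /near[Uy fn]; [exact: cg|exact: fg].
rewrite up.
(* The second segment joins [top y] to [top x] inside the ball around [top x] where [f > 0]. *)
have -> : top x = top y + (x - y) by rewrite /top addrAC [y + _]addrC subrK.
have near t : 0 <= t <= 1 -> U (top y + t *: (x - y)) /\ f (top y + t *: (x - y)) != 0.
  move=> /andP[t0 t1].
  have E : top x - (top y + t *: (x - y)) = (1 - t) *: (x - y).
    by rewrite /top scalerBl scale1r opprD addrA opprD addrACA subrr addr0.
  have h : `|top x - (top y + t *: (x - y))| <= `|x - y|.
    by rewrite E normrZ ger0_norm ?subr_ge0// ler_piMl// gerBl.
  split; last by rewrite gt_eqF//; apply: rP; exact: le_lt_trans h yr.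
  apply: rhoU; rewrite -(subrKA (top x)).
  apply: le_lt_trans (ler_normD _ _) _.
  move: xtop yt; rewrite !tauE; lra.
by apply: sign_segment => t /near[Uy fn]; [exact: cg|exact: fg].
Qed.

End Signs.

(** * Two-sidedness of a compact hypersurface *)

Section Separation.
Context {R : realType} {d : nat}.
Implicit Types (x y z v : 'rV[R]_d) (f g : 'rV[R]_d -> R) (U Y : set 'rV[R]_d).
Implicit Types (s : 'rV[R]_d -> bool).
Local Notation e_ i := (delta_mx ord0 i).
Variable S : set 'rV[R]_d.
Hypothesis cS : compact S.
Hypothesis chartS : forall p, S p -> exists U f,
  [/\ U p, open U, smooth U f, (forall x, U x -> grad f x <> 0)
    & forall x, U x -> (S x <-> f x = 0)].

(* [s] tells apart, near [x], the two sides of [S]; its values on [S] are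
   irrelevant. *)
Definition sided s x : Prop := exists U f,
  [/\ U x, open U, Ck 1 U f,
      forall y, U y -> (S y <-> f y = 0) /\ (S y -> exists i, partial i f y != 0)
    & forall y, U y -> ~ S y -> s y = (0 < f y)].

Lemma grad_neq0 f x : grad f x <> 0 -> exists i, partial i f x != 0.
Proof.
move=> gf; apply/not_existsP => h; apply: gf; apply/rowP => i; rewrite !mxE.
by apply/eqP; rewrite -[_ == _]negbK; apply/negP; exact: h.
Qed.

Lemma sided_ext s s' x : sided s x ->
  (exists2 r : R, 0 < r & forall y, `|x - y| < r -> ~ S y -> s' y = s y) -> sided s' x.
Proof.
move=> [U [f [Ux oU Cf SU sU]]] [r r0 rs].
have oB : open (U `&` [set y | `|x - y| < r]).
  apply: openI => //.
  rewrite (_ : [set y | _] = ball x r); first exact: ball_open.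
  by rewrite -ball_normE.
exists (U `&` [set y | `|x - y| < r]), f; split=> //.
- by split=> //=; rewrite subrr normr0.
- by apply: Ck_sub Cf => y [].
- by move=> y [/SU].
- by move=> y [Uy /= yr] Sy; rewrite rs// sU.
Qed.

Lemma sided_neg s x : sided s x -> sided (fun y => ~~ s y) x.
Proof.
move=> [U [f [Ux oU Cf SU sU]]].
exists U, (fun y => - f y); split; [exact: Ux|exact: oU|exact: CkN| |].
- move=> y Uy; have [SE Sd] := SU y Uy; split.
    by rewrite SE; split=> [->|/eqP]; rewrite ?oppr0// oppr_eq0 => /eqP.
  move=> /Sd[i fi]; exists i.
  have -> : partial i (fun y => - f y) y = - partial i f y.
    rewrite (partial_eq i oU (g := fun y => -1 * f y) _ Uy); last first.
      by move=> z _; rewrite mulN1r.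
    by rewrite partialZ ?mulN1r//; exact: (Ck_derivable Cf Uy).
  by rewrite oppr_eq0.
move=> y Uy nSy; rewrite sU// oppr_gt0 -leNgt le_eqVlt.
have [SE _] := SU y Uy.
have -> : (f y == 0) = false by apply/eqP => /SE.
by [].
Qed.

Lemma sided_off s x : sided s x -> ~ S x ->
  exists2 r : R, 0 < r & forall y, `|x - y| < r -> ~ S y /\ s y = s x.
Proof.
move=> [U [f [Ux oU Cf SU sU]]] nSx.
have fx0 : f x != 0 by apply/eqP => /(SU x Ux).1.
have cf : {for x, continuous f} := Ck_continuous Cf Ux.
have /nbhs_rowP[r r0 rP] := open_nbhs_nbhs (conj oU Ux).
have [r' r'0 r'P] : exists2 r : R, 0 < r & forall y, `|x - y| < r ->
    f y != 0 /\ (0 < f y) = (0 < f x).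
  have [fx|fx|fx] := ltgtP 0 (f x).
  - have /nbhs_rowP[r' r'0 r'P] := cf _ (lt_nbhsr fx); exists r' => // y /r'P/= fy.
    by rewrite gt_eqF.
  - have /nbhs_rowP[r' r'0 r'P] := cf _ (lt_nbhsl fx); exists r' => // y /r'P/= fy.
    by rewrite lt_eqF// ltNge (ltW fy).
  - by rewrite -fx eqxx in fx0.
exists (Num.min r r'); first by rewrite lt_min r0.
move=> y; rewrite lt_min => /andP[/rP Uy /r'P[fy0 fyx]].
have nSy : ~ S y by move=> /(SU y Uy).1/eqP; exact/negP.
by split=> //; rewrite !sU.
Qed.

Lemma sided_both s x : sided s x -> S x -> forall (b : bool) (r : R), 0 < r ->
  exists y, [/\ `|x - y| < r, ~ S y & s y = b].
Proof.
move=> sx Sx b r r0.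
have main s' : sided s' x -> exists y, [/\ `|x - y| < r, ~ S y & s' y = true].
  move=> [U [f [Ux oU Cf SU sU]]].
  have [SE /(_ Sx)[i fi]] := SU x Ux.
  have /nbhs_rowP[r' r'0 r'P] := open_nbhs_nbhs (conj oU Ux).
  have m0 : 0 < Num.min r r' by rewrite lt_min r0.
  have [y] := positive_nearby oU Cf Ux fi (SE.1 Sx) m0.
  rewrite lt_min => /andP[yr /r'P Uy] fy.
  have nSy : ~ S y by move=> /(SU y Uy).1 h; rewrite h ltxx in fy.
  by exists y; split=> //; rewrite sU.
case: b; first exact: main.
have [y [yr nSy sy]] := main _ (sided_neg sx).
by exists y; split=> //; apply/negbTE.
Qed.

Lemma sided_dense s x (r : R) : sided s x -> 0 < r -> exists2 y, `|x - y| < r & ~ S y.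
Proof.
move=> sx r0; have [Sx|nSx] := pselect (S x).
  by have [y [yr nSy _]] := sided_both sx Sx true r0; exists y.
by exists x; rewrite // subrr normr0.
Qed.

(** At a point of S, [side_sign] makes [s2] constant on each of the two sides told apart by [s1].
    Both values of [s2] occur nearby, so the two constants differ and [s2] is [s1] or its
    negation. *)
Lemma sided_compare s1 s2 x : sided s1 x -> sided s2 x ->
  exists2 r : R, 0 < r & exists c : bool,
    forall y, `|x - y| < r -> ~ S y -> s2 y = s1 y (+) c.
Proof.
move=> sx1 sx2; have [Sx|nSx] := pselect (S x); last first.
  have [r1 r10 P1] := sided_off sx1 nSx; have [r2 r20 P2] := sided_off sx2 nSx.
  exists (Num.min r1 r2); first by rewrite lt_min r10.
  exists (s1 x (+) s2 x) => y; rewrite lt_min => /andP[/P1[_ ->] /P2[_ ->]] _.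
  by rewrite addbA addbb.
have half s1' s2' : sided s1' x -> sided s2' x -> exists2 r : R, 0 < r &
    exists c : bool, forall y, `|x - y| < r -> ~ S y -> s1' y -> s2' y = c.
  move=> [U [f [Ux oU Cf SU sU]]] [V [g [Vx oV Cg SV sV]]].
  have oW : open (U `&` V) by exact: openI.
  have CfW : Ck 1 (U `&` V) f by apply: Ck_sub Cf => y [].
  have [SE /(_ Sx)[i fi]] := SU x Ux.
  have [r r0 [c cP]] : exists2 del : R, 0 < del & exists c : bool,
      forall y, `|x - y| < del -> 0 < f y -> (0 < g y) = c.
    apply: (side_sign oW CfW (conj Ux Vx) fi (SE.1 Sx)).
      by move=> y [_ Vy]; exact: (Ck_continuous Cg Vy).
    move=> y [Uy Vy] fy; apply/eqP => gy.
    by move: fy; rewrite ((SU y Uy).1.1 ((SV y Vy).1.2 gy)) eqxx.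
  have /nbhs_rowP[r' r'0 r'P] := open_nbhs_nbhs (conj oW (conj Ux Vx)).
  exists (Num.min r r'); first by rewrite lt_min r0.
  exists c => y; rewrite lt_min => /andP[yr /r'P[Uy Vy]] nSy.
  by rewrite sU// sV//; exact: cP.
have [r1 r10 [c1 P1]] := half _ _ sx1 sx2.
have [r2 r20 [c2 P2]] := half _ _ (sided_neg sx1) sx2.
pose r := Num.min r1 r2.
have r0 : 0 < r by rewrite lt_min r10.
have rP y : `|x - y| < r -> ~ S y -> s2 y = if s1 y then c1 else c2.
  rewrite lt_min => /andP[y1 y2] nSy; case: ifP => sy; first exact: P1.
  by apply: P2; rewrite ?sy.
exists r => //; exists (~~ c1) => y yr nSy.
have [y1 [y1r nSy1 sy1]] := sided_both sx2 Sx true r0.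
have [y2 [y2r nSy2 sy2]] := sided_both sx2 Sx false r0.
have := rP _ y1r nSy1; have := rP _ y2r nSy2; rewrite sy1 sy2 (rP y)//.
by case: (s1 y); case: (s1 y1); case: (s1 y2); case: c1 {P1 rP}; case: c2 {P2}.
Qed.

Definition sides Y s := forall x, Y x -> sided s x.

Definition convex_region Y := forall x y (t : R), Y x -> Y y -> 0 <= t <= 1 ->
  Y (x + t *: (y - x)).

(* A locally constant boolean on a convex region is constant: apply the
   intermediate value theorem to the function with values 1 and -1. *)
Lemma locally_constant_convex Y (b : 'rV[R]_d -> bool) : convex_region Y ->
  (forall x, Y x -> exists2 r : R, 0 < r & forall y, `|x - y| < r -> b y = b x) ->
  forall x y, Y x -> Y y -> b x = b y.
Proof.
move=> cY lb x y Yx Yy; pose h z := if b z then 1 else -1 : R.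
have hb z : (0 < h z) = b z by rewrite /h; case: ifP; rewrite ?ltr01// ltr0N1.
rewrite -(hb x) -(hb y) -[in RHS](subrK x y) [y - x + x]addrC.
apply: sign_segment => t t01; last first.
  by rewrite /h; case: ifP => _; rewrite ?oppr_eq0 oner_eq0.
have [r r0 rP] := lb _ (cY x y t Yx Yy t01).
apply/cvgrPdist_le => eps eps0.
apply/nbhs_rowP; exists r => // z /rP bz.
by rewrite /h bz subrr normr0 ltW.
Qed.

(** The local flip is unique because points off S are dense in Y; hence it is locally constant, and
    constant by convexity. *)
Lemma sides_compare Y s1 s2 : convex_region Y -> open Y -> sides Y s1 -> sides Y s2 ->
  exists c : bool, forall y, Y y -> ~ S y -> s2 y = s1 y (+) c.
Proof.
move=> cY oY Y1 Y2.
pose A (c : bool) x := exists2 r : R, 0 < r &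
  forall y, `|x - y| < r -> ~ S y -> s2 y = s1 y (+) c.
have Aor x : Y x -> exists c, A c x.
  move=> Yx; have [r r0 [c cP]] := sided_compare (Y1 x Yx) (Y2 x Yx).
  by exists c, r.
have Auniq x c c' : Y x -> A c x -> A c' x -> c = c'.
  move=> Yx [r r0 rP] [r' r'0 r'P].
  have [|y] := @sided_dense _ _ (Num.min r r') (Y1 x Yx).
    by rewrite lt_min r0.
  rewrite lt_min => /andP[h h'] nSy.
  by have := rP y h nSy; rewrite (r'P y h' nSy); case: (s1 y); case: c {rP}; case: c' {r'P}.
have Anear x c : A c x -> exists2 r : R, 0 < r & forall y, `|x - y| < r -> A c y.
  move=> [r r0 rP]; exists (r / 2); first by rewrite divr_gt0.
  move=> y xy; exists (r / 2); first by rewrite divr_gt0.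
  move=> z yz; apply: rP; rewrite -(subrKA y) (splitr r).
  by apply: le_lt_trans (ler_normD _ _) _; exact: ltrD.
pose b x := `[< A true x >].
have lb x : Y x -> exists2 r : R, 0 < r & forall y, `|x - y| < r -> b y = b x.
  move=> Yx; have [c Ac] := Aor x Yx; have [r r0 rP] := Anear x c Ac.
  have /nbhs_rowP[r' r'0 r'P] := open_nbhs_nbhs (conj oY Yx).
  have bc y : Y y -> A c y -> b y = c.
    move=> Yy Ay; apply/asboolP/idP => [At|ct]; first by rewrite (Auniq y c true).
    by rewrite -ct.
  exists (Num.min r r'); first by rewrite lt_min r0.
  by move=> y; rewrite lt_min => /andP[/rP Ay /r'P Yy]; rewrite !bc.
have [[x0 Yx0]|nY] := pselect (exists x, Y x); last first.
  by exists true => y Yy; case: nY; exists y.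
exists (b x0) => y Yy nSy; have [c Ac] := Aor y Yy.
rewrite (locally_constant_convex cY lb Yx0 Yy).
have -> : b y = c.
  by apply/asboolP/idP => [At|ct]; [rewrite (Auniq y c true)|rewrite -ct].
by have [r r0] := Ac; apply; rewrite // subrr normr0.
Qed.

(** On the convex overlap the two indicators differ by one flip, which is applied to the second
    before they are joined. *)
Lemma sides_glue Y1 Y2 s1 s2 : open Y1 -> open Y2 -> convex_region (Y1 `&` Y2) ->
  sides Y1 s1 -> sides Y2 s2 -> exists s, sides (Y1 `|` Y2) s.
Proof.
move=> o1 o2 cY h1 h2.
have [c cP] := @sides_compare (Y1 `&` Y2) s1 s2 cY (openI o1 o2)
  (fun x h => h1 x h.1) (fun x h => h2 x h.2).
pose s y := if `[< Y1 y >] then s1 y else s2 y (+) c.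
exists s => x [Yx|Yx].
  apply: sided_ext (h1 x Yx) _.
  have /nbhs_rowP[r r0 rP] := open_nbhs_nbhs (conj o1 Yx).
  by exists r => // y /rP Yy _; rewrite /s (asboolT Yy).
have h2c : sided (fun y => s2 y (+) c) x.
  case: c {cP s} => /=; last first.
    by apply: sided_ext (h2 x Yx) _; exists 1 => // y _ _; rewrite addbF.
  apply: sided_ext (sided_neg (h2 x Yx)) _; exists 1 => // y _ _.
  by rewrite addbT.
apply: sided_ext h2c _.
have /nbhs_rowP[r r0 rP] := open_nbhs_nbhs (conj o2 Yx).
exists r => // y /rP Yy nSy; rewrite /s; case: asboolP => // Y1y.
by rewrite (cP y (conj Y1y Yy) nSy) -addbA addbb addbF.
Qed.

Definition obox (a b : 'rV[R]_d) : set 'rV[R]_d :=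
  [set x | forall i, a ord0 i < x ord0 i < b ord0 i].

Lemma open_obox a b : open (obox a b).
Proof.
rewrite openE => x xab; apply/nbhs_rowP.
have /fin_all_exists2[r r0 rP] i : exists2 r : R, 0 < r &
    a ord0 i + r < x ord0 i < b ord0 i - r.
  have /andP[h1 h2] := xab i.
  exists (Num.min (x ord0 i - a ord0 i) (b ord0 i - x ord0 i) / 2).
    by rewrite divr_gt0// lt_min !subr_gt0 h1.
  have : Num.min (x ord0 i - a ord0 i) (b ord0 i - x ord0 i) <= x ord0 i - a ord0 i.
    by rewrite ge_min lexx.
  have : Num.min (x ord0 i - a ord0 i) (b ord0 i - x ord0 i) <= b ord0 i - x ord0 i.
    by rewrite ge_min lexx orbT.
  by move=> *; apply/andP; split; lra.
exists (\big[Num.min/1]_i r i).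
  by apply: lt_bigmin => // i _; exact: r0.
move=> y xy i; have ri : `|x ord0 i - y ord0 i| < r i.
  have := coord_le (x - y) i; rewrite !mxE => /le_lt_trans; apply.
  by apply: lt_le_trans xy _; exact: bigmin_le_cond.
by have /andP[h1 h2] := rP i; move: ri; rewrite ltr_norml => /andP[h3 h4]; apply/andP; split; lra.
Qed.

Lemma convex_comb_gt (a x y t : R) : a < x -> a < y -> 0 <= t <= 1 -> a < x + t * (y - x).
Proof.
move=> ax ay /andP[t0 t1]; have [xy|yx] := leP x y.
  by apply: lt_le_trans ax _; rewrite lerDl mulr_ge0// subr_ge0.
by apply: lt_le_trans ay _; nra.
Qed.

Lemma convex_obox a b : convex_region (obox a b).
Proof.
move=> x y t xab yab t01 i; rewrite !mxE.
have /andP[h1 h2] := xab i; have /andP[h3 h4] := yab i.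
rewrite convex_comb_gt//= -ltrN2.
have -> : - (x ord0 i + t * (y ord0 i - x ord0 i)) =
  - x ord0 i + t * (- y ord0 i - - x ord0 i) by ring.
by apply: convex_comb_gt; rewrite ?ltrN2.
Qed.

Lemma convex_regionI Y1 Y2 : convex_region Y1 -> convex_region Y2 ->
  convex_region (Y1 `&` Y2).
Proof. by move=> c1 c2 x y t [x1 x2] [y1 y2] t01; split; [exact: c1|exact: c2]. Qed.

Lemma sided_away Y x : open Y -> Y x -> Y `&` S = set0 -> sided (fun=> true) x.
Proof.
move=> oY Yx YS; exists Y, (fun=> 1); split; [exact: Yx|exact: oY|exact: Ck_cst| |].
  move=> y Yy; have nSy : ~ S y by move=> Sy; have : (Y `&` S) y by []; rewrite YS.
  by split=> //; split=> // /eqP; rewrite oner_eq0.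
by move=> y _ _; rewrite ltr01.
Qed.

(** A Lebesgue number: a small box either misses S or lies in a chart, whose function tells the
    sides apart. *)
Lemma small_boxes : exists2 eps : R, 0 < eps & forall a b : 'rV[R]_d,
  (forall i, b ord0 i - a ord0 i <= eps) -> exists s, sides (obox a b) s.
Proof.
have [|r r0 rP] := @compact_uniform R d S (fun del x => exists s,
    forall y, `|x - y| < del -> sided s y) cS.
  move=> p Sp; have [U [f [Up oU Sf gf SU]]] := chartS Sp.
  have sU y : U y -> sided (fun y => 0 < f y) y.
    move=> Uy; exists U, f; split; [exact: Uy|exact: oU|exact: Sf| |by []].
    by move=> z Uz; split; [exact: SU|move=> _; apply: grad_neq0; exact: gf].
  have /nbhs_rowP[r r0 rP] := open_nbhs_nbhs (conj oU Up).
  exists (r / 2); first by rewrite divr_gt0.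
  move=> x del px /andP[del0 delr]; exists (fun y => 0 < f y) => y xy.
  apply/sU/rP; rewrite -(subrKA x) (splitr r).
  by apply: le_lt_trans (ler_normD _ _) _; rewrite ltrD// (lt_trans xy).
exists (r / 4); first by rewrite divr_gt0.
move=> a b ab; have [[x [xab Sx]]|nS] := pselect (exists x, obox a b x /\ S x).
  have [|s sP] := rP (r / 2) x _ Sx; first by apply/andP; split; lra.
  exists s => y yab; apply: sP; apply: normr_row_lt => [|i]; first by rewrite divr_gt0.
  rewrite !mxE; have := ab i; have /andP[h1 h2] := xab i; have /andP[h3 h4] := yab i.
  by move=> h5; rewrite ltr_norml; apply/andP; split; lra.
exists (fun=> true) => y yab; apply: (sided_away (@open_obox a b) yab).
by apply/seteqP; split=> // x [xab Sx]; case: nS; exists x.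
Qed.

(** Induction on the number of axes along which the box may be long. The overlap of two boxes is
    convex, so [sides_glue] applies. *)
Lemma all_boxes a b : exists s, sides (obox a b) s.
Proof.
have [eps eps0 small] := small_boxes.
suff main k : forall a b : 'rV[R]_d, (forall i : 'I_d, (k <= i)%N -> b ord0 i - a ord0 i <= eps) ->
    exists s, sides (obox a b) s.
  by apply: (main d) => i; rewrite leqNgt ltn_ord.
elim: k => [|k IH] {}a {}b ab; first by apply: small => i; exact: ab.
have [kd|kd] := ltnP k d; last first.
  by apply: IH => i ki; have := leq_trans kd ki; rewrite leqNgt ltn_ord.
pose i0 := Ordinal kd.
(* Each step splits off along axis k a slab of width eps, which overlaps the remaining box in a
   width of [eps / 2]. *)
suff step m : forall a b : 'rV[R]_d, (forall i : 'I_d, (k < i)%N -> b ord0 i - a ord0 i <= eps) ->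
    b ord0 i0 - a ord0 i0 <= m%:R * (eps / 2) + eps -> exists s, sides (obox a b) s.
  apply: (step (Num.bound `|(b ord0 i0 - a ord0 i0) / (eps / 2)|)) => //.
  have e2 : 0 < eps / 2 by rewrite divr_gt0.
  apply: (@le_trans _ _ ((Num.bound `|(b ord0 i0 - a ord0 i0) / (eps / 2)|)%:R * (eps / 2))).
    rewrite -ler_pdivrMr//; apply: le_trans (ler_norm _) _; apply: ltW.
    exact: archi_boundP.
  by rewrite lerDl ltW.
elim: m => [|m IHm] {ab} a' b' ab ab0.
  apply: IH => i; rewrite leq_eqVlt => /orP[/eqP ki|]; last exact: ab.
  have -> : i = i0 by apply/val_inj.
  by move: ab0; rewrite mul0r add0r.
pose b1 : 'rV[R]_d := \row_i (if i == i0 then b' ord0 i - eps / 2 else b' ord0 i).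
pose a2 : 'rV[R]_d := \row_i (if i == i0 then b' ord0 i - eps else a' ord0 i).
have [||s1 h1] := IHm a' b1.
- move=> i ki; rewrite mxE; case: eqP => [ii|_]; last exact: ab.
  by rewrite ii ltnn in ki.
- by rewrite mxE eqxx; move: ab0; rewrite -natr1 mulrDl; lra.
have [|s2 h2] := IH a2 b'.
  move=> i; rewrite leq_eqVlt mxE => /orP[/eqP ki|ki].
    by have -> : i == i0 by [apply/eqP/val_inj]; lra.
  by case: eqP => [ii|_]; [rewrite ii ltnn in ki|exact: ab].
have [s sP] := sides_glue (@open_obox _ _) (@open_obox _ _)
  (convex_regionI (convex_obox (a:=a') (b:=b1)) (convex_obox (a:=a2) (b:=b'))) h1 h2.
exists s => x xab; apply: sP.
have [x1|x1] := ltP (x ord0 i0) (b' ord0 i0 - eps / 2); [left|right] => i; rewrite mxE;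
  have /andP[h3 h4] := xab i; case: eqP => [ii|_]; rewrite ?h3 ?h4//.
  by rewrite ii.
by rewrite ii andbT; lra.
Qed.

Hypothesis d2 : (2 <= d)%N.

(* The complement of a large cube is connected because d >= 2: it is covered
   by half-space slabs each of which meets another one. *)
Theorem surface_in_closure_int p : S p -> closure (surf_int S) p.
Proof.
move=> Sp.
have [M M0 SM] : exists2 M : R, 0 < M & forall x i, S x -> `|x ord0 i| <= M.
  have [M M0 MP] : exists2 M : R, 0 < M & forall x, S x -> `| `|x| | <= M.
    by apply: (bounded_on_compact cS) => x _; exact: norm_continuous.
  exists M => // x i /MP; rewrite normr_id => h.
  exact: le_trans (coord_le x i) h.
pose B := obox (const_mx (- (M + 2))) (const_mx (M + 2)).
have BE x : B x <-> forall i, `|x ord0 i| < M + 2.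
  by split=> h i; have := h i; rewrite !mxE ltr_norml.
have [s sB] := all_boxes (const_mx (- (M + 2))) (const_mx (M + 2)).
pose q : 'rV[R]_d := const_mx (M + 1).
have shell y : B y -> (exists i, M < `|y ord0 i|) -> ~ S y /\ s y = s q.
  move=> By [i yi]; have nS z j : M < `|z ord0 j| -> ~ S z.
    by move=> zj /(SM z j); rewrite leNgt zj.
  split; first exact: nS yi.
  have slab (sg : R) j : `|sg| = 1 -> forall x y, B x -> B y ->
      M < sg * x ord0 j -> M < sg * y ord0 j -> s x = s y.
    move=> sn x z Bx Bz xj zj.
    apply: (@locally_constant_convex (B `&` [set x | M < sg * x ord0 j]) s) => //.
      apply: convex_regionI; first exact: convex_obox.
      move=> u v t /= uj vj t01; rewrite !mxE.
      have -> : sg * (u ord0 j + t * (v ord0 j - u ord0 j)) =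
        sg * u ord0 j + t * (sg * v ord0 j - sg * u ord0 j) by ring.
      exact: convex_comb_gt.
    move=> u [Bu uj]; have nSu : ~ S u.
      apply: (nS u j); apply: lt_le_trans uj _; apply: le_trans (ler_norm _) _.
      by rewrite normrM sn mul1r.
    have [r r0 rP] := sided_off (sB u Bu) nSu.
    by exists r => // v /rP[].
  have Bq : B q by apply/BE => j; rewrite mxE gtr0_norm; lra.
  have yi' : M < y ord0 i \/ M < - 1 * y ord0 i.
    by move: yi; rewrite lter_normr => /orP[]; [left|right; rewrite mulN1r].
  case: yi' => yi'.
    by apply: (slab 1 i) => //; rewrite ?normr1 ?mul1r// mxE; lra.
  have [j ji] : exists j : 'I_d, j != i.
    have d0 : (0 < d)%N by exact: ltnW.
    have [->|i0] := eqVneq i (Ordinal d0); first by exists (Ordinal d2).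
    by exists (Ordinal d0); rewrite eq_sym.
  (* [z] shares the negative slab of axis i with y and the positive slab of axis j with q. *)
  pose z : 'rV[R]_d := \row_l (if l == i then - (M + 1) else M + 1).
  have Bz : B z.
    by apply/BE => l; rewrite mxE; case: eqP => _; rewrite ?normrN gtr0_norm; lra.
  transitivity (s z).
    apply: (slab (- 1) i) => //; first by rewrite normrN normr1.
    by rewrite mxE eqxx; lra.
  apply: (slab 1 j) => //; first by rewrite normr1.
    by rewrite mxE (negbTE ji); lra.
  by rewrite mxE; lra.
have MB x : (forall i, `|x ord0 i| <= M) -> B x.
  by move=> h; apply/BE => i; apply: le_lt_trans (h i) _; lra.
(* The side away from the far corner q. It is open and closed in the complement of S and lies in the
   cube, so the components of its points are bounded; it accumulates at p because both values of s
   occur there. *)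
pose E := [set y | [/\ B y, ~ S y & s y <> s q]].
have openE1 x : E x -> exists2 r : R, 0 < r & forall y, `|x - y| < r -> E y.
  move=> [Bx nSx sx]; have [r r0 rP] := sided_off (sB x Bx) nSx.
  have /nbhs_rowP[r' r'0 r'P] := open_nbhs_nbhs (conj (@open_obox _ _) Bx).
  exists (Num.min r r'); first by rewrite lt_min r0.
  by move=> y; rewrite lt_min => /andP[/rP[nSy sy] /r'P By]; split=> //; rewrite sy.
have openF x : ~ S x -> ~ E x -> exists2 r : R, 0 < r & forall y, `|x - y| < r -> ~ E y.
  move=> nSx nEx; have [Bx|nBx] := pselect (B x).
    have [r r0 rP] := sided_off (sB x Bx) nSx.
    exists r => // y /rP[nSy sy] [_ _]; rewrite sy => sx; exact: nEx.
  have [i xi] : exists i, M + 2 <= `|x ord0 i|.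
    apply: contrapT => h; apply: nBx; apply/BE => i; rewrite ltNge; apply/negP => xi.
    by apply: h; exists i.
  exists 1 => // y xy [By nSy]; apply; apply: (shell y By _).2; exists i.
  have := le_lt_trans (coord_le (x - y) i) xy; rewrite !mxE => h.
  have := ler_normD (x ord0 i - y ord0 i) (y ord0 i); rewrite subrK; lra.
have Eint : E `<=` surf_int S.
  move=> y Ey; have [By nSy sy] := Ey; split=> //.
  have CE : connected_component (~` S) y `<=` E.
    have sep : separated E (~` S `\` E).
      split; apply/seteqP; split=> // x [].
        move=> cEx [/= nSx nEx]; have [r r0 rP] := openF x nSx nEx.
        have [z [Ez xz]] := cEx _ (proj2 (nbhs_rowP x [set z | `|x - z| < r]) (ex_intro2 _ _ r r0 (fun _ h => h))).
        exact: rP xz Ez.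
      move=> Ex cFx; have [r r0 rP] := openE1 x Ex.
      have [z [[_ nEz] xz]] := cFx _ (proj2 (nbhs_rowP x [set z | `|x - z| < r]) (ex_intro2 _ _ r r0 (fun _ h => h))).
      exact: nEz (rP _ xz).
    have sub : connected_component (~` S) y `<=` E `|` (~` S `\` E).
      move=> x /connected_component_sub nSx.
      by have [Ex|nEx] := pselect (E x); [left|right].
    have [//|h] := connected_subset sep sub (@component_connected _ _ _).
    by have [_ nEy] := h y (connected_component_refl nSy).
  exists (M + 2); split; first exact: num_real.
  move=> K MK x /CE[Bx _ _]; apply: normr_row_le; first by lra.
  by move=> i; apply: ltW; apply: lt_trans MK; exact: (BE x).1.
move=> A /nbhs_rowP[r r0 rA].
have Bp : B p by apply: MB => i; exact: SM.
have /nbhs_rowP[r' r'0 r'P] := open_nbhs_nbhs (conj (@open_obox _ _) Bp).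
have m0 : 0 < Num.min r r' by rewrite lt_min r0.
have [y [yr nSy sy]] := sided_both (sB p Bp) Sp (~~ s q) m0.
move: yr; rewrite lt_min => /andP[yr /r'P By].
exists y; split; last exact: rA.
by apply: Eint; split=> //; rewrite sy; case: (s q).
Qed.

End Separation.

(** * Components, closures and defining functions *)

Section Surface.
Context {R : realType} {d : nat}.
Implicit Types (x y z v : 'rV[R]_d) (f g : 'rV[R]_d -> R) (S U : set 'rV[R]_d).
Local Notation e_ i := (delta_mx ord0 i).

Lemma same_component_ball S x y (r : R) : (forall z, `|x - z| < r -> ~ S z) ->
  `|x - y| < r -> connected_component (~` S) x = connected_component (~` S) y.
Proof.
move=> xS xy; apply: same_connected_component.
pose L := [set x + (1 * t) *: (y - x) | t in `[0, 1]%classic].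
have LS z : L z -> `|x - z| < r.
  move=> [t /= t01 <-]; rewrite mul1r; move: t01; rewrite in_itv/= => /andP[t0 t1].
  rewrite opprD addNKr normrN normrZ (ger0_norm t0) distrC.
  by apply: le_lt_trans xy; rewrite ler_piMl.
apply: (@connected_component_max _ _ L).
- exists 0; first by rewrite /= in_itv/= lexx ler01.
  by rewrite mulr0 scale0r addr0.
- by move=> z /LS/xS.
- apply: connected_continuous_connected; first exact: segment_connected.
  apply: continuous_subspaceT => t.
  apply: cvgD; first exact: cvg_cst.
  by apply: cvgZr_tmp; apply: cvgMl_tmp; exact: cvg_id.
- exists 1; first by rewrite /= in_itv/= lexx ler01.
  by rewrite mulr1 scale1r addrC subrK.
Qed.

Lemma surf_side_open S (P : set 'rV[R]_d -> Prop) : closed S ->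
  open [set x | ~ S x /\ P (connected_component (~` S) x)].
Proof.
move=> cS; rewrite openE => x [nSx Px].
have /nbhs_rowP[r r0 rP] := open_nbhs_nbhs (conj (closed_openC cS) nSx).
apply/nbhs_rowP; exists r => // y xy; split; first exact: rP.
by rewrite -(same_component_ball rP xy).
Qed.

Lemma open_surf_int S : closed S -> open (surf_int S).
Proof. exact: surf_side_open. Qed.

Lemma open_surf_ext S : closed S -> open (surf_ext S).
Proof. exact: (surf_side_open (P := fun A => ~ bounded_set A)). Qed.

Lemma surf_int_ext S x : surf_int S x -> ~ surf_ext S x.
Proof. by move=> [_ b] [_ nb]. Qed.

Lemma surf_cases S x : [\/ S x, surf_int S x | surf_ext S x].
Proof.
have [Sx|nSx] := pselect (S x); first exact: Or31.
have [b|nb] := pselect (bounded_set (connected_component (~` S) x)).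
  exact: Or32.
exact: Or33.
Qed.

Lemma closureP (A : set 'rV[R]_d) x :
  closure A x <-> forall r : R, 0 < r -> exists2 y, A y & `|x - y| < r.
Proof.
split=> [cA r r0|h B /nbhs_rowP[r r0 rB]].
  have [y [Ay xy]] := cA _ (proj2 (nbhs_rowP x [set z | `|x - z| < r])
    (ex_intro2 _ _ r r0 (fun _ h => h))).
  by exists y.
by have [y Ay /rB] := h r r0; exists y.
Qed.

Lemma closure_open_disjoint (A B : set 'rV[R]_d) x : open B -> B x ->
  (forall y, A y -> ~ B y) -> ~ closure A x.
Proof.
move=> oB Bx AB cA; have /nbhs_rowP[r r0 rP] := open_nbhs_nbhs (conj oB Bx).
by have /closureP/(_ r r0)[y Ay /rP] := cA; exact: AB.
Qed.

Lemma compact_closure (A : set 'rV[R]_d) : bounded_set A -> compact (closure A).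
Proof.
move=> [M [Mr MA]]; apply: bounded_closed_compact; last exact: closed_closure.
exists (M + 2); split; first exact: num_real.
move=> K MK x /closureP/(_ 1 ltr01)[y Ay xy].
have : `|y| <= M + 1 by apply: MA => //; rewrite ltrDl.
move=> yM; rewrite -[x](subrK y); apply: le_trans (ler_normD _ _) _.
apply: le_trans (ltW MK); rewrite (_ : M + 2 = 1 + (M + 1)); last by ring.
by rewrite lerD// ltW.
Qed.

Lemma eq_on_closure (A : set 'rV[R]_d) f g x :
  {for x, continuous f} -> {for x, continuous g} ->
  (forall y, A y -> f y = g y) -> closure A x -> f x = g x.
Proof.
move=> cf cg fg cA; apply/eqP; rewrite -subr_eq0 -normr_le0.
apply/ler_addgt0Pl => e e0; rewrite addr0.
have e20 : 0 < e / 2 by rewrite divr_gt0.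
have /nbhs_rowP[r1 r10 P1] : \forall y \near x, `|f x - f y| <= e / 2.
  exact: (cvgr_dist_le _ _ cf).
have /nbhs_rowP[r2 r20 P2] : \forall y \near x, `|g x - g y| <= e / 2.
  exact: (cvgr_dist_le _ _ cg).
have m0 : 0 < Num.min r1 r2 by rewrite lt_min r10.
have /closureP/(_ _ m0)[y Ay] := cA; rewrite lt_min => /andP[/P1 h1 /P2 h2].
rewrite (_ : f x - g x = (f x - f y) - (g x - g y)); last by rewrite (fg y Ay); ring.
by apply: le_trans (ler_normB _ _) _; rewrite [e]splitr lerD.
Qed.

Lemma le0_on_closure (A : set 'rV[R]_d) f x : {for x, continuous f} ->
  (forall y, A y -> f y <= 0) -> closure A x -> f x <= 0.
Proof.
move=> cf f0 cA; rewrite leNgt; apply/negP => fx.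
have /nbhs_rowP[r r0 rP] := cf _ (lt_nbhsr fx).
have /closureP/(_ _ r0)[y Ay /rP] := cA.
by rewrite /= ltNge f0.
Qed.

Lemma smooth_C1 U f : smooth U f -> Ck 1 U f. Proof. exact. Qed.

Lemma negative_nearby U f x (r : R) : open U -> Ck 1 U f -> U x ->
  grad f x <> 0 -> f x = 0 -> 0 < r -> exists2 y, `|x - y| < r & f y < 0.
Proof.
move=> oU Cf Ux /grad_neq0[i fi] fx r0.
have CN : Ck 1 U (fun y => - f y) by exact: CkN.
have fi' : partial i (fun y => - f y) x != 0.
  rewrite (partial_eq i oU (g := fun y => -1 * f y) _ Ux); last first.
    by move=> z _; rewrite mulN1r.
  by rewrite partialZ ?mulN1r ?oppr_eq0//; exact: (Ck_derivable Cf Ux).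
have [|y xy] := positive_nearby oU CN Ux fi' _ r0; first by rewrite fx oppr0.
by rewrite oppr_gt0; exists y.
Qed.

Lemma descent_ray U f x v : open U -> Ck 1 U f -> U x -> f x = 0 ->
  dotr (grad f x) v < 0 -> exists2 r : R, 0 < r & forall t, 0 < t < r -> f (x + t *: v) < 0.
Proof.
move=> oU Cf Ux fx fv.
have cD : {for x, continuous (fun y => dotr (grad f y) v)}.
  rewrite /dotr; apply: (@cvg_sum_R _ _ _ (nbhs x)) => i _; apply: cvgMr_tmp.
  rewrite !mxE (_ : (fun y => _) = partial i f); first exact: (Ck_continuous (Ck_partial i Cf) Ux).
  by apply/funext => y; rewrite mxE.
have /nbhs_rowP[r1 r10 P1] := cD _ (lt_nbhsl fv).
have /nbhs_rowP[r2 r20 P2] := open_nbhs_nbhs (conj oU Ux).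
have v0 : 0 < `|v| + 1 by rewrite ltr_wpDl.
have m0 : 0 < Num.min r1 r2 by rewrite lt_min r10.
exists (Num.min r1 r2 / (`|v| + 1)); first by rewrite divr_gt0.
move=> t /andP[t0]; rewrite ltr_pdivlMr// => tr.
have near th : 0 <= th <= 1 -> `|x - (x + (th * t) *: v)| < Num.min r1 r2.
  move=> /andP[th0 th1]; rewrite opprD addNKr normrN; apply: le_lt_trans tr.
  rewrite normrZ; apply: ler_pM => //; last by rewrite lerDl.
  by rewrite normrM (ger0_norm th0) (gtr0_norm t0) ler_piMl// ltW.
have [|th th01 E] := @MVT_line R d f x v t.
  move=> th /near; rewrite lt_min => /andP[_ /P2 Uy].
  exact: (C1_derivable oU Cf Uy).
have := near th th01; rewrite lt_min => /andP[/P1/= h1 /P2 Uy].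
by move: E; rewrite fx subr0 => ->; rewrite (C1_derive v oU Cf Uy) pmulr_rlt0.
Qed.

Lemma gradN U f x : open U -> Ck 1 U f -> U x -> grad (fun y => - f y) x = - grad f x.
Proof.
move=> oU Cf Ux; apply/rowP => i; rewrite !mxE.
rewrite (partial_eq i oU (g := fun y => -1 * f y) _ Ux); last first.
  by move=> z _; rewrite mulN1r.
by rewrite partialZ ?mulN1r//; exact: (Ck_derivable Cf Ux).
Qed.

Lemma dotrC (v w : 'rV[R]_d) : dotr v w = dotr w v.
Proof. by apply: eq_bigr => i _; rewrite mulrC. Qed.

Lemma dotr_ge0 (v : 'rV[R]_d) : 0 <= dotr v v.
Proof. by apply: sumr_ge0 => i _; rewrite -expr2 sqr_ge0. Qed.

Lemma dotr_eq0 (v : 'rV[R]_d) : dotr v v = 0 -> v = 0.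
Proof.
move=> /eqP; rewrite psumr_eq0 => [/allP h|i _]; last by rewrite -expr2 sqr_ge0.
apply/rowP => i; rewrite mxE; apply/eqP.
by have := h i (mem_index_enum i); rewrite mulf_eq0 orbb.
Qed.

Lemma dotrDr (u v w : 'rV[R]_d) : dotr u (v + w) = dotr u v + dotr u w.
Proof. exact: linearD. Qed.

Lemma dotrZr (u v : 'rV[R]_d) (c : R) : dotr u (c *: v) = c * dotr u v.
Proof. exact: linearZ. Qed.

(** The component v of w orthogonal to u lies on the edge of the half-space. Pushing it slightly
    inside bounds [dotr v v] by any positive number, so w is a multiple of u. *)
Lemma halfspace_parallel (u w : 'rV[R]_d) : u <> 0 -> w <> 0 ->
  (forall v, dotr u v < 0 -> dotr w v <= 0) -> exists2 c : R, 0 < c & u = c *: w.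
Proof.
move=> u0 w0 h.
have uu : 0 < dotr u u.
  by rewrite lt_def dotr_ge0 andbT; apply/eqP => /dotr_eq0.
pose c := dotr w u / dotr u u.
pose v := w + (- c) *: u.
have uv : dotr u v = 0.
  by rewrite dotrDr dotrZr /c (dotrC w u) mulNr divfK ?subrr// gt_eqF.
have vv : dotr v v = 0.
  apply/eqP; rewrite eq_le dotr_ge0 andbT.
  have vE : dotr v v = dotr w v.
    rewrite {1}/v dotrC dotrDr dotrZr (dotrC v u) uv mulr0 addr0; exact: dotrC.
  rewrite vE; apply/ler_addgt0Pr => e e0; rewrite add0r.
  pose k := e / (`|dotr w u| + 1).
  have k0 : 0 < k by rewrite divr_gt0// ltr_wpDl.
  have : dotr w (v + (- k) *: u) <= 0.
    by apply: h; rewrite dotrDr dotrZr uv add0r mulNr oppr_lt0 mulr_gt0.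
  rewrite dotrDr dotrZr => h1.
  have : k * dotr w u <= e.
    apply: (@le_trans _ _ (k * (`|dotr w u| + 1))).
      by rewrite ler_pM2l//; apply: le_trans (ler_norm _) _; rewrite lerDl.
    by rewrite /k divfK// gt_eqF// ltr_wpDl.
  lra.
have wE : w = c *: u.
  by have /eqP := dotr_eq0 vv; rewrite /v scaleNr subr_eq0 => /eqP.
have c0 : c != 0 by apply/eqP => c0; apply: w0; rewrite wE c0 scale0r.
have cp : 0 < c.
  rewrite lt_def c0/= /c divr_ge0 ?dotr_ge0//.
  have := h (- u); rewrite -scaleN1r !dotrZr !mulN1r oppr_lt0 => /(_ uu).
  by rewrite oppr_le0.
exists c^-1; first by rewrite invr_gt0.
by rewrite wE scalerA mulVf// scale1r.
Qed.

(** Otherwise some direction would make f decrease and g increase. The comparison is needed because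
    [outward_normal] brings its own defining function at each point, while near a given point of the
    surface one function is fixed. *)
Lemma defining_gradients U V f g x : open U -> open V -> Ck 1 U f -> Ck 1 V g ->
  U x -> V x -> f x = 0 -> g x = 0 -> grad f x <> 0 -> grad g x <> 0 ->
  (forall y, U y -> V y -> (f y < 0 <-> g y < 0)) ->
  exists2 c : R, 0 < c & grad f x = c *: grad g x.
Proof.
move=> oU oV Cf Cg Ux Vx fx gx nf ng fg.
apply: halfspace_parallel => // v fv; rewrite leNgt; apply/negP => gv.
have [r1 r10 P1] := descent_ray oU Cf Ux fx fv.
have [r2 r20 P2] : exists2 r : R, 0 < r & forall t, 0 < t < r -> - g (x + t *: v) < 0.
  apply: (descent_ray oV (CkN oV Cg) Vx); first by rewrite gx oppr0.
  by rewrite (gradN oV Cg Vx) dotrC -scaleN1r dotrZr mulN1r oppr_lt0 dotrC.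
have /nbhs_rowP[r3 r30 P3] := open_nbhs_nbhs (conj (openI oU oV) (conj Ux Vx)).
have v0 : 0 < `|v| + 1 by rewrite ltr_wpDl.
pose m := Num.min r1 (Num.min r2 (r3 / (`|v| + 1))).
have m0 : 0 < m by rewrite !lt_min r10 r20 divr_gt0.
have t0 : 0 < m / 2 by rewrite divr_gt0.
have : m / 2 < m by lra.
rewrite {2}/m !lt_min => /and3P[h1 h2 h3].
have [Uy Vy] : (U `&` V) (x + (m / 2) *: v).
  apply: P3; rewrite opprD addNKr normrN normrZ gtr0_norm//.
  move: h3; rewrite ltr_pdivlMr// => h3; apply: le_lt_trans h3.
  by rewrite ler_wpM2l ?(ltW t0)// lerDl.
have /(fg _ Uy Vy) g1 : f (x + (m / 2) *: v) < 0 by apply: P1; rewrite t0.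
have := P2 (m / 2); rewrite t0 h2 oppr_lt0 => /(_ isT) /(lt_trans g1).
by rewrite ltxx.
Qed.

(** A defining function controls only [f < 0]. Points of S have [f <= 0] as limits of interior
    points, which is where separation enters; a zero of f off S would be exterior, yet interior
    points lie arbitrarily near it because the gradient is nonzero. *)
Lemma defining_int_ext S U f : closed S -> (forall x, S x -> closure (surf_int S) x) ->
  defining_function (surf_int S) U f ->
  forall x, U x -> (S x <-> f x = 0) /\ (surf_ext S x <-> 0 < f x).
Proof.
move=> cS Sint [oU Sf gf Uf].
have Cf := smooth_C1 Sf.
have S0 x : U x -> S x -> f x = 0.
  move=> Ux Sx; apply/eqP; rewrite eq_le; apply/andP; split.
    apply: (@le0_on_closure (surf_int S `&` U) f x (Ck_continuous Cf Ux)).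
      by move=> y [Iy Uy]; apply: ltW; apply/Uf.
    apply/closureP => r r0.
    have /nbhs_rowP[r' r'0 rP] := open_nbhs_nbhs (conj oU Ux).
    have m0 : 0 < Num.min r r' by rewrite lt_min r0.
    have /closureP/(_ _ m0)[y Iy] := Sint x Sx.
    by rewrite lt_min => /andP[xy /rP Uy]; exists y.
  by rewrite leNgt; apply/negP => /(Uf x Ux)[].
have f0 x : U x -> f x = 0 -> S x.
  move=> Ux fx; have [//|Ix|Ex] := surf_cases S x.
    by move: (Ix) => /(Uf x Ux); rewrite fx ltxx.
  have /nbhs_rowP[r r0 rP] := open_nbhs_nbhs (conj (openI oU (open_surf_ext cS)) (conj Ux Ex)).
  have [y /rP[Uy Ey] fy] := negative_nearby oU Cf Ux (gf x Ux) fx r0.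
  by have /surf_int_ext := (Uf y Uy).2 fy.
move=> x Ux; split; first by split; [exact: S0|exact: f0].
split=> [Ex|fx].
  case: (ltgtP (f x) 0) => // [/(Uf x Ux)/surf_int_ext//|/(f0 x Ux) Sx].
  by case: Ex.
have [/(S0 x Ux) h|/(Uf x Ux) h|//] := surf_cases S x.
  by rewrite h ltxx in fx.
by move: (lt_trans fx h); rewrite ltxx.
Qed.

End Surface.

(** * Uniqueness in the exterior of the ergosphere *)

Section Density.
Context {R : realType} {n : nat}.
Implicit Types (x y p : 'rV[R]_n) (U D Omega : set 'rV[R]_n) (G : 'rV[R]_n -> 'M[R]_n.+1).

Lemma C1_comp_pos (phi phi' : R -> R) U f : open U -> Ck 1 U f ->
  (forall x : 'rV[R]_n, U x -> 0 < f x) ->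
  (forall s : R, 0 < s -> is_derive s 1 phi (phi' s)) ->
  (forall s : R, 0 < s -> {for s, continuous phi'}) ->
  Ck 1 U (fun x => phi (f x)).
Proof.
move=> oU Cf f0 dphi cphi; apply: (C1_comp1 oU Cf).
  by move=> x /f0/dphi[].
move=> x /f0 fx; have E (s : R) : 0 < s -> phi^`()%classic s = phi' s.
  by move=> s0; rewrite derive1E; have [_ ->] := dphi s s0.
rewrite /prop_for /continuous_at E//.
apply: cvg_trans (cphi _ fx); apply: near_eq_cvg.
by near=> t; rewrite E//; near: t; exact: lt_nbhsr.
Unshelve. all: by end_near. Qed.

Lemma C1_inv_pos U f : open U -> Ck 1 U f ->
  (forall x : 'rV[R]_n, U x -> 0 < f x) -> Ck 1 U (fun x => (f x)^-1).
Proof.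
move=> oU Cf f0.
apply: (C1_comp_pos (phi := fun s => s^-1) (phi' := fun s : R => - (s ^+ 2)^-1) oU Cf f0).
  move=> s s0; have sn0 : s != 0 by rewrite gt_eqF.
  split; first exact: (derivableV (f := id) sn0 (@derivable_id _ _ s 1)).
  rewrite (deriveV (f := id) sn0 (@derivable_id _ _ s 1)) derive_id.
  by rewrite [_ *: _]mulr1 -exprVn.
move=> s s0; apply: continuousN; apply: continuousV; first by rewrite expf_neq0// gt_eqF.
by apply: cvgM; exact: cvg_id.
Qed.

Lemma C1_sqrt_pos U f : open U -> Ck 1 U f ->
  (forall x : 'rV[R]_n, U x -> 0 < f x) -> Ck 1 U (fun x => Num.sqrt (f x)).
Proof.
move=> oU Cf f0.
apply: (C1_comp_pos (phi := Num.sqrt) (phi' := fun s : R => (2 * Num.sqrt s)^-1) oU Cf f0).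
move=> s s0; apply: continuousV; first by rewrite mulf_neq0// sqrtr_eq0 -ltNge.
by apply: cvgMl_tmp; exact: sqrt_continuous.
Qed.

Lemma signr_mul_inv (d : R) : (-1) ^+ n * d^-1 = ((-1) ^+ n * d)^-1.
Proof. by rewrite invfM -exprVn invrN1. Qed.

(** The sign of the determinant is given on the closure of Omega only; it persists in the open set
    [U1], where the inverse and the square root can be differentiated. *)
Lemma density_C1 Omega G : wave_coefficients Omega G -> exists U1,
  [/\ open U1, closure Omega `<=` U1, forall x, U1 x -> 0 < density G x,
      forall j k, Ck 1 U1 (fun x => G x j k) &
      forall j k, Ck 1 U1 (fun x => density G x * G x j k)].
Proof.
move=> [[U [oU OU] CG] _ LG _].
have Cdet : Ck 1 U (fun x => (-1) ^+ n * \det (G x)).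
  apply: (CkZ _ oU); apply: (Ck_sum _ oU) => s _; apply: (CkZ _ oU).
  by apply: (Ck_prod _ oU) => i _; exact: CG.
pose U1 := [set x | U x /\ 0 < (-1) ^+ n * \det (G x)].
have oU1 : open U1 by apply: open_pos oU _ => x Ux; exact: (Ck_continuous Cdet Ux).
have U1U : U1 `<=` U by move=> x [].
have Cdet1 : Ck 1 U1 (fun x => (-1) ^+ n * \det (G x)) by apply: Ck_sub Cdet.
have CG1 j k : Ck 1 U1 (fun x => G x j k) by apply: Ck_sub (CG j k 1%N).
have Ci := C1_inv_pos oU1 Cdet1 (fun x (h : U1 x) => h.2).
have inv0 x : U1 x -> 0 < ((-1) ^+ n * \det (G x))^-1 by move=> [_]; rewrite invr_gt0.
have Cs : Ck 1 U1 (density G).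
  apply: (Ck_eq oU1 _ (C1_sqrt_pos oU1 Ci inv0)) => x _.
  by rewrite /density signr_mul_inv.
exists U1; split; [exact: oU1| | |exact: CG1|].
- by move=> x Ox; split; [exact: OU|exact/lorentz_det/LG].
- by move=> x /inv0; rewrite /density signr_mul_inv sqrtr_gt0.
- move=> j k; exact: (CkM oU1 Cs (CG1 j k)).
Qed.

Lemma waveop_factor G (u : 'rV[R]_n.+1 -> R) z : waveop G u z =
  (density G (space z))^-1 * \sum_j \sum_k
    partial j (fun w => density G (space w) * G (space w) j k * partial k u w) z.
Proof.
by rewrite /waveop mulr_sumr; apply: eq_bigr => j _; rewrite mulr_sumr.
Qed.

End Density.

(** * The exterior region and the difference of two solutions *)

Section Exterior.
Context {R : realType} {n m : nat}.
Variables (Omega0 : set 'rV[R]_n) (Obs : 'I_m -> set 'rV[R]_n) (Sg : set 'rV[R]_n).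
Variables (nu : 'rV[R]_n -> 'rV[R]_n) (G1 : 'rV[R]_n -> 'M[R]_n.+1).
Let Omega := remove_obstacles Omega0 Obs.
Hypothesis n_ge2 : (2 <= n)%N.
Hypothesis hOmega : obstacle_domain Omega0 Obs.
Hypotheses (hS : closed_surface Sg) (hSOmega : Sg `<=` Omega).
Hypothesis hSout : boundary Omega0 `<=` surf_ext Sg.
Hypothesis hobs : forall j, Obs j `&` surf_ext Sg = set0.
Hypothesis hnu : forall x, Sg x -> outward_normal (surf_int Sg) x (nu x).
Hypotheses (hG1 : wave_coefficients Omega G1) (hE1 : has_ergosphere Omega Sg G1).
Hypothesis hbh : black_hole Sg nu G1.

Let D := Omega `&` surf_ext Sg.

Lemma surface_closed : closed Sg.
Proof. by have [_ cS _ _] := hS; apply: compact_closed => //; exact: norm_hausdorff. Qed.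

Let oInt : open (surf_int Sg) := open_surf_int surface_closed.
Let oExt : open (surf_ext Sg) := open_surf_ext surface_closed.

Lemma surface_touches_interior x : Sg x -> closure (surf_int Sg) x.
Proof. by have [_ cS _ ch] := hS; exact: surface_in_closure_int. Qed.

Let oOmega0 : open Omega0. Proof. by have [[]] := hOmega. Qed.

Lemma exterior_no_obstacle x : surf_ext Sg x -> (Omega x <-> Omega0 x).
Proof.
move=> Ex; split=> [[]//|Ox]; split=> // -[j _ cOj].
apply: (closure_open_disjoint oExt Ex _ cOj) => y Oy Ey.
by have : (Obs j `&` surf_ext Sg) y by []; rewrite hobs.
Qed.

Let DE x : D x <-> Omega0 x /\ surf_ext Sg x.
Proof.
by split=> [[Ox Ex]|[Ox Ex]]; split=> //; have [h1 h2] := exterior_no_obstacle Ex; auto.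
Qed.

Lemma exterior_open : open D.
Proof.
rewrite (_ : D = Omega0 `&` surf_ext Sg); first exact: openI.
by apply/seteqP; split=> x /DE.
Qed.

Let cDO : closure D `<=` closure Omega.
Proof. by apply: closure_subset => x []. Qed.

Lemma boundary_outer p : boundary Omega0 p -> closure D p /\ boundary Omega p.
Proof.
move=> bp; have Ep := hSout bp; have [cp np] := bp.
have cDp : closure D p.
  apply/closureP => r r0.
  have /nbhs_rowP[r' r'0 rP] := open_nbhs_nbhs (conj oExt Ep).
  have m0 : 0 < Num.min r r' by rewrite lt_min r0.
  have /closureP/(_ _ m0)[y Oy] := cp.
  by rewrite lt_min => /andP[h /rP Ey]; exists y => //; apply/DE.
split=> //; split; first exact: cDO.
move=> /interior_subset/(exterior_no_obstacle Ep) Op; apply: np.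
exact: (open_nbhs_nbhs (conj oOmega0 Op)).
Qed.

Lemma closure_exterior_cases p : closure D p -> [\/ D p, Sg p | boundary Omega0 p].
Proof.
move=> cDp; have cOp : closure Omega0 p.
  by apply: closure_subset cDp => x /DE[].
have [Op|nOp] := pselect (Omega0 p); last first.
  by apply: Or33; split=> // /interior_subset.
have [Sp|Ip|Ep] := surf_cases Sg p.
- exact: Or32.
- by case: (closure_open_disjoint oInt Ip _ cDp) => y [_ Ey] /surf_int_ext.
- by apply: Or31; apply/DE.
Qed.

Lemma compact_closure_exterior : compact (closure D).
Proof.
apply: compact_closure; have [[_ _ [M [Mr MP]] _ _] _ _ _] := hOmega.
by exists M; split=> // K MK x /DE[Ox _]; exact: MP.
Qed.

Let b j k x := density G1 x * G1 x j k.

(** [lorentz_spatial_neg] asks for a strict sign of [Delta], which fails on the ergosphere; the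
    boundary of D is therefore reached by continuity. *)
Lemma exterior_spatial_neg x (v : 'I_n -> R) : closure D x ->
  sform (fun j k => b j k x) v v <= 0.
Proof.
have [U1 [oU1 OU1 dpos _ Cb]] := density_C1 hG1.
move=> cDx; have Ux := OU1 _ (cDO cDx).
apply: (@le0_on_closure _ _ D (fun x => sform (fun j k => b j k x) v v) x) => //.
  apply: (@cvg_sum_R _ _ _ (nbhs x)) => j _; apply: (@cvg_sum_R _ _ _ (nbhs x)) => k _.
  apply: cvgMr_tmp; apply: cvgMr_tmp; exact: (Ck_continuous (Cb _ _) Ux).
move=> y Dy; have cOy : closure Omega y by apply: cDO; exact: subset_closure.
have [_ _ LG _] := hG1; have [_ hext _] := hE1.
have h := lorentz_spatial_neg (\row_i v i) (LG y cOy) (hext y cOy Dy.2).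
rewrite /sform.
have -> : \sum_j \sum_k b (lift ord0 j) (lift ord0 k) y * v j * v k =
  density G1 y * \sum_j \sum_k G1 y (lift ord0 j) (lift ord0 k) *
     (\row_i v i) ord0 j * (\row_i v i) ord0 k.
  rewrite mulr_sumr; apply: eq_bigr => j _; rewrite mulr_sumr; apply: eq_bigr => k _.
  by rewrite !mxE /b; ring.
by rewrite pmulr_rle0//; exact/dpos/OU1.
Qed.

Section Difference.
Variables (G2 : 'rV[R]_n -> 'M[R]_n.+1) (f u1 u2 : 'rV[R]_n.+1 -> R).
Hypothesis hG12 : forall x, D x -> G1 x = G2 x.
Hypotheses (h1 : ibvp_solution Omega G1 f u1) (h2 : ibvp_solution Omega G2 f u2).

Let u z := u1 z - u2 z.
Let a j k (z : 'rV[R]_n.+1) := b j k (space z).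

(** Where the coefficients agree the densities agree too, and D is open, so the derivatives do as
    well. After division by the nonzero prefactor both solutions obey the same linear equation in
    divergence form. *)
Lemma difference_eqn z : cylinder D z ->
  \sum_j \sum_k partial j (fun w => a j k w * partial k u w) z = 0.
Proof.
move=> Dz; have oC := open_cylinder exterior_open.
have [U1 [oU1 OU1 dpos _ Cb]] := density_C1 hG1.
have DO y : cylinder D y -> cylinder (closure Omega) y.
  by move=> [Oy _]; exact: subset_closure.
have [[W1 [oW1 W1O] C1] e1 _ _] := h1; have [[W2 [oW2 W2O] C2] e2 _ _] := h2.
have Cu1 : Ck 2 (cylinder D) u1 by apply: Ck_sub C1 => y /DO/W1O.
have Cu2 : Ck 2 (cylinder D) u2 by apply: Ck_sub C2 => y /DO/W2O.
have Ca j k : Ck 1 (cylinder D) (a j k).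
  by apply: Ck_sub (Ck_space oU1 (Cb j k)) => y /DO/OU1.
have eq1 : \sum_j \sum_k partial j (fun w => a j k w * partial k u1 w) z = 0.
  have := e1 z Dz.1; rewrite waveop_factor => /eqP; rewrite mulf_eq0 invr_eq0.
  by rewrite gt_eqF/= => [/eqP//|]; exact/dpos/OU1/DO.
have eq2 : \sum_j \sum_k partial j (fun w => a j k w * partial k u2 w) z = 0.
  have : \sum_j \sum_k partial j (fun w => density G2 (space w) * G2 (space w) j k
      * partial k u2 w) z = 0.
    have := e2 z Dz.1; rewrite waveop_factor => /eqP; rewrite mulf_eq0 invr_eq0.
    rewrite gt_eqF/= => [/eqP//|].
    by rewrite /density -hG12//; exact/dpos/OU1/DO.
  move=> E0; rewrite -[RHS]E0; apply: eq_bigr => j _; apply: eq_bigr => k _.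
  apply: (partial_eq _ oC _ Dz) => y Dy.
  by rewrite /a /b /density hG12.
transitivity ((\sum_j \sum_k partial j (fun w => a j k w * partial k u1 w) z) -
  \sum_j \sum_k partial j (fun w => a j k w * partial k u2 w) z); last first.
  exact: etrans (congr2 (fun x y => x - y) eq1 eq2) (subr0 0).
rewrite -sumrB; apply: eq_bigr => j _.
rewrite -sumrB; apply: eq_bigr => k _.
have t1 := CkM oC (Ca j k) (Ck_partial k Cu1).
have t2 := CkM oC (Ca j k) (Ck_partial k Cu2).
have E : partial j (fun w => a j k w * partial k u w) z =
   partial j (fun w => a j k w * partial k u1 w + -1 * (a j k w * partial k u2 w)) z.
  apply: (partial_eq _ oC _ Dz) => y Dy.
  have -> : partial k u y = partial k u1 y + partial k (fun y => -1 * u2 y) y.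
    rewrite -partialD; last 2 first.
    - exact: (Ck_derivable Cu1 Dy).
    - exact: (Ck_derivable (CkZ _ oC Cu2) Dy).
    by apply: (partial_eq _ oC _ Dy) => w _; rewrite mulN1r.
  by rewrite partialZ; [ring|exact: (Ck_derivable Cu2 Dy)].
rewrite E partialD; [|exact: (Ck_derivable t1 Dz)|exact: (Ck_derivable (CkZ _ oC t2) Dz)].
by rewrite partialZ ?mulN1r//; exact: (Ck_derivable t2 Dz).
Qed.

Lemma difference_smooth :
  exists2 W, open W /\ cylinder (closure D) `<=` W & Ck 2 W u.
Proof.
have [[W1 [oW1 W1O] C1] _ _ _] := h1; have [[W2 [oW2 W2O] C2] _ _ _] := h2.
have oW : open (W1 `&` W2) := openI oW1 oW2.
exists (W1 `&` W2).
  by split=> // z Dz; split; [apply: W1O|apply: W2O]; exact: cDO.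
apply: (CkB oW); [apply: Ck_sub C1|apply: Ck_sub C2]; by move=> z [].
Qed.

Lemma exterior_sym j k x : closure D x -> b j k x = b k j x.
Proof.
move=> /cDO cx; have [_ sG _ _] := hG1.
by rewrite /b -[in LHS](sG x cx) mxE.
Qed.

Lemma exterior_pos x : closure D x -> 0 < b ord0 ord0 x.
Proof.
move=> /cDO cx; have [_ _ _ pG] := hG1; have [U1 [_ OU1 dpos _ _]] := density_C1 hG1.
by rewrite mulr_gt0//; [exact/dpos/OU1|exact: pG].
Qed.

Lemma grad_partial (g : 'rV[R]_n -> R) x : grad g x <> 0 -> exists i, partial i g x != 0.
Proof.
move=> gx; apply: contrapT => h; apply: gx; apply/rowP => i; rewrite !mxE.
by apply/eqP/negPn/negP => gi; apply: h; exists i.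
Qed.

(* Inflow is excluded on the ergosphere by the characteristic conditions of
   [black_hole], and on the outer boundary by u = 0. *)
Lemma tame_surface p : Sg p -> closure D p -> tame_boundary D b u p.
Proof.
move=> Sp cDp; have [_ [U [g [Up dg gp]]]] := hnu Sp.
have [oU Sg_ ng Ug] := dg.
have [U1 [oU1 OU1 dpos _ Cb]] := density_C1 hG1.
have [W [oW DW] Cu] := difference_smooth.
have UP := defining_int_ext surface_closed surface_touches_interior dg.
have Cg B k : B `<=` U -> Ck k B g by move=> BU; apply: Ck_sub (Sg_ k).
have BU : U `&` Omega0 `<=` U by move=> x [].
apply: (tame_of_flux exterior_open oU1 (fun x h => OU1 x (cDO h)) Cb oW DW Cu
  (B := U `&` Omega0) (f := g) cDp (openI oU oOmega0)).
- by split=> //; have [] := hSOmega Sp.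
- exact: Cg.
- move=> x [Ux Ox]; rewrite -(UP x Ux).2; split=> [/DE[]//|Ex].
  by apply/DE; split.
- exact/grad_partial/ng.
move=> z [Uz Oz] cDz gz; set x := space z in Uz Oz cDz gz.
have Sx : Sg x by apply/(UP x Uz).1.
have [bh1 bh2] := hbh Sx.
(* The normal at x comes with its own defining function h; as the gradients of g and h are
   positively proportional, that of g is a positive multiple of [nu x]. *)
have [_ [V [h [Vx [oV Sh nh Vh] [c' c'0 hx]]]]] := hnu Sx.
have [||c c0 gh] := defining_gradients oU oV (Sg_ 1%N) (Sh 1%N) Uz Vx gz _ (ng x Uz) (nh x Vx).
- by apply/(defining_int_ext surface_closed surface_touches_interior (And4 oV Sh nh Vh) Vx).1.
- by move=> y Uy Vy; split=> hy; [apply/(Vh y Vy)/(Ug y Uy)|apply/(Ug y Uy)/(Vh y Vy)].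
have gE j : partial j g x = (c * c') * nu x ord0 j.
  have := congr1 (fun v : 'rV[R]_n => v ord0 j) gh.
  by rewrite /= hx !mxE mulrA.
have d0 : 0 < density G1 x by apply/dpos/OU1/cDO.
rewrite (eq_bigr (fun j => partial j g x * (partial ord0 u z *
   \sum_k b (lift ord0 j) k x * partial k u z))); last first.
  by move=> j _; rewrite /current /= subr0.
apply: (@current_boundary R n (fun j k => b j k x) (fun k => partial k u z)
  (fun j k => exterior_sym j k cDz) (fun w => exterior_spatial_neg w cDz)
  (fun j => partial j g x)).
- rewrite /sform -[RHS](mulr0 (density G1 x * (c * c') ^+ 2)) -[X in _ = _ * X]bh1.
  rewrite /spatial_form mulr_sumr; apply: eq_bigr => j _; rewrite mulr_sumr.
  by apply: eq_bigr => k _; rewrite !gE /b; ring.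
rewrite (eq_bigr (fun j => (density G1 x * (c * c')) *
   (G1 x (lift ord0 j) ord0 * nu x ord0 j))); last first.
  by move=> j _; rewrite gE /b; ring.
by rewrite -mulr_sumr pmulr_rle0 ?(ltW bh2)// !mulr_gt0.
Qed.

(** No regularity of v is asked for: the difference quotient in time is identically zero. *)
Lemma static_partial0 (v : 'rV[R]_n.+1 -> R) z :
  (forall t, v (event t (space z)) = 0) -> partial ord0 v z = 0.
Proof.
move=> v0.
have v0' y : space y = space z -> v y = 0 by move=> yz; rewrite -(event_eta y) yz.
rewrite /partial /derive [X in lim (X @ _)](_ : _ = fun=> (0 : R)).
  exact: (@lim_cst R^o).
apply/funext => h /=; rewrite (v0' z)// (v0' (_ + _)) ?subr0 ?scaler0//.
by apply/rowP => i; rewrite !spaceE !mxE /= mulr0 add0r.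
Qed.

Lemma tame_outer p : boundary Omega0 p -> tame_boundary D b u p.
Proof.
move=> bp; have [cDp bOp] := boundary_outer bp.
have [[_ _ _ _ smo] _ _ _] := hOmega.
have [U [g [Up [oU Sg_ ng Ug]]]] := smo p bp.
have [U1 [oU1 OU1 dpos _ Cb]] := density_C1 hG1.
have [W [oW DW] Cu] := difference_smooth.
have Ep := hSout bp.
have oB := openI oU oExt.
have CgB k : Ck k (U `&` surf_ext Sg) g by apply: Ck_sub (Sg_ k); move=> x [].
have Cmg k : Ck k (U `&` surf_ext Sg) (fun x => - g x) by exact: CkN.
have Dg x : (U `&` surf_ext Sg) x -> (D x <-> 0 < - g x).
  move=> [Ux Ex]; rewrite oppr_gt0 -(Ug x Ux); split=> [/DE[]//|Ox].
  by apply/DE; split.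
apply: (tame_of_flux exterior_open oU1 (fun x h => OU1 x (cDO h)) Cb oW DW Cu
  (B := U `&` surf_ext Sg) (f := fun x => - g x) cDp oB).
- by split.
- exact: Cmg.
- exact: Dg.
- apply: grad_partial; rewrite (gradN oU (Sg_ 1%N) Up) => /eqP.
  by rewrite oppr_eq0 => /eqP; exact: ng.
move=> z [Uz Ez] cDz gz; set x := space z in Uz Ez cDz gz.
have bx : boundary Omega0 x.
  have [Dx|Sx|//] := closure_exterior_cases cDz.
    by move: Dx => /(Dg x (conj Uz Ez)); rewrite gz ltxx.
  by case: Ez.
have u0 : partial ord0 u z = 0.
  apply: static_partial0 => t; have [_ bO] := boundary_outer bx.
  have [_ _ _ e1] := h1; have [_ _ _ e2] := h2.
  have bc : cylinder (boundary Omega) (event t x) by rewrite /cylinder /= space_event.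
  exact: etrans (congr2 (fun x y => x - y) (e1 _ bc) (e2 _ bc)) (subrr _).
rewrite big1// => j _; rewrite /current u0 mul0r /= subr0 mulr0//.
Qed.

Lemma exterior_unique z : cylinder D z -> u1 z = u2 z.
Proof.
move=> Dz; apply/eqP; rewrite -subr_eq0; apply/eqP.
have [U1 [oU1 OU1 dpos _ Cb]] := density_C1 hG1.
have [W [oW DW] Cu] := difference_smooth.
change (u z = 0); refine (energy_uniqueness exterior_open compact_closure_exterior oU1
  (fun x h => OU1 x (cDO h)) Cb exterior_sym exterior_pos (fun x h v => exterior_spatial_neg v h)
  oW DW Cu difference_eqn _ _ Dz).
- move=> p cDp; have [Dp|Sp|bp] := closure_exterior_cases cDp.
  + exact: (tame_interior _ _ exterior_open Dp).
  + exact: tame_surface.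
  + exact: tame_outer.
have [_ _ [T1 q1] _] := h1; have [_ _ [T2 q2] _] := h2.
exists (Num.min T1 T2) => y Dy; rewrite lt_min => /andP[y1 y2].
exact: etrans (congr2 (fun x y => x - y) (q1 _ Dy.1 y1) (q2 _ Dy.1 y2)) (subrr 0).
Qed.

(** Only coefficients and first derivatives enter, all continuous up to the outer boundary, so both
    sides agree as limits from D. *)
Lemma exterior_conormal (N : 'rV[R]_n -> 'rV[R]_n) z :
  wave_coefficients Omega G2 -> cylinder (boundary Omega0) z ->
  conormal N G1 u1 z = conormal N G2 u2 z.
Proof.
move=> hG2 bz; have [cDx bOx] := boundary_outer bz.
have cDz : closure (cylinder D : set 'rV[R]_n.+1) z.
  apply/closureP => r r0; have /closureP/(_ _ r0)[y Dy zy] := cDx.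
  exists (event (time z) y); first by rewrite /cylinder /= space_event.
  by rewrite -{1}(event_eta z); apply: norm_event_lt; rewrite ?subrr ?normr0.
have [[W1 [oW1 W1O] C1] _ _ _] := h1; have [[W2 [oW2 W2O] C2] _ _ _] := h2.
have GE j k : G1 (space z) j k = G2 (space z) j k.
  have [[V1 [oV1 V1O] S1] _ _ _] := hG1; have [[V2 [oV2 V2O] S2] _ _ _] := hG2.
  apply: (eq_on_closure (f := fun x => G1 x j k) (g := fun x => G2 x j k) _ _ _ cDx).
  - exact: (Ck_continuous (S1 j k 0%N) (V1O _ (cDO cDx))).
  - exact: (Ck_continuous (S2 j k 0%N) (V2O _ (cDO cDx))).
  - by move=> y Dy; rewrite hG12.
have pE j : partial j u1 z = partial j u2 z.
  apply: (eq_on_closure (f := partial j u1) (g := partial j u2) _ _ _ cDz).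
  - exact: (Ck_continuous (Ck_partial j C1) (W1O _ (cDO cDx))).
  - exact: (Ck_continuous (Ck_partial j C2) (W2O _ (cDO cDx))).
  - move=> y Dy.
    exact: (partial_eq j (@open_cylinder _ _ _ exterior_open) exterior_unique Dy).
rewrite /conormal /spatial_form; apply: eq_bigr => j _; apply: eq_bigr => k _.
rewrite GE pE; congr (_ * (Num.sqrt (- _))^-1).
by apply: eq_bigr => i _; apply: eq_bigr => l _; rewrite GE.
Qed.

End Difference.

(** [DtN] evaluates a chosen solution. For solvable data the choice is a genuine solution and not
    the default [fun=> 0], and [exterior_conormal] holds for any pair of solutions. *)
Lemma exterior_DtN N G2 f z : wave_coefficients Omega G2 ->
  (forall x, D x -> G1 x = G2 x) ->
  solvable_data Omega G1 f -> solvable_data Omega G2 f ->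
  cylinder (boundary Omega0) z -> DtN N Omega G1 f z = DtN N Omega G2 f z.
Proof.
move=> hG2 hG12 [_ s1] [_ s2] bz.
have h1 := xgetPex (fun=> 0) s1; have h2 := xgetPex (fun=> 0) s2.
exact: (exterior_conormal hG12 h1 h2 N hG2 bz).
Qed.

End Exterior.

(** * Time shifts *)

Section TimeShift.
Context {R : realType} {n : nat}.
Implicit Types (x : 'rV[R]_n) (z : 'rV[R]_n.+1) (G : 'rV[R]_n -> 'M[R]_n.+1).
Implicit Types (a : 'rV[R]_n -> R) (u : 'rV[R]_n.+1 -> R).

(* In the coordinates (x_0 - a(x), x_1, ..., x_n) the coefficient matrix G
   becomes [time_shift a G], and u becomes [u \o delay a]. *)
Definition shear a x : 'M[R]_n.+1 :=
  1%:M - (delta_mx ord0 ord0 : 'cV[R]_n.+1) *m no_time (grad a x).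

Definition time_shift a G x : 'M[R]_n.+1 := shear a x *m G x *m (shear a x)^T.

Definition delay a z : 'rV[R]_n.+1 := event (time z + a (space z)) (space z).

Lemma no_time0 (v : 'rV[R]_n) : no_time v ord0 ord0 = 0.
Proof. by rewrite mxE unlift_none. Qed.

Lemma no_timeS (v : 'rV[R]_n) i : no_time v ord0 (lift ord0 i) = v ord0 i.
Proof. by rewrite mxE liftK. Qed.

Lemma shearE a x j k :
  shear a x j k = (j == k)%:R - (j == ord0)%:R * no_time (grad a x) ord0 k.
Proof. by rewrite !mxE big_ord1 !mxE eqxx andbT. Qed.

Lemma shear_flat a x : grad a x = 0 -> shear a x = 1%:M.
Proof.
move=> ga; apply/matrixP => j k; rewrite shearE ga !mxE.
by case: unlift => [i|]; rewrite ?mxE mulr0 subr0.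
Qed.

(** Only row 0 differs from the identity, and its diagonal entry is 1. The value 1 is what keeps
    [density] unchanged. *)
Lemma det_shear a x : \det (shear a x) = 1.
Proof.
rewrite -det_tr det_trig; last first.
  apply/is_trig_mxP => i j ij; rewrite mxE shearE.
  have /negPf-> : j != i by rewrite gt_eqF.
  have /negPf-> : j != ord0 by rewrite -(inj_eq val_inj) -lt0n (leq_ltn_trans _ ij).
  by rewrite mul0r subr0.
apply: big1 => i _; rewrite mxE shearE eqxx.
by have [->|] := eqVneq i ord0; rewrite ?no_time0 ?mulr0 ?mul0r subr0.
Qed.

Lemma det_time_shift a G x : \det (time_shift a G x) = \det (G x).
Proof. by rewrite /time_shift !det_mulmx det_tr det_shear mul1r mulr1. Qed.

Lemma density_time_shift a G x : density (time_shift a G) x = density G x.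
Proof. by rewrite /density det_time_shift. Qed.

Lemma time_shift_flat a G x : grad a x = 0 -> time_shift a G x = G x.
Proof. by move=> ga; rewrite /time_shift shear_flat// trmx1 mul1mx mulmx1. Qed.

Lemma time_shiftE a G x j k : time_shift a G x j k =
  \sum_p \sum_q shear a x j p * G x p q * shear a x k q.
Proof.
rewrite /time_shift mxE exchange_big/=; apply: eq_bigr => q _.
by rewrite !mxE mulr_suml.
Qed.

Lemma sum_shear a x j (X : 'I_n.+1 -> R) : \sum_p shear a x j p * X p =
  X j - (j == ord0)%:R * \sum_p no_time (grad a x) ord0 p * X p.
Proof.
rewrite (eq_bigr (fun p => (j == p)%:R * X p -
  (j == ord0)%:R * (no_time (grad a x) ord0 p * X p))); last first.
  by move=> p _; rewrite shearE; ring.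
rewrite sumrB -mulr_sumr; congr (_ - _).
rewrite (bigD1 j)//= eqxx mul1r big1 ?addr0// => p pj.
by rewrite eq_sym (negbTE pj) mul0r.
Qed.

Lemma sum_shear_tr a x k (X : 'I_n.+1 -> R) : \sum_p shear a x p k * X p =
  X k - no_time (grad a x) ord0 k * X ord0.
Proof.
rewrite (eq_bigr (fun p => (p == k)%:R * X p -
  (p == ord0)%:R * (no_time (grad a x) ord0 k * X p))); last first.
  by move=> p _; rewrite shearE; ring.
rewrite sumrB; congr (_ - _).
  by rewrite (bigD1 k)//= eqxx mul1r big1 ?addr0// => p /negPf->; rewrite mul0r.
by rewrite (bigD1 ord0)//= mul1r big1 ?addr0// => p /negPf->; rewrite mul0r.
Qed.

(** The product of the column and the row has square 0, because the row has no time component. *)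
Lemma shearN a x : Ck 1 setT a -> shear (fun y => - a y) x *m shear a x = 1%:M.
Proof.
move=> Ca; rewrite /shear (gradN openT Ca I).
have -> : no_time (- grad a x) = - no_time (grad a x).
  by apply/rowP => k; rewrite !mxE; case: unlift => [i|]; rewrite ?mxE ?oppr0.
set c := delta_mx _ _; set r := no_time _.
have rc : r *m c = 0.
  apply/matrixP => i j; rewrite !mxE big_ord_recl big1 => [|k _]; last first.
    by rewrite !mxE /= mulr0.
  by rewrite ord1 no_time0 mul0r addr0.
rewrite mulmxN opprK mulmxBr mulmx1 mulmxDl mul1mx.
by rewrite mulmxA -(mulmxA c) rc mulmx0 mul0mx addr0 addrK.
Qed.

Lemma shear_unit a x : shear a x \in unitmx.
Proof. by rewrite unitmxE det_shear unitr1. Qed.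

Lemma time_shiftK a G x : Ck 1 setT a ->
  time_shift (fun y => - a y) (time_shift a G) x = G x.
Proof.
move=> Ca; rewrite /time_shift !mulmxA shearN// mul1mx -mulmxA -trmx_mul.
by rewrite shearN// trmx1 mulmx1.
Qed.

Lemma space_delay a z : space (delay a z) = space z.
Proof. exact: space_event. Qed.

Lemma delayE a z j : delay a z ord0 j = z ord0 j + (j == ord0)%:R * a (space z).
Proof.
rewrite mxE; case: (unliftP ord0 j) => [i ->|->]; first by rewrite spaceE mul0r addr0.
by rewrite mul1r.
Qed.

Section Smooth.
Variable a : 'rV[R]_n -> R.
Hypothesis Ca : smooth setT a.
Let oT : open [set: 'rV[R]_n.+1] := openT.

Lemma Ck_a_space k : Ck k setT (fun z => a (space z)).
Proof. exact: (Ck_space openT (Ca k)). Qed.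

Lemma Ck_delay k j : Ck k setT (fun z => delay a z ord0 j).
Proof.
apply: (Ck_eq oT (fun z _ => esym (delayE a z j))).
exact: (CkD oT (Ck_coord k j oT) (CkZ _ oT (Ck_a_space k))).
Qed.

Lemma partial_space i z :
  partial i (fun y => a (space y)) z = no_time (grad a (space z)) ord0 i.
Proof.
case: (unliftP ord0 i) => [j ->|->].
  by rewrite (partialS_space j openT (Ca 1%N))// no_timeS mxE.
by rewrite (partial0_space openT (Ca 1%N))// no_time0.
Qed.

Lemma Ck_slope k p : Ck k setT (fun x => no_time (grad a x) ord0 p).
Proof.
case: (unliftP ord0 p) => [j ->|->].
  apply: (@Ck_eq _ _ _ _ (partial j a)) (Ck_partial j (Ca k.+1)); first exact: openT.
  by move=> x _; rewrite no_timeS mxE.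
apply: (@Ck_eq _ _ _ _ (fun=> 0)) (Ck_cst _ _ _); first exact: openT.
by move=> x _; rewrite no_time0.
Qed.

Lemma Ck_shear k j p : Ck k setT (fun x => shear a x j p).
Proof.
apply: (Ck_eq openT (fun x _ => esym (shearE a x j p))).
apply: (CkB openT); first exact: Ck_cst.
exact: (CkZ _ openT (Ck_slope k p)).
Qed.

Lemma Ck_time_shift k U G (c : 'rV[R]_n -> R) : open U ->
  (forall p q, Ck k U (fun x => c x * G x p q)) ->
  forall p q, Ck k U (fun x => c x * time_shift a G x p q).
Proof.
move=> oU CG i j.
have CM p q : Ck k U (fun x => shear a x p q) by apply: Ck_sub (Ck_shear k p q).
apply: (@Ck_eq _ _ _ _ (fun x => \sum_p \sum_q shear a x i p * (c x * G x p q) * shear a x j q)).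
- exact: oU.
- move=> x _; rewrite time_shiftE mulr_sumr; apply: eq_bigr => p _.
  by rewrite mulr_sumr; apply: eq_bigr => q _; ring.
apply: (Ck_sum _ oU) => p _; apply: (Ck_sum _ oU) => q _.
exact: (CkM oU (CkM oU (CM i p) (CG p q)) (CM j q)).
Qed.

Lemma partial_delay V u z i : open V -> Ck 1 V u -> V (delay a z) ->
  partial i (fun y => u (delay a y)) z =
  partial i u (delay a z) + no_time (grad a (space z)) ord0 i * partial ord0 u (delay a z).
Proof.
move=> oV Cu Vz.
rewrite {1}/partial (@derive_val _ _ _ _ _ _ _
  (chain_derive (delta_mx ord0 i) oT oV Cu (Ck_delay 1%N) I Vz)).
have dE j : 'D_(delta_mx ord0 i) (fun y => delay a y ord0 j) z =
    (i == j)%:R + (j == ord0)%:R * no_time (grad a (space z)) ord0 i.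
  rewrite -[LHS]/(partial i (fun y => delay a y ord0 j) z).
  rewrite (partial_eq i oT (fun y _ => delayE a y j) I) partialD.
  - rewrite partial_coord partialZ ?partial_space//.
    exact: (Ck_derivable (Ck_a_space 1%N) I).
  - exact: (Ck_derivable (Ck_coord 1%N j oT) I).
  - exact: (Ck_derivable (CkZ _ oT (Ck_a_space 1%N)) I).
rewrite (eq_bigr (fun j => (i == j)%:R * partial j u (delay a z) +
   (j == ord0)%:R * (no_time (grad a (space z)) ord0 i * partial j u (delay a z)))).
  rewrite big_split/=; congr (_ + _).
    rewrite (bigD1 i)//= eqxx mul1r big1 ?addr0// => p pi.
    by rewrite eq_sym (negbTE pi) mul0r.
  by rewrite (bigD1 ord0)//= mul1r big1 ?addr0// => p /negPf->; rewrite mul0r.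
by move=> j _; rewrite dE; ring.
Qed.

Lemma Ck_delayed k V u : open V -> Ck k V u ->
  Ck k [set z | V (delay a z)] (fun z => u (delay a z)).
Proof.
move=> oV Cu.
have oP : open [set z | V (delay a z)].
  have : open (delay a @^-1` V); last by [].
  apply: open_comp => // z _.
  by apply: row_continuous => j; exact: (Ck_continuous (Ck_delay 0%N j) I).
by apply: (Ck_comp oP oV _ Cu) => // j; apply: Ck_sub (Ck_delay k j).
Qed.

Variables (Omega : set 'rV[R]_n) (G : 'rV[R]_n -> 'M[R]_n.+1).
Hypotheses (oOmega : open Omega) (hG : wave_coefficients Omega G).

Let V : set 'rV[R]_n.+1 := cylinder Omega.
Let oV : open V := @open_cylinder _ _ _ oOmega.
Let b j k x := density G x * G x j k.

Let Cb j k : Ck 1 Omega (b j k).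
Proof.
have [U1 [oU1 OU1 _ _ CU]] := density_C1 hG.
by apply: Ck_sub (CU j k) => x /subset_closure/OU1.
Qed.

Let Cbs j k : Ck 1 V (fun z => b j k (space z)).
Proof. exact: (Ck_space oOmega (Cb j k)). Qed.

(** Differentiating [w j (delay a y)] along axis j produces an extra time derivative of [w j] with
    the factor [r j]. Summed over j, these terms cancel against the time derivative of the
    correction [S] that the shear puts into row 0; as [r] is static, no further term appears. *)
Lemma waveop_time_shift u z : Ck 2 V u -> cylinder Omega z ->
  waveop (time_shift a G) (fun y => u (delay a y)) z = waveop G u (delay a z).
Proof.
move=> Cu Vz.
have Vd y : V y -> V (delay a y) by rewrite /V /cylinder /= space_delay.
pose w p := momentum (fun j k y => b j k (space y)) u p.
have Cw p : Ck 1 V (w p).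
  by apply: (Ck_sum _ oV) => k _; exact: (CkM oV (Cbs p k) (Ck_partial k Cu)).
have Cud : Ck 2 V (fun y => u (delay a y)) by apply: Ck_sub (Ck_delayed oV Cu).
have Cwd p : Ck 1 V (fun y => w p (delay a y)).
  by apply: Ck_sub (Ck_delayed oV (Cw p)).
pose r p y := no_time (grad a (space y)) ord0 p.
have Cr p : Ck 1 V (r p) by apply: Ck_sub (Ck_space openT (Ck_slope 1%N p)).
have Crw p : Ck 1 V (fun y => r p y * w p (delay a y)) := CkM oV (Cr p) (Cwd p).
pose S y := \sum_p r p y * w p (delay a y).
have CS : Ck 1 V S by apply: (Ck_sum _ oV) => p _; exact: Crw.
have shifted j y : V y ->
    \sum_k density (time_shift a G) (space y) * time_shift a G (space y) j k *
      partial k (fun y => u (delay a y)) y =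
    w j (delay a y) + - (j == ord0)%:R * S y.
  move=> Vy; rewrite mulNr -(sum_shear a (space y) j (fun p => w p (delay a y))).
  transitivity (\sum_p shear a (space y) j p * \sum_q b p q (space y) *
     \sum_k shear a (space y) k q * partial k (fun y => u (delay a y)) y).
    rewrite (eq_bigr (fun k => \sum_p \sum_q shear a (space y) j p * (b p q (space y) *
      (shear a (space y) k q * partial k (fun y => u (delay a y)) y)))).
      rewrite exchange_big/=; apply: eq_bigr => p _; rewrite exchange_big/= mulr_sumr.
      by apply: eq_bigr => q _; rewrite -!mulr_sumr.
    move=> k _; rewrite density_time_shift time_shiftE mulr_sumr mulr_suml.
    apply: eq_bigr => p _; rewrite mulr_sumr mulr_suml; apply: eq_bigr => q _.
    by rewrite /b; ring.
  apply: eq_bigr => p _; congr (_ * _); rewrite /w /momentum.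
  apply: eq_bigr => q _; rewrite space_delay; congr (_ * _).
  rewrite sum_shear_tr.
  have C1 : Ck 1 V u := CkW Cu.
  rewrite (partial_delay q oV C1 (Vd _ Vy)) (partial_delay ord0 oV C1 (Vd _ Vy)).
  by rewrite no_time0; ring.
have rho : (density (time_shift a G) (space z))^-1 = (density G (space (delay a z)))^-1.
  by rewrite space_delay density_time_shift.
apply: etrans (waveop_factor _ _ _) (etrans _ (esym (waveop_factor _ _ _))).
refine (congr2 (fun s t : R => s * t) rho _).
transitivity (\sum_j partial j (fun y => w j (delay a y) + - (j == ord0)%:R * S y) z).
  apply: eq_bigr => j _.
  have Ct k : Ck 1 V (fun y => density (time_shift a G) (space y) *
      time_shift a G (space y) j k * partial k (fun y => u (delay a y)) y).
    apply: (CkM oV) (Ck_partial k Cud).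
    apply: (@Ck_eq _ _ _ _ (fun y => density G (space y) * time_shift a G (space y) j k)).
    - exact: oV.
    - by move=> y _; rewrite density_time_shift.
    exact: (Ck_space oOmega (Ck_time_shift oOmega Cb j k)).
  by rewrite -(partial_sum _ j oV Ct Vz); exact: (partial_eq j oV (shifted j) Vz).
transitivity (\sum_j partial j (w j) (delay a z)); last first.
  apply: eq_bigr => j _.
  exact: (partial_sum _ j oV (fun k => CkM oV (Cbs j k) (Ck_partial k Cu)) (Vd _ Vz)).
have dS : partial ord0 S z = \sum_p r p z * partial ord0 (w p) (delay a z).
  rewrite (partial_sum _ ord0 oV Crw Vz); apply: eq_bigr => p _.
  rewrite partialM; [|exact: (Ck_derivable (Cr p) Vz)|exact: (Ck_derivable (Cwd p) Vz)].
  rewrite (partial0_space openT (Ck_slope 1%N p))// mul0r add0r.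
  by rewrite (partial_delay ord0 oV (Cw p) (Vd _ Vz)) no_time0 mul0r addr0.
transitivity (\sum_j (partial j (fun y => w j (delay a y)) z +
   - (j == ord0)%:R * partial j S z)).
  apply: eq_bigr => j _; rewrite partialD.
  - by rewrite partialZ//; exact: (Ck_derivable CS Vz).
  - exact: (Ck_derivable (Cwd j) Vz).
  - exact: (Ck_derivable (CkZ _ oV CS) Vz).
have sS : \sum_j - (j == ord0)%:R * partial j S z = - partial ord0 S z.
  rewrite (bigD1 ord0)//= mulN1r big1 ?addr0// => p /negPf->.
  by rewrite oppr0 mul0r.
rewrite big_split/= sS dS -sumrN -big_split/=; apply: eq_bigr => j _.
by rewrite (partial_delay j oV (Cw j) (Vd _ Vz)) addrK.
Qed.

Lemma ibvp_time_shift (A : R) f u :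
  (forall x, `|a x| <= A) -> (forall x, boundary Omega x -> a x = 0) ->
  ibvp_solution Omega G f u ->
  ibvp_solution Omega (time_shift a G) f (fun z => u (delay a z)).
Proof.
move=> aA a0 [[W [oW WO] Cu] eqn [T qT] bu]; split.
- exists [set z | W (delay a z)]; last exact: Ck_delayed.
  split; last by move=> z Oz; apply: WO; rewrite /cylinder /= space_delay.
  have : open (delay a @^-1` W); last by [].
  apply: open_comp => // z _.
  by apply: row_continuous => j; exact: (Ck_continuous (Ck_delay 0%N j) I).
- move=> z Oz; rewrite waveop_time_shift//.
    by apply: eqn; rewrite /cylinder /= space_delay.
  by apply: Ck_sub Cu => y Oy; apply: WO; exact: subset_closure.
(* The shift changes times by at most A. *)
- exists (T - A) => z Oz zT; apply: qT; first by rewrite /cylinder /= space_delay.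
  rewrite time_event; have := aA (space z); rewrite ler_norml; lra.
- move=> z bz; rewrite -bu//; congr u.
  by rewrite /delay a0// addr0 event_eta.
Qed.

End Smooth.
End TimeShift.

(** * Smooth bump functions *)

Section Bump.
Context {R : realType}.

(** The powers of the inverse make the family stable under differentiation, so the smoothness of
    [expR (- s^-1)] extended by 0 is one induction over all k. *)
Definition flat (k : nat) (s : R) : R := if 0 < s then s^-1 ^+ k * expR (- s^-1) else 0.

Lemma flat_le0 k (s : R) : s <= 0 -> flat k s = 0.
Proof. by rewrite /flat ltNge => ->. Qed.

Lemma flat_gt0 k (s : R) : 0 < s -> 0 < flat k s.
Proof. by rewrite /flat => s0; rewrite s0 mulr_gt0 ?exprn_gt0 ?invr_gt0 ?expR_gt0. Qed.

(** The term of degree [k.+2] of the exponential series beats the power and leaves a factor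
    [s ^+ 2], enough for the derivative at 0. *)
Lemma flat_le k (s : R) : `|flat k s| <= (k.+2)`!%:R * s ^+ 2.
Proof.
have [s0|s0] := leP s 0; first by rewrite flat_le0// normr0 mulr_ge0// sqr_ge0.
rewrite ger0_norm ?(ltW (flat_gt0 k s0))// /flat s0.
have := expR_ge1Dxn k.+1 (ltW (_ : 0 < s^-1)); rewrite invr_gt0 => /(_ s0) h.
rewrite expRN.
have f0 : 0 < (k.+2)`!%:R :> R by rewrite ltr0n fact_gt0.
have y0 : 0 < s^-1 by rewrite invr_gt0.
have h2 : s^-1 ^+ k.+2 <= (k.+2)`!%:R * expR s^-1.
  by rewrite mulrC -ler_pdivrMr//; apply: le_trans h; rewrite lerDr.
rewrite ler_pdivrMr ?expR_gt0//.
have -> : s^-1 ^+ k = s^-1 ^+ k.+2 * s ^+ 2.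
  by rewrite exprSr exprSr; field; rewrite gt_eqF.
by rewrite [leRHS]mulrAC ler_wpM2r ?sqr_ge0.
Qed.

Lemma flat_le1 (s : R) : `|flat 0 s| <= 1.
Proof.
have [s0|s0] := leP s 0; first by rewrite flat_le0// normr0.
rewrite ger0_norm ?(ltW (flat_gt0 0 s0))// /flat s0 expr0 mul1r expR_le1.
by rewrite oppr_le0 invr_ge0 ltW.
Qed.

Lemma is_derive0_quadratic (f : R -> R) (C : R) : (forall s, `|f s| <= C * s ^+ 2) ->
  is_derive (0 : R) 1 f 0.
Proof.
move=> fC; have f0 : f 0 = 0.
  by apply/eqP; rewrite -normr_le0; have := fC 0; rewrite expr0n mulr0.
have C0 : 0 <= C by have := le_trans (normr_ge0 _) (fC 1); rewrite expr1n mulr1.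
have H : h^-1 *: ((f \o shift 0) (h *: (1 : R)) - f 0) @[h --> (0 : R)^'] --> (0 : R).
  apply/cvgrPdist_le => e e0.
  have d0 : 0 < e / (C + 1) by rewrite divr_gt0// ltr_wpDl.
  near=> h; rewrite /= addr0 f0 subr0 sub0r normrN [h *: 1]mulr1.
  rewrite normrM normrV ?unitfE; last by near: h; exact: nbhs_dnbhs_neq.
  have hn0 : 0 < `|h| by rewrite normr_gt0; near: h; exact: nbhs_dnbhs_neq.
  rewrite mulrC ler_pdivrMr//; apply: le_trans (fC h) _.
  rewrite -real_normK ?num_real// expr2 mulrA ler_wpM2r//.
  have : `|h| < e / (C + 1) by near: h; exact: dnbhs0_lt.
  rewrite ltr_pdivlMr ?ltr_wpDl// => he; apply: le_trans (ltW he).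
  by rewrite mulrC ler_wpM2l// lerDl.
split; first by apply/cvg_ex; exists 0.
exact: (cvg_lim _ H).
Unshelve. all: by end_near. Qed.

Lemma is_derive_flat k (s : R) :
  is_derive s 1 (flat k) (- k%:R * flat k.+1 s + flat k.+2 s).
Proof.
have [s0|s0|->] := ltgtP s 0.
- rewrite !flat_le0 ?(ltW s0)// mulr0 addr0.
  have H : is_derive s 1 (fun=> 0 : R) 0 by exact: is_derive_cst.
  apply: near_eq_is_derive H; near=> t; rewrite flat_le0//; apply: ltW; near: t; exact: lt_nbhsl.
- have sn0 : s != 0 by rewrite gt_eqF.
  have dg : is_derive s 1 (fun t : R => t^-1) (- s^-1 ^+ 2).
    apply: is_derive_eq; first exact: (is_deriveV sn0 (is_derive_id s 1)).
    by rewrite exprVn [_ *: _]mulr1.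
  have dH : is_derive s^-1 1 (fun y : R => y ^+ k * expR (- y))
     (k%:R * s^-1 ^+ k.-1 * expR (- s^-1) - s^-1 ^+ k * expR (- s^-1)).
    have dN : is_derive s^-1 1 (fun y : R => - y) (-1).
      exact: (is_deriveN (is_derive_id s^-1 1)).
    have dE : is_derive s^-1 1 (fun y : R => expR (- y)) (expR (- s^-1) * -1).
      exact: (is_derive1_comp (is_derive_expR (- s^-1)) dN).
    have dX : is_derive s^-1 1 (fun y : R => y ^+ k) (k%:R * s^-1 ^+ k.-1).
      rewrite -[X in is_derive _ _ X _]/(fun y : R => id y ^+ k) -exprfctE.
      by apply: is_derive_eq; rewrite [_ *: _]mulr1.
    rewrite (_ : (fun y => _) = (fun y : R => y ^+ k) * (fun y : R => expR (- y)))//.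
    apply: (is_derive_eq (is_deriveM dX dE)).
    by rewrite /= /GRing.scale /=; ring.
  have := is_derive1_comp dH dg.
  rewrite /flat s0 => D1.
  have H : is_derive s 1 (flat k) ((k%:R * s^-1 ^+ k.-1 * expR (- s^-1) -
      s^-1 ^+ k * expR (- s^-1)) * - s^-1 ^+ 2).
    apply: near_eq_is_derive D1; near=> t; rewrite /= /flat.
    by have -> : 0 < t by near: t; exact: lt_nbhsr.
  apply: is_derive_eq H _.
  by case: (k) => [|l] /=; rewrite !exprS; ring.
- rewrite !flat_le0// mulr0 addr0; exact: (is_derive0_quadratic (flat_le k)).
Unshelve. all: by end_near. Qed.

Lemma flat_derivable k (s : R) : derivable (flat k) s 1.
Proof. by have [] := is_derive_flat k s. Qed.

Lemma flat_continuous k (s : R) : {for s, continuous (flat k)}.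
Proof. by apply: differentiable_continuous; apply/derivable1_diffP; exact: flat_derivable. Qed.

Lemma derive1_flat k (s : R) :
  (flat k)^`()%classic s = - k%:R * flat k.+1 s + flat k.+2 s.
Proof. by rewrite derive1E; have [_ ->] := is_derive_flat k s. Qed.

Lemma smooth_flat_comp {n} k (q : 'rV[R]_n -> R) : smooth setT q ->
  smooth setT (fun x => flat k (q x)).
Proof.
move=> Cq l; elim: l k => [|l IH] k.
  split=> // x _; apply: continuous_comp; first exact: (Ck_continuous (Cq 0%N) I).
  exact: flat_continuous.
have dq x i : derivable q x (delta_mx ord0 i) by exact: (Ck_derivable (Cq 1%N) I).
split=> [x _|i].
  apply: continuous_comp; first exact: (Ck_continuous (Cq 0%N) I).
  exact: flat_continuous.
split=> [x _|].
  by have [] := derivable_comp1 (dq x i) (@flat_derivable k (q x)).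
apply: (@Ck_eq _ _ _ _ (fun x =>
  (- k%:R * flat k.+1 (q x) + flat k.+2 (q x)) * partial i q x)).
- exact: openT.
- move=> x _; rewrite partial_comp1 ?derive1_flat//; exact: flat_derivable.
apply: (CkM openT) (Ck_partial i (Cq l.+1)).
by apply: (CkD openT (CkZ _ openT (IH _)) (IH _)).
Qed.

Context {n : nat}.
Variables (p : 'rV[R]_n) (r : R).

(** A sum of squares, since the sup norm is not smooth. For r > 0 the function is positive exactly
    on the open Euclidean ball, which lies in the sup-norm ball of the same radius. *)
Definition ball_fun (x : 'rV[R]_n) : R := r ^+ 2 - \sum_i (x ord0 i - p ord0 i) ^+ 2.

Let Ccoord k i : Ck k setT (fun x : 'rV[R]_n => x ord0 i - p ord0 i).
Proof. exact: (CkB openT (Ck_coord k i openT) (Ck_cst _ _ _)). Qed.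

Lemma smooth_ball_fun : smooth setT ball_fun.
Proof.
move=> k; apply: (CkB openT (Ck_cst _ _ _)); apply: (Ck_sum _ openT) => i _.
exact: (CkM openT (Ccoord k i) (Ccoord k i)).
Qed.

Lemma partial_ball_fun i x : partial i ball_fun x = - 2 * (x ord0 i - p ord0 i).
Proof.
have C1 j : Ck 1 setT (fun x : 'rV[R]_n => (x ord0 j - p ord0 j) ^+ 2).
  exact: (CkM openT (Ccoord 1%N j) (Ccoord 1%N j)).
have dc j : derivable (fun x : 'rV[R]_n => x ord0 j - p ord0 j) x (delta_mx ord0 i).
  exact: (Ck_derivable (Ccoord 1%N j) I).
have dE j : partial i (fun x : 'rV[R]_n => x ord0 j - p ord0 j) x = (i == j)%:R.
  rewrite partialD.
  - by rewrite partial_cst partial_coord addr0.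
  - exact: (Ck_derivable (Ck_coord 1%N j openT) I).
  - exact: (Ck_derivable (Ck_cst 1%N setT (- p ord0 j)) I).
rewrite (partial_eq (f := ball_fun) (g := fun x => r ^+ 2 +
   -1 * \sum_i (x ord0 i - p ord0 i) ^+ 2) i openT _ I); last first.
  by move=> y _; rewrite mulN1r.
have CS : Ck 1 setT (fun x : 'rV[R]_n => \sum_i (x ord0 i - p ord0 i) ^+ 2).
  by apply: (Ck_sum _ openT) => j _; exact: C1.
rewrite partialD; last 2 first.
- exact: (Ck_derivable (Ck_cst 1%N setT (r ^+ 2)) I).
- exact: (Ck_derivable (CkZ _ openT CS) I).
rewrite partial_cst add0r partialZ; last exact: (Ck_derivable CS I).
rewrite (partial_sum _ i openT C1 I) (bigD1 i)//= big1 => [|j ji].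
  by rewrite (partialM (dc i) (dc i)) dE eqxx /= mulr1n; ring.
by rewrite (partialM (dc j) (dc j)) dE eq_sym (negbTE ji) /= mulr0n; ring.
Qed.

Lemma ball_fun_pos x : 0 < r -> 0 < ball_fun x -> `|p - x| < r.
Proof.
move=> r0; rewrite subr_gt0 => h; apply: normr_row_lt => // i.
rewrite !mxE distrC -(ltr_pXn2r (n := 2))// ?nnegrE ?normr_ge0 ?(ltW r0)//.
rewrite real_normK ?num_real//; apply: le_lt_trans h.
by rewrite (bigD1 i)//= lerDl sumr_ge0// => j _; exact: sqr_ge0.
Qed.

Lemma partial_bump i x :
  partial i (fun x => flat 0 (ball_fun x)) x = flat 2 (ball_fun x) * (- 2 * (x ord0 i - p ord0 i)).
Proof.
rewrite partial_comp1.
- by rewrite derive1_flat partial_ball_fun oppr0 mul0r add0r.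
- exact: (Ck_derivable (smooth_ball_fun 1%N) I).
- exact: flat_derivable.
Qed.

End Bump.

(** * Properties of the second operator *)

Section ShiftedOperator.
Context {R : realType} {n : nat}.
Implicit Types (x : 'rV[R]_n) (G : 'rV[R]_n -> 'M[R]_n.+1) (a : 'rV[R]_n -> R).
Implicit Types (Omega S : set 'rV[R]_n).

Lemma time_shiftS a G x j k : time_shift a G x j (lift ord0 k) =
  G x j (lift ord0 k) - (j == ord0)%:R *
    \sum_p no_time (grad a x) ord0 p * G x p (lift ord0 k).
Proof.
rewrite time_shiftE -(sum_shear a x j (fun p => G x p (lift ord0 k))).
apply: eq_bigr => p _.
rewrite (eq_bigr (fun q => shear a x (lift ord0 k) q * (shear a x j p * G x p q))).
  by rewrite sum_shear mul0r subr0.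
by move=> q _; rewrite mulrC.
Qed.

Lemma time_shift00 a G x : time_shift a G x ord0 ord0 = G x ord0 ord0 -
  \sum_p no_time (grad a x) ord0 p * (G x ord0 p + G x p ord0) +
  \sum_p \sum_q no_time (grad a x) ord0 p * (no_time (grad a x) ord0 q * G x p q).
Proof.
set r := no_time (grad a x).
have E p : \sum_q shear a x ord0 p * G x p q * shear a x ord0 q =
    shear a x ord0 p * (G x p ord0 - \sum_q r ord0 q * G x p q).
  rewrite -[X in _ - X]mul1r -(sum_shear a x ord0 (fun q => G x p q)) mulr_sumr.
  by apply: eq_bigr => q _; rewrite -mulrA [G x p q * _]mulrC.
rewrite time_shiftE (eq_bigr _ (fun p _ => E p)) sum_shear mul1r -/r.
have -> : \sum_p r ord0 p * (G x ord0 p + G x p ord0) =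
    (\sum_p r ord0 p * G x ord0 p) + \sum_p r ord0 p * G x p ord0.
  by rewrite -big_split; apply: eq_bigr => p _; rewrite mulrDr.
have -> : \sum_p r ord0 p * (G x p ord0 - \sum_q r ord0 q * G x p q) =
    (\sum_p r ord0 p * G x p ord0) - \sum_p \sum_q r ord0 p * (r ord0 q * G x p q).
  by rewrite -sumrB; apply: eq_bigr => p _; rewrite mulrBr mulr_sumr.
by ring.
Qed.

(** The shear changes only entries with an index 0, so the spatial block is the same. *)
Lemma Delta_time_shift a G x : Delta (time_shift a G) x = Delta G x.
Proof.
congr (\det _); apply/matrixP => j k; rewrite [LHS]mxE [LHS]mxE time_shiftS.
by rewrite mul0r subr0 [RHS]mxE [RHS]mxE.
Qed.

Lemma time_shift_moves a G x : Delta G x != 0 -> grad a x <> 0 ->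
  time_shift a G x <> G x.
Proof.
move=> D0 ga E; apply: ga.
have u : row' ord0 (col' ord0 (G x)) \in unitmx by rewrite unitmxE unitfE.
apply: (can_inj (mulmxK u)); rewrite mul0mx; apply/rowP => k; rewrite !mxE.
have := congr1 (fun M : 'M[R]_n.+1 => M ord0 (lift ord0 k)) E.
rewrite time_shiftS mul1r => /eqP; rewrite -subr_eq0 addrAC subrr add0r oppr_eq0.
rewrite big_ord_recl no_time0 mul0r add0r => /eqP h; rewrite -[RHS]h.
by apply: eq_bigr => i _; rewrite no_timeS !mxE.
Qed.

(** Symmetry and signature survive every invertible congruence, but the sign of the time entry need
    not, hence the last hypothesis. *)
Lemma wave_time_shift Omega G a : smooth setT a -> wave_coefficients Omega G ->
  (forall x, closure Omega x -> 0 < time_shift a G x ord0 ord0) ->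
  wave_coefficients Omega (time_shift a G).
Proof.
move=> Ca [[U [oU OU] CG] sG LG _] pos; split=> //.
- exists U => // j k l.
  apply: (@Ck_eq _ _ _ _ (fun x => 1 * time_shift a G x j k)).
  + exact: oU.
  + by move=> x _; rewrite mul1r.
  apply: (Ck_time_shift Ca oU) => p q.
  exact: (CkM oU (Ck_cst _ _ _) (CG p q l)).
- by move=> x Ox; rewrite /time_shift !trmx_mul trmxK (sG x Ox) mulmxA.
move=> x Ox; have [P Pu PE] := LG x Ox.
have Mu := shear_unit a x.
exists (P *m invmx (shear a x)); first by rewrite unitmx_mul Pu unitmx_inv.
rewrite -PE /time_shift trmx_mul -!mulmxA; congr (_ *m _).
rewrite mulKmx//; congr (_ *m _).
by rewrite mulmxA -trmx_mul mulVmx// trmx1 mul1mx.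
Qed.

Lemma ergosphere_time_shift Omega S G a : has_ergosphere Omega S G ->
  has_ergosphere Omega S (time_shift a G).
Proof.
move=> [SE h1 h2]; split.
- by rewrite SE; apply/seteqP; split=> x /=; rewrite Delta_time_shift.
- by move=> x cx Ex; rewrite Delta_time_shift; exact: h1.
- by move=> x cx Ex; rewrite Delta_time_shift; exact: h2.
Qed.

(** The inverse change of variables is the shift by [- a], of the same kind, so solutions are
    carried over both ways. *)
Lemma solvable_data_time_shift Omega G a (A : R) : open Omega ->
  smooth setT a -> (forall x, `|a x| <= A) -> (forall x, boundary Omega x -> a x = 0) ->
  wave_coefficients Omega G -> wave_coefficients Omega (time_shift a G) ->
  solvable_data Omega G = solvable_data Omega (time_shift a G).
Proof.
move=> oO Ca aA a0 hG hG2; apply/seteqP; split=> f [bf [u hu]]; split=> //.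
  by exists (fun z => u (delay a z)); exact: (ibvp_time_shift Ca oO hG aA a0).
pose na y := - a y.
have CN : smooth setT na by move=> k; exact: (CkN openT (Ca k)).
exists (fun z => u (delay na z)).
rewrite (_ : G = time_shift na (time_shift a G)); last first.
  by apply/funext => x; rewrite (time_shiftK _ _ (Ca 1%N)).
apply: (ibvp_time_shift CN oO hG2 (A := A)) hu.
- by move=> x; rewrite normrN.
- by move=> x bx; rewrite /na a0 ?oppr0.
Qed.

Lemma bump_time_shift Omega G (p : 'rV[R]_n) (r : R) : (0 < n)%N -> compact (closure Omega) ->
  wave_coefficients Omega G -> 0 < r ->
  exists a (A : R), [/\ smooth setT a, forall x, `|a x| <= A,
    forall x, ~ `|p - x| < r -> a x = 0 /\ grad a x = 0,
    exists2 x, `|p - x| < r & grad a x <> 0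
  & wave_coefficients Omega (time_shift a G)].
Proof.
move=> n0 cO hG r0; have [[U [oU OU] CG] _ _ pG] := hG.
pose e x := flat 0 (ball_fun p r x).
have Ce : smooth setT e := smooth_flat_comp 0 (smooth_ball_fun p r).
pose c x k := no_time (grad e x) ord0 k.
have Cc k : Ck 0 U (fun x => c x k) by apply: Ck_sub (Ck_slope Ce 0%N k).
have CG0 j k : Ck 0 U (fun x => G x j k) := CG j k 0%N.
pose h1 x := \sum_k c x k * (G x ord0 k + G x k ord0).
pose h2 x := \sum_j \sum_k c x j * (c x k * G x j k).
have Ch1 : Ck 0 U h1.
  by apply: (Ck_sum _ oU) => k _; exact: (CkM oU (Cc k) (CkD oU (CG0 _ _) (CG0 _ _))).
have Ch2 : Ck 0 U h2.
  apply: (Ck_sum _ oU) => j _; apply: (Ck_sum _ oU) => k _.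
  exact: (CkM oU (Cc j) (CkM oU (Cc k) (CG0 _ _))).
have [C1 C10 H1] := bounded_on_compact cO (fun x Ox => Ck_continuous Ch1 (OU x Ox)).
have [C2 C20 H2] := bounded_on_compact cO (fun x Ox => Ck_continuous Ch2 (OU x Ox)).
have cV x : closure Omega x -> {for x, continuous (fun y => (G y ord0 ord0)^-1)}.
  move=> Ox; apply: continuousV; first by rewrite gt_eqF// pG.
  exact: (Ck_continuous (CG0 _ _) (OU x Ox)).
have [C3 C30 H3] := bounded_on_compact cO cV.
have q0 : 0 < 1 + C3 * (C1 + C2) by rewrite addr_gt0// mulr_gt0// addr_gt0.
(* The new time entry is the old one, at least [C3^-1], minus [s * h1 x] plus [s ^+ 2 * h2 x]. It
   stays positive if [s * (C1 + C2) < C3^-1] and [s <= 1]; the added 1 gives both. *)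
have [s sE] : exists s, s = (1 + C3 * (C1 + C2))^-1 by eexists.
have s0 : 0 < s by rewrite sE invr_gt0.
have s1 : s <= 1 by rewrite sE invf_le1// lerDl mulr_ge0 ?addr_ge0// ltW.
have sC : s * (C3 * (C1 + C2)) < 1.
  by rewrite sE ltr_pdivrMl// mulr1 ltrDr.
pose a x := s * e x.
have Ca : smooth setT a by move=> k; exact: (CkZ _ openT (Ce k)).
have aE i x : partial i a x = s * (flat 2 (ball_fun p r x) * (- 2 * (x ord0 i - p ord0 i))).
  by rewrite partialZ ?partial_bump//; exact: (Ck_derivable (Ce 1%N) I).
exists a, s; split.
- exact: Ca.
- move=> x; rewrite normrM gtr0_norm// -[leRHS]mulr1 ler_wpM2l ?(ltW s0)//.
  exact: flat_le1.
- move=> x nx; have b0 : ball_fun p r x <= 0.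
    by rewrite leNgt; apply/negP => /(ball_fun_pos r0).
  split; first by rewrite /a /e flat_le0// mulr0.
  by apply/rowP => i; rewrite !mxE aE flat_le0// mul0r mulr0.
(* A point off the centre, since the gradient of the bump vanishes at p. *)
- pose i0 := Ordinal n0; pose x := p + (r / 2) *: delta_mx ord0 i0.
  have xp i : x ord0 i - p ord0 i = r / 2 * (i == i0)%:R.
    by rewrite /x !mxE eqxx addrAC subrr add0r.
  have b0 : 0 < ball_fun p r x.
    rewrite /ball_fun (bigD1 i0)//= xp eqxx mulr1 big1 ?addr0.
      by rewrite exprMn; have := exprn_gt0 2 r0; lra.
    by move=> i /negPf ii; rewrite xp ii mulr0 expr0n.
  exists x; first exact: ball_fun_pos.
  move=> /rowP/(_ i0); rewrite !mxE aE xp eqxx mulr1 => /eqP.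
  rewrite (_ : - 2 * (r / 2) = - r); last by field.
  by rewrite !mulrN oppr_eq0 gt_eqF// !mulr_gt0// flat_gt0.
apply: (wave_time_shift Ca hG) => x Ox; rewrite time_shift00.
have sc k : no_time (grad a x) ord0 k = s * c x k.
  rewrite /c; case: (unliftP ord0 k) => [i ->|->]; last by rewrite !no_time0 mulr0.
  by rewrite !no_timeS !mxE partialZ//; exact: (Ck_derivable (Ce 1%N) I).
rewrite (eq_bigr (fun k => s * (c x k * (G x ord0 k + G x k ord0)))); last first.
  by move=> k _; rewrite sc mulrA.
rewrite -mulr_sumr -/(h1 x).
rewrite (eq_bigr (fun j => s ^+ 2 * \sum_k c x j * (c x k * G x j k))); last first.
  by move=> j _; rewrite mulr_sumr; apply: eq_bigr => k _; rewrite !sc; ring.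
rewrite -mulr_sumr -/(h2 x).
have G0 := pG x Ox.
have := H3 x Ox; rewrite ger0_norm ?invr_ge0 ?(ltW G0)// -[_ ^-1]mul1r ler_pdivrMr// => h3.
have := H1 x Ox; rewrite ler_norml => /andP[_ h1'].
have := H2 x Ox; rewrite ler_norml => /andP[h2' _].
have b1 : s * h1 x <= s * C1 by rewrite ler_wpM2l// ltW.
have b2 : - (s * C2) <= s ^+ 2 * h2 x.
  rewrite -mulrN expr2 -mulrA ler_wpM2l ?(ltW s0)//.
  apply: le_trans (_ : s * - C2 <= _); last by rewrite ler_wpM2l ?(ltW s0).
  by rewrite mulrN lerN2 ler_piMl// ltW.
have b3 : s * (C1 + C2) < G x ord0 ord0.
  rewrite -(ltr_pM2l C30); apply: lt_le_trans h3.
  by rewrite mulrCA.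
lra.
Qed.

End ShiftedOperator.

Lemma remove_obstacles_open (R : realType) (n m : nat)
    (Omega0 : set 'rV[R]_n) (Obs : 'I_m -> set 'rV[R]_n) :
  open Omega0 -> open (remove_obstacles Omega0 Obs).
Proof.
move=> oO; rewrite /remove_obstacles setDE; apply: openI => //.
apply: closed_openC; apply: closed_bigcup => [|j _]; last exact: closed_closure.
exact: finite_finset.
Qed.

(** Nonuniqueness takes the form of a different second operator for every first one, with the same
    solvable data, so that the two Dirichlet-to-Neumann operators are compared on a common
    domain. *)
Theorem mainTheorem5 (R : realType) (n m : nat)
    (Omega0 : set 'rV[R]_n) (Obs : 'I_m -> set 'rV[R]_n) (Sg : set 'rV[R]_n)
    (N nu : 'rV[R]_n -> 'rV[R]_n) (G1 : 'rV[R]_n -> 'M[R]_n.+1)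
    (Omega := remove_obstacles Omega0 Obs)
    (n_ge2 : (2 <= n)%N)
    (hOmega : obstacle_domain Omega0 Obs)
    (hN : forall x, boundary Omega0 x -> outward_normal Omega0 x (N x))
    (hS : closed_surface Sg) (hSOmega : Sg `<=` Omega)
    (hSout : boundary Omega0 `<=` surf_ext Sg)
    (hobs : forall j, Obs j `&` surf_ext Sg = set0)
    (hnu : forall x, Sg x -> outward_normal (surf_int Sg) x (nu x))
    (hG1 : wave_coefficients Omega G1) (hE1 : has_ergosphere Omega Sg G1)
    (hbh : black_hole Sg nu G1) :
  (forall G2 : 'rV[R]_n -> 'M[R]_n.+1,
     wave_coefficients Omega G2 -> has_ergosphere Omega Sg G2 ->
     (forall x, (Omega `&` surf_ext Sg) x -> G1 x = G2 x) ->
     (forall f u1 u2, boundary_data Omega f ->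
        ibvp_solution Omega G1 f u1 -> ibvp_solution Omega G2 f u2 ->
        forall z, cylinder (Omega `&` surf_ext Sg) z -> u1 z = u2 z) /\
     (forall f, solvable_data Omega G1 f -> solvable_data Omega G2 f ->
        forall z, cylinder (boundary Omega0) z ->
          DtN N Omega G1 f z = DtN N Omega G2 f z)) /\
  (exists G2 : 'rV[R]_n -> 'M[R]_n.+1,
     [/\ wave_coefficients Omega G2, has_ergosphere Omega Sg G2,
         black_hole Sg nu G2,
         (forall x, (Omega `&` surf_ext Sg) x -> G1 x = G2 x) /\
         (exists2 x, (Omega `&` surf_int Sg) x & G1 x <> G2 x)
       & solvable_data Omega G1 = solvable_data Omega G2 /\
         forall f, solvable_data Omega G1 f ->
           forall z, cylinder (boundary Omega0) z ->
             DtN N Omega G1 f z = DtN N Omega G2 f z]).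
Proof.
have dtn G2 f z : wave_coefficients Omega G2 ->
    (forall x, (Omega `&` surf_ext Sg) x -> G1 x = G2 x) ->
    solvable_data Omega G1 f -> solvable_data Omega G2 f ->
    cylinder (boundary Omega0) z -> DtN N Omega G1 f z = DtN N Omega G2 f z.
  exact: (exterior_DtN n_ge2 hOmega hS hSOmega hSout hobs hnu hG1 hE1 hbh).
split=> [G2 hG2 _ hG12|].
  split=> [f u1 u2 _ h1 h2 z Dz|f s1 s2 z bz]; last exact: dtn.
  exact: (exterior_unique n_ge2 hOmega hS hSOmega hSout hobs hnu hG1 hE1 hbh hG12 h1 h2).
have [[_ oO0 bO0 _ _] _ _ _] := hOmega.
have oO : open Omega := @remove_obstacles_open R n m Omega0 Obs oO0.
have cO : compact (closure Omega).
  apply: compact_closure; have [M [Mr MP]] := bO0.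
  by exists M; split=> // K MK x [Ox _]; exact: MP.
have [[s Ss] _ _ _] := hS.
have oI : open (surf_int Sg) := open_surf_int (surface_closed hS).
(* Obstacles may occupy part of the interior, so the point is taken near the surface, which lies in
   the open set [Omega] and is a limit of interior points. *)
have [p [Op Ip]] : exists p, Omega p /\ surf_int Sg p.
  have /nbhs_rowP[r r0 rP] := open_nbhs_nbhs (conj oO (hSOmega s Ss)).
  have cs : closure (surf_int Sg) s := @surface_touches_interior R n Sg n_ge2 hS s Ss.
  have /closureP/(_ _ r0)[p Ip /rP Op] := cs.
  by exists p.
have /nbhs_rowP[r r0 rP] := open_nbhs_nbhs (conj (openI oO oI) (conj Op Ip)).
(* The shift vanishes outside a ball contained in [Omega] and in the interior, so the coefficients
   do not change in the exterior and on the surface, and the boundary data are kept. *)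
have [a [A [Ca aA a0 [x xr gx] hG2]]] := bump_time_shift p (ltnW n_ge2) cO hG1 r0.
have flat_out y : ~ surf_int Sg y -> grad a y = 0.
  by move=> nI; have [] := a0 y (fun h => nI (rP y h).2).
have hG12 y : (Omega `&` surf_ext Sg) y -> G1 y = time_shift a G1 y.
  by move=> [_ Ey]; rewrite time_shift_flat// flat_out// => /surf_int_ext.
have sol : solvable_data Omega G1 = solvable_data Omega (time_shift a G1).
  apply: (solvable_data_time_shift oO Ca aA) => // y [_ ny].
  have [] := a0 y; last by [].
  move=> /rP[Oy _]; apply: ny; exact: (open_nbhs_nbhs (conj oO Oy)).
exists (time_shift a G1); split=> //.
- exact: ergosphere_time_shift.
- move=> y Sy; have := hbh y Sy.
  rewrite /spatial_form time_shift_flat//; apply: flat_out => -[]; exact.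
- split=> //; have [Ox Ix] := rP x xr; exists x => //.
  apply/nesym/time_shift_moves => //; have [_ _ hi] := hE1.
  have := hi x (subset_closure Ox) Ix; apply: contraTneq => ->.
  by rewrite mulr0 ltxx.
split=> // f sf z bz; apply: dtn => //; by rewrite -sol.
Qed.
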